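(* Let $t\ge 1$ be a square-free odd integer. Then: (1) there are infinitely many (pairwise distinct) subfields $K$ of the field $\mathbb{Q}^{\rm tr}$ of all totally real algebraic numbers such that $\mathcal{O}_K$ has Julia Robinson number $\lceil 2\sqrt{2t}\,\rceil+2\sqrt{2t}$; (2) there are infinitely many (pairwise distinct) subfields $K$ of $\mathbb{Q}^{\rm tr}$ such that $\mathcal{O}_K$ has Julia Robinson number $8t$.
   Context: For a subfield $F$ of $\mathbb{Q}^{\rm tr}$, $\mathcal{O}_F$ denotes its ring of algebraic integers. For such a ring $R$ and $t\in\mathbb{R}\cup\{+\infty\}$, let $R_t$ be the set of $\alpha\in R$ all of whose conjugates $\beta$ satisfy $0<\beta<t$; let $A(R)=\{t\in\mathbb{R}\cup\{+\infty\} : R_t \text{ is infinite}\}$. The Julia Robinson number of $R$ is $\mathrm{JR}(R)=\inf A(R)$. $\lceil x\rceil$ denotes the smallest integer $\ge x$. *)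

(* Defs.v *)
From HB Require Import structures.
From mathcomp Require Import all_boot all_order all_algebra.
From mathcomp Require Import complex.
From mathcomp Require Import boolp classical_sets cardinality reals.
From mathcomp Require Import constructive_ereal ereal.

Set Implicit Arguments.
Unset Strict Implicit.
Unset Printing Implicit Defensive.

Import Order.TTheory GRing.Theory Num.Theory.

Local Open Scope classical_set_scope.
Local Open Scope ring_scope.
Local Open Scope complex_scope.

Definition squarefree (n : nat) : Prop :=
  forall d : nat, (d ^ 2 %| n)%N -> d = 1%N.

Section JuliaRobinson.
Variable R : realType.

(* The roots in [R[i]] of the minimal polynomial of [a] over the rationals,
   an irreducible polynomial vanishing at [a] being a scalar multiple of it.
   This set is empty when [a] is transcendental. *)
Definition conjugates (a : R[i]) : set R[i] :=
  [set b | exists p : {poly rat},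
     [/\ irreducible_poly p,
         root (map_poly (ratr : rat -> R[i]) p) a
       & root (map_poly (ratr : rat -> R[i]) p) b]].

Definition Qtr : set R[i] :=
  [set a | algebraicOver (ratr : rat -> R[i]) a /\
           forall b, conjugates a b -> exists r : R, b = r%:C].

(* In a field, [divring_closed] (contains 1, closed under difference and
   quotient) says exactly that [K] is a subfield, as x / 0 = 0. *)
Definition is_subfield (K : set R[i]) : Prop := divring_closed [in K].

Definition ring_of_integers (K : set R[i]) : set R[i] :=
  [set a | K a /\ integralOver (intr : int -> R[i]) a].

Definition conj_lt (O : set R[i]) (t : \bar R) : set R[i] :=
  [set a | O a /\
     forall b, conjugates a b -> exists2 r : R, b = r%:C & (0 < r%:E < t)%E].

Definition JR_set (O : set R[i]) : set (\bar R) :=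
  [set t | t <> -oo%E /\ infinite_set (conj_lt O t)].

Definition JR (O : set R[i]) : \bar R := ereal_inf (JR_set O).

End JuliaRobinson.

(* Main.v *)
Require Import Defs.
From mathcomp Require Import all_boot all_order all_algebra.
From mathcomp Require Import complex.
From mathcomp Require Import boolp classical_sets functions cardinality reals.
From mathcomp Require Import constructive_ereal ereal.
From mathcomp Require Import ring lra zify.

Import Order.TTheory GRing.Theory Num.Theory.
Local Open Scope classical_set_scope.
Local Open Scope ring_scope.
Local Open Scope complex_scope.
Set Implicit Arguments.
Unset Strict Implicit.
Unset Printing Implicit Defensive.

(** Both parts come from one construction. Let w > 0 with w^2 = h an even integer. Start from E = Q
    with w = 2t for the value 8t, or from E = Q(w) with w = sqrt(2t) for the other value, and adjoin
    c_0 = sqrt(delta) / w^j and then c_{n+1} = +-sqrt(2 + c_n). For every field K so obtained, O_K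
    has Julia Robinson number M + 2w, where M is the ceiling of 2w ([JR_towerK]).

    All conjugates of c_n lie in (-2, 2), and w c_n is integral once 2^n >= j. So the infinitely
    many integers M + w c_n have their conjugates in (0, M + 2w) ([JR_upper]).

    Conversely, let s < M + 2w and let x in O_K have all its conjugates in (0, s). Write x as the
    sum of a_m T_m(c_n) for m < 2^n, with T_m the Chebyshev polynomials and a_m in E(c_0). Away from
    w the a_m are integral because r = 4 h^j - delta is squarefree ([lev_coords]). At w the terms
    have pairwise distinct valuations modulo 1, which makes a_m divisible by w to the power ceil(j m
    / 2^n) ([coords_int]). Averaging (x - s/2)^2 over the embeddings above a fixed embedding of
    E(c_0) bounds a quadratic form in the a_m ([variance_lt]). An algebraic integer with all
    conjugates below 1 in absolute value is 0 ([tower_norm_lt1]). As r is large, this kills every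
    a_m with m >= 2^(n-1) ([high_coord_eq0]) and all but two of the others with m > 0
    ([at_most_two]). If the surviving terms reach a high level of the tower, suitable embeddings
    move x by about 2w or more in both directions from the rest of the sum. All conjugates of that
    rest are then trapped strictly between M - 1 and M, which no algebraic integer allows
    ([no_window]). So x lies at a bounded level ([small_in_level]), where finiteness is Northcott's
    argument ([tower_finite]).

    Infinitely many fields arise from the signs: 2 + c_n and 2 - c_n are never both squares in one
    tower, so changing one sign changes the field ([towerK_flip_inj]). Suitable r and delta come
    from congruences modulo 8 ([exists_parameters]). *)

Section Subfields.
Context {F L : numFieldType}.
Implicit Types (K : set F) (f g : F -> L) (x y s u v : F).

(** * Subfields as sets, and their embeddings *)

Record subfield K : Prop := Subfield {
  sf1 : K 1;
  sfB : forall x y, K x -> K y -> K (x - y);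
  sfM : forall x y, K x -> K y -> K (x * y);
  sfV : forall x, K x -> K x^-1 }.

(** An embedding is a total function constrained on [K] only, so that restricting it to a smaller
    field leaves the function unchanged. *)
Record hom K f : Prop := Hom {
  hom1 : f 1 = 1;
  homB : forall x y, K x -> K y -> f (x - y) = f x - f y;
  homM : forall x y, K x -> K y -> f (x * y) = f x * f y }.

Section SubfieldTheory.
Context (K : set F) (sK : subfield K).

Lemma sf0 : K 0. Proof. by rewrite -(subrr 1); apply: (sfB sK) => //; exact: (sf1 sK). Qed.

Lemma sfN x : K x -> K (- x).
Proof. by move=> Kx; rewrite -sub0r; apply: (sfB sK) => //; exact: sf0. Qed.

Lemma sfD x y : K x -> K y -> K (x + y).
Proof. by move=> Kx Ky; rewrite -[y]opprK; apply: (sfB sK) => //; exact: sfN. Qed.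

Lemma sfX x n : K x -> K (x ^+ n).
Proof.
by move=> Kx; elim: n => [|n IH]; [exact: (sf1 sK) | rewrite exprS; apply: (sfM sK)].
Qed.

Lemma sf_div x y : K x -> K y -> K (x / y).
Proof. by move=> Kx Ky; apply: (sfM sK) => //; exact: (sfV sK). Qed.

Lemma sf_nat n : K n%:R.
Proof.
by elim: n => [|n IH]; [exact: sf0 | rewrite -natr1; apply: sfD => //; exact: (sf1 sK)].
Qed.

Lemma sf_int (m : int) : K m%:~R.
Proof.
by case: m => n; [exact: sf_nat | rewrite NegzE mulrNz; apply: sfN; exact: sf_nat].
Qed.

Lemma sf_rat (z : rat) : K (ratr z).
Proof. by rewrite /ratr; apply: sf_div; exact: sf_int. Qed.

Lemma sf_sum (I : Type) (r : seq I) (P : pred I) (a : I -> F) :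
  (forall i, P i -> K (a i)) -> K (\sum_(i <- r | P i) a i).
Proof. by move=> Ka; elim/big_ind: _ => //; [exact: sf0 | exact: sfD]. Qed.

Context (f : F -> L) (hf : hom K f).

Lemma hom0 : f 0 = 0.
Proof. by rewrite -(subrr 1) (homB hf) ?subrr //; exact: (sf1 sK). Qed.

Lemma homN x : K x -> f (- x) = - f x.
Proof. by move=> Kx; rewrite -sub0r (homB hf) ?hom0 ?sub0r //; exact: sf0. Qed.

Lemma homD x y : K x -> K y -> f (x + y) = f x + f y.
Proof.
by move=> Kx Ky; rewrite -{1}[y]opprK (homB hf) ?homN ?opprK //; exact: sfN.
Qed.

Lemma homX x n : K x -> f (x ^+ n) = f x ^+ n.
Proof.
move=> Kx; elim: n => [|n IH]; first exact: (hom1 hf).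
by rewrite !exprS (homM hf) ?IH //; exact: sfX.
Qed.

Lemma hom_nat n : f n%:R = n%:R.
Proof.
elim: n => [|n IH]; first exact: hom0.
by rewrite -!natr1 homD ?IH ?(hom1 hf) //; [exact: sf_nat | exact: (sf1 sK)].
Qed.

Lemma hom_int (m : int) : f m%:~R = m%:~R.
Proof.
case: m => n; first exact: hom_nat.
by rewrite NegzE !mulrNz homN ?hom_nat //; exact: sf_nat.
Qed.

Lemma homV x : K x -> f x^-1 = (f x)^-1.
Proof.
move=> Kx; have [->|x0] := eqVneq x 0; first by rewrite invr0 hom0 invr0.
have E : f x * f x^-1 = 1.
  by rewrite -(homM hf) ?mulfV ?(hom1 hf) //; exact: (sfV sK).
have fx0 : f x != 0.
  by apply/eqP => fx0; move/eqP: E; rewrite fx0 mul0r eq_sym oner_eq0.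
by apply: (mulfI fx0); rewrite E mulfV.
Qed.

Lemma hom_div x y : K x -> K y -> f (x / y) = f x / f y.
Proof. by move=> Kx Ky; rewrite (homM hf) ?homV //; exact: (sfV sK). Qed.

Lemma hom_rat (z : rat) : f (ratr z) = ratr z.
Proof. by rewrite /ratr hom_div ?hom_int //; exact: sf_int. Qed.

Lemma hom_sum (I : Type) (r : seq I) (P : pred I) (a : I -> F) :
  (forall i, K (a i)) ->
  f (\sum_(i <- r | P i) a i) = \sum_(i <- r | P i) f (a i).
Proof.
move=> Ka; elim: r => [|i r IH]; first by rewrite !big_nil hom0.
rewrite !big_cons; case: ifP => // _; rewrite homD ?IH //.
by apply: sf_sum => ? _.
Qed.

Lemma hom_eq0 x : K x -> f x = 0 -> x = 0.
Proof.
move=> Kx fx0; apply/eqP; apply: contra_eqT (hom1 hf) => x0.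
by rewrite -(mulfV x0) (homM hf) ?fx0 ?mul0r 1?eq_sym ?oner_eq0 //; exact: (sfV sK).
Qed.

Lemma sf_horner (p : {poly rat}) x : K x -> K (map_poly ratr p).[x].
Proof.
move=> Kx; elim/poly_ind: p => [|p c IH].
  by rewrite rmorph0 horner0; exact: sf0.
rewrite rmorphD rmorphM /= map_polyX map_polyC /= hornerMXaddC.
by apply: sfD; [exact: (sfM sK) | exact: sf_rat].
Qed.

Lemma hom_horner (p : {poly rat}) x : K x ->
  f (map_poly ratr p).[x] = (map_poly ratr p).[f x].
Proof.
move=> Kx; elim/poly_ind: p => [|p c IH].
  by rewrite !rmorph0 !horner0 hom0.
rewrite !rmorphD !rmorphM /= !map_polyX !map_polyC /= !hornerMXaddC.
have Kp := sf_horner p Kx.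
rewrite homD ?(homM hf Kp Kx) ?IH ?hom_rat //; [exact: (sfM sK) | exact: sf_rat].
Qed.

End SubfieldTheory.

(** * Adjoining a square root and extending embeddings to it *)

Definition adj K s : set F := [set x | exists u v, [/\ K u, K v & x = u + v * s]].

Section Adjunction.
Context (K : set F) (s : F) (sK : subfield K) (Ks2 : K (s ^+ 2)).

Lemma adj_sub : K `<=` adj K s.
Proof. by move=> x Kx; exists x, 0; split; rewrite ?mul0r ?addr0 //; exact: sf0. Qed.

Lemma adj_gen : adj K s s.
Proof.
by exists 0, 1; split; rewrite ?mul1r ?add0r //; [exact: sf0 | exact: (sf1 sK)].
Qed.

Context (nKs : ~ K s).

Lemma adj_eq0 u v : K u -> K v -> u + v * s = 0 -> u = 0 /\ v = 0.
Proof.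
move=> Ku Kv; have [->|v0] := eqVneq v 0; first by rewrite mul0r addr0.
move=> E; exfalso; apply: nKs.
have -> : s = - u / v by rewrite -[u](addrK (v * s)) E; field.
by apply: sf_div => //; exact: sfN.
Qed.

Lemma adj_inj u v u' v' : K u -> K v -> K u' -> K v' ->
  u + v * s = u' + v' * s -> u = u' /\ v = v'.
Proof.
move=> Ku Kv Ku' Kv' /eqP; rewrite -subr_eq0 => /eqP E.
have [] := @adj_eq0 (u - u') (v - v').
- exact: (sfB sK).
- exact: (sfB sK).
- by rewrite -[RHS]E; ring.
by move=> /subr0_eq-> /subr0_eq->.
Qed.

Lemma adj_norm_eq0 u v : K u -> K v -> u ^+ 2 - v ^+ 2 * s ^+ 2 = 0 ->
  u = 0 /\ v = 0.
Proof.
move=> Ku Kv E; have /eqP : (u + v * s) * (u + (- v) * s) = 0.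
  by rewrite -[RHS]E; ring.
rewrite mulf_eq0 => /orP[] /eqP; first exact: adj_eq0.
by case/adj_eq0 => //; [exact: sfN | move=> -> /eqP; rewrite oppr_eq0 => /eqP].
Qed.

Lemma adj_subfield : subfield (adj K s).
Proof.
split.
- by apply: adj_sub; exact: (sf1 sK).
- move=> _ _ [u [v [Ku Kv ->]]] [u' [v' [Ku' Kv' ->]]].
  by exists (u - u'), (v - v'); split; [exact: (sfB sK) | exact: (sfB sK) | ring].
- move=> _ _ [u [v [Ku Kv ->]]] [u' [v' [Ku' Kv' ->]]].
  exists (u * u' + v * v' * s ^+ 2), (u * v' + v * u'); split; last by ring.
  + by apply: sfD => //; repeat apply: (sfM sK) => //.
  + by apply: sfD => //; exact: (sfM sK).
- move=> _ [u [v [Ku Kv ->]]].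
  have [E|N0] := eqVneq (u ^+ 2 - v ^+ 2 * s ^+ 2) 0.
    have [-> ->] := adj_norm_eq0 Ku Kv E.
    by rewrite mul0r addr0 invr0; apply: adj_sub; exact: sf0.
  have KN : K (u ^+ 2 - v ^+ 2 * s ^+ 2).
    by apply: (sfB sK) => //; [exact: sfX | apply: (sfM sK) => //; exact: sfX].
  exists (u / (u ^+ 2 - v ^+ 2 * s ^+ 2)), (- v / (u ^+ 2 - v ^+ 2 * s ^+ 2)).
  split; [exact: sf_div | by apply: sf_div => //; exact: sfN |].
  have uv0 : u + v * s != 0.
    apply: contra N0 => /eqP E.
    have -> : u ^+ 2 - v ^+ 2 * s ^+ 2 = (u + v * s) * (u - v * s) by ring.
    by rewrite E mul0r.
  apply: (mulfI uv0); rewrite mulfV // -[LHS](mulfV N0) -!mulrA; ring.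
Qed.

Lemma hom_ext f (s' : L) : hom K f -> s' ^+ 2 = f (s ^+ 2) ->
  exists g, [/\ hom (adj K s) g, forall x, K x -> g x = f x, g s = s' &
    forall u v, K u -> K v -> g (u + v * s) = f u + f v * s'].
Proof.
move=> hf s'2.
pose Q x (p : F * F) := [/\ K p.1, K p.2 & x = p.1 + p.2 * s].
pose g x := if pselect (exists p, Q x p) is left P
  then f (projT1 (cid P)).1 + f (projT1 (cid P)).2 * s' else 0.
have gE u v : K u -> K v -> g (u + v * s) = f u + f v * s'.
  move=> Ku Kv; rewrite /g; case: pselect => [P|]; last by case; exists (u, v).
  by case: cid => -[u' v'] /= [/= Ku' Kv' /adj_inj[]// -> ->].
exists g; split => //; last first.
- rewrite -[X in g X]add0r -[X in _ + X]mul1r gE ?(hom0 sK hf) ?(hom1 hf) ?mul1r ?add0r //.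
    exact: sf0.
  exact: (sf1 sK).
- move=> x Kx; rewrite -{1}[x]addr0 -(mul0r s) gE ?(hom0 sK hf) ?mul0r ?addr0 //.
  exact: sf0.
split.
- rewrite -{1}[1]addr0 -(mul0r s) gE ?(hom0 sK hf) ?mul0r ?addr0 ?(hom1 hf) //.
    exact: (sf1 sK).
  exact: sf0.
- move=> _ _ [u [v [Ku Kv ->]]] [u' [v' [Ku' Kv' ->]]].
  have -> : u + v * s - (u' + v' * s) = (u - u') + (v - v') * s by ring.
  rewrite !gE ?(homB hf) //; try exact: (sfB sK).
  by ring.
- move=> _ _ [u [v [Ku Kv ->]]] [u' [v' [Ku' Kv' ->]]].
  have -> : (u + v * s) * (u' + v' * s) =
    (u * u' + v * v' * s ^+ 2) + (u * v' + v * u') * s by ring.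
  have Kuu := sfM sK Ku Ku'; have Kvv := sfM sK Kv Kv'.
  have Kuv := sfM sK Ku Kv'; have Kvu := sfM sK Kv Ku'.
  have Kvs := sfM sK Kvv Ks2.
  rewrite !gE //; [|exact: sfD|exact: sfD].
  rewrite !(homD sK hf) // (homM hf Kvv Ks2) (homM hf Ku Ku') (homM hf Kv Kv').
  by rewrite (homM hf Ku Kv') (homM hf Kv Ku') -s'2; ring.
Qed.

End Adjunction.

End Subfields.

Lemma hom_sub (F L : numFieldType) (K K' : set F) (f : F -> L) :
  K `<=` K' -> hom K' f -> hom K f.
Proof. by move=> KK' [f1 fB fM]; split=> // x y /KK' Kx /KK' Ky; auto. Qed.

Lemma hom_id (F : numFieldType) (K : set F) : hom K (@id F).
Proof. by []. Qed.

Lemma map_poly_intrE (F : numFieldType) (p : {poly int}) :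
  map_poly intr p = map_poly ratr (map_poly intr p : {poly rat}) :> {poly F}.
Proof. by rewrite -map_poly_comp; apply: eq_map_poly => m /=; rewrite ratr_int. Qed.

(** * Algebraic integers *)

Section Integers.
Context {F : numFieldType}.
Implicit Types x y : F.

Definition OO : set F := [set x | integralOver (intr : int -> F) x].

Lemma OO_int (m : int) : OO m%:~R.
Proof. exact: (@integral_id _ _ intr). Qed.

Lemma OO_nat n : OO n%:R.
Proof. exact: (OO_int n). Qed.

Lemma OO0 : OO 0. Proof. exact: (OO_nat 0). Qed.
Lemma OO1 : OO 1. Proof. exact: (OO_nat 1). Qed.

Lemma OON x : OO x -> OO (- x).
Proof. exact: integral_opp. Qed.

Lemma OOD x y : OO x -> OO y -> OO (x + y).
Proof. exact: integral_add. Qed.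

Lemma OOB x y : OO x -> OO y -> OO (x - y).
Proof. exact: integral_sub. Qed.

Lemma OOM x y : OO x -> OO y -> OO (x * y).
Proof. exact: integral_mul. Qed.

Lemma OOX x n : OO x -> OO (x ^+ n).
Proof.
by move=> Ox; elim: n => [|n IH]; [exact: OO1 | rewrite exprS; apply: OOM].
Qed.

Lemma OO_sum (I : Type) (r : seq I) (P : pred I) (a : I -> F) :
  (forall i, P i -> OO (a i)) -> OO (\sum_(i <- r | P i) a i).
Proof. by move=> Oa; elim/big_ind: _ => //; [exact: OO0 | exact: OOD]. Qed.

Lemma OO_rootX x n : (0 < n)%N -> OO (x ^+ n) -> OO x.
Proof.
move=> n0 Ox; apply: (@integral_root_monic _ _ _ x ('X^n - (x ^+ n)%:P)).
- by apply: monicXnsubC.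
- by rewrite rootE !hornerE subrr.
apply/integral_poly => i; rewrite coefB coefXn coefC.
by apply: OOB; [exact: OO_nat | case: ifP => // _; exact: OO0].
Qed.

Lemma OO_quadratic x a b : OO a -> OO b -> x ^+ 2 - a * x + b = 0 -> OO x.
Proof.
move=> Oa Ob E; apply: (@integral_root_monic _ _ _ x ('X^2 + (- a *: 'X + b%:P))).
- apply/monicP; rewrite lead_coefDl ?lead_coefXn // size_polyXn.
  rewrite ltnS; apply: (leq_trans (size_polyD _ _)); rewrite geq_max.
  by rewrite (leq_trans (size_scale_leq _ _)) ?size_polyX // (leq_trans (size_polyC_leq1 _)).
- by apply/eqP; rewrite -[RHS]E !(hornerD, hornerZ, hornerXn, hornerX, hornerC); ring.
apply/integral_poly => i; rewrite !coefD coefXn coefZ coefX coefC.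
apply: OOD; first exact: OO_nat.
apply: OOD; first by apply: OOM; [exact: OON | exact: OO_nat].
by case: ifP => // _; exact: OO0.
Qed.

(** Gauss's lemma: the factor ['X - z] of a monic integer polynomial is [a] times an integer
    polynomial whose leading coefficient divides 1, so [a] is an integer too. *)
Lemma OO_rat (z : rat) : OO (ratr z : F) -> exists m : int, ratr z = m%:~R :> F.
Proof.
case=> p p_mon; rewrite map_poly_intrE fmorph_root -dvdp_XsubCl => /dvdpP_rat_int[p1 [a a0 Ea]] [r Er].
have lp : lead_coef p1 * lead_coef r = 1 by rewrite -lead_coefM -Er (monicP p_mon).
have la : a * (lead_coef p1)%:~R = 1.
  have := congr1 lead_coef Ea; rewrite lead_coefXsubC lead_coefZ.
  by rewrite lead_coef_map_inj //; exact: intr_inj.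
have aE : a = (lead_coef r)%:~R.
  have -> : a = a * (lead_coef p1 * lead_coef r)%:~R by rewrite lp mulr1.
  by rewrite intrM mulrA la mul1r.
have := congr1 (fun q : {poly rat} => q`_0) Ea.
rewrite /= coefB coefX coefC coefZ coef_map /= sub0r aE -intrM => /(canRL opprK) ->.
by exists (- (lead_coef r * p1`_0)); rewrite -mulrNz ratr_int.
Qed.

End Integers.

Lemma OO_hom (F L : numFieldType) (K : set F) (f : F -> L) x :
  subfield K -> hom K f -> K x -> OO x -> OO (f x).
Proof.
move=> sK hf Kx [p p_mon px]; exists p => //.
move: px; rewrite !rootE (@map_poly_intrE F) (@map_poly_intrE L) -(hom_horner sK hf) // => /eqP->.
by rewrite (hom0 sK hf).
Qed.

(** * Totally real towers of quadratic extensions of Q *)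

Section Towers.
Context {R : realType}.
Implicit Types (K : set R) (f g : R -> R) (s x u v w : R).

Definition rats : set R := [set x | exists z : rat, x = ratr z].

Lemma rats_subfield : subfield rats.
Proof.
split.
- by exists 1; rewrite rmorph1.
- by move=> _ _ [x ->] [y ->]; exists (x - y); rewrite rmorphB.
- by move=> _ _ [x ->] [y ->]; exists (x * y); rewrite rmorphM.
- by move=> _ [x ->]; exists x^-1; rewrite fmorphV.
Qed.

Lemma hom_rats (L : numFieldType) (f : R -> L) (z : rat) :
  hom rats f -> f (ratr z) = ratr z.
Proof. by move=> hf; apply: (hom_rat rats_subfield hf). Qed.

(** Positivity of [f (s ^+ 2)] under every real embedding keeps the tower totally real. The
    denominator [d] makes [s] algebraic and bounds denominators in [tower_finite]. *)
Inductive tower : set R -> Prop :=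
| tower_rats : tower rats
| tower_adj K s : tower K -> K (s ^+ 2) -> ~ K s ->
    (exists2 d : int, d != 0 & OO (d%:~R * s)) ->
    (forall f, hom K f -> 0 < f (s ^+ 2)) -> tower (adj K s).

Lemma tower_subfield K : tower K -> subfield K.
Proof.
by elim=> [|{}K s _ sK Ks2 nKs _ _]; [exact: rats_subfield | exact: adj_subfield].
Qed.

Lemma hom_ext_sqrt K s f (e : bool) : subfield K -> K (s ^+ 2) -> ~ K s ->
  hom K f -> 0 < f (s ^+ 2) ->
  exists g, [/\ hom (adj K s) g, forall x, K x -> g x = f x,
    g s = (-1) ^+ e * Num.sqrt (f (s ^+ 2)) & forall u v, K u -> K v ->
    g (u + v * s) = f u + f v * ((-1) ^+ e * Num.sqrt (f (s ^+ 2)))].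
Proof.
move=> sK Ks2 nKs hf f0; apply: hom_ext => //.
by rewrite exprMn sqr_sqrtr ?ltW // -exprM mulnC exprM sqrrN expr1n expr1n mul1r.
Qed.

Lemma adj_conj K s : subfield K -> K (s ^+ 2) -> ~ K s ->
  exists g, [/\ hom (adj K s) g, forall x, K x -> g x = x, g s = - s &
    forall u v, K u -> K v -> g (u + v * s) = u - v * s].
Proof.
move=> sK Ks2 nKs.
have [|g [hg gK gs gE]] := hom_ext sK Ks2 nKs (s' := - s) (hom_id K).
  by rewrite sqrrN.
by exists g; split=> // u v Ku Kv; rewrite gE // mulrN.
Qed.

(** Does the duty of the finiteness of the set of embeddings of [K]. *)
Lemma tower_hom_bound K x : tower K -> K x ->
  exists B, forall f, hom K f -> `|f x| <= B.
Proof.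
move=> tK; elim: tK x => [x [z ->]|{}K s tK IH Ks2 nKs _ pos _ [u [v [Ku Kv ->]]]].
  by exists `|ratr z : R| => f hf; rewrite hom_rats.
have sK := tower_subfield tK; have sA := adj_subfield sK Ks2 nKs.
have [Bu bu] := IH _ Ku; have [Bv bv] := IH _ Kv; have [Bs bs] := IH _ Ks2.
exists (Bu + Bv * (Bs + 1)) => f hf.
have hK : hom K f by apply: hom_sub hf; exact: adj_sub.
have As : adj K s s by apply: adj_gen.
have Au := adj_sub s sK Ku; have Av := adj_sub s sK Kv.
rewrite (homD sA hf) ?(homM hf) //; last exact: (sfM sA).
have fs2 : `|f s| ^+ 2 <= Bs.
  by rewrite -normrX -(homX sA hf) //; exact: bs.
apply: (le_trans (ler_normD _ _)); rewrite normrM lerD ?bu // ler_pM ?bv //.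
by move: (normr_ge0 (f s)) fs2; nra.
Qed.

(** The norm of [w] to Q is an integer of absolute value below 1. The induction takes relative
    norms, one quadratic step at a time. *)
Lemma tower_norm_lt1 K w : tower K -> K w -> OO w ->
  (forall f, hom K f -> `|f w| < 1) -> w = 0.
Proof.
move=> tK; elim: tK w => [w [z ->] Oz small|{}K s tK IH Ks2 nKs _ pos w].
  have := small _ (hom_id _); have [m ->] := OO_rat Oz.
  rewrite -intr_norm ltrz1 => m1; have -> : m = 0 by lia.
  by [].
have sK := tower_subfield tK; have sA := adj_subfield sK Ks2 nKs.
move=> [u [v [Ku Kv Ew]]] Ow small; have [c [hc _ _ cE]] := adj_conj sK Ks2 nKs.
have Aw : adj K s w by exists u, v.
have KN : K (u ^+ 2 - v ^+ 2 * s ^+ 2).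
  by apply: (sfB sK); [exact: sfX | apply: (sfM sK) => //; exact: sfX].
suff E : u ^+ 2 - v ^+ 2 * s ^+ 2 = 0.
  have [u0 v0] := adj_norm_eq0 sK nKs Ku Kv E.
  by rewrite Ew u0 v0 mul0r addr0.
apply: IH => //.
  have -> : u ^+ 2 - v ^+ 2 * s ^+ 2 = w * c w by rewrite Ew cE //; ring.
  by apply: OOM => //; exact: OO_hom hc Aw Ow.
move=> f hf; have f0 := pos _ hf.
have [g [hg gK _ gE]] := hom_ext_sqrt false sK Ks2 nKs hf f0.
have [g' [hg' gK' _ gE']] := hom_ext_sqrt true sK Ks2 nKs hf f0.
have -> : f (u ^+ 2 - v ^+ 2 * s ^+ 2) = g w * g' w.
  have Ku2 := sfX sK 2 Ku; have Kv2 := sfX sK 2 Kv.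
  rewrite Ew gE // gE' // (homB hf) ?(homM hf Kv2 Ks2) //; last exact: (sfM sK).
  rewrite (homX sK hf 2 Ku) (homX sK hf 2 Kv) -{1}[f (s ^+ 2)]sqr_sqrtr ?ltW //.
  by rewrite expr0 expr1; ring.
by rewrite normrM mulr_ilt1 ?small.
Qed.

(** Northcott's theorem. In [u + v * s], the elements [2 * u] (the trace) and [2 * v * s ^+ 2 * d]
    are integers of the smaller field with bounded embeddings, and they determine [u] and [v]. *)
Lemma tower_finite K (C : R) : tower K ->
  finite_set [set w | [/\ K w, OO w & forall f, hom K f -> `|f w| <= C]].
Proof.
move=> tK; elim: tK C => [|{}K s tK IH Ks2 nKs [d d0 Ods] pos] C.
  have [N CN] : exists N : nat, C < N%:R.
    by exists (Num.truncn C).+1; exact: truncnS_gt.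
  apply: (@sub_finite_set _ _ ((fun n : nat => n%:R : R) @` `I_N `|`
    (fun n : nat => - n%:R : R) @` `I_N)); last first.
    by rewrite finite_setU; split; apply: finite_image.
  move=> _ [[z ->] Oz small]; have := small _ (hom_id _); have [m ->] := OO_rat Oz.
  move/le_lt_trans => /(_ _ CN); rewrite -intr_norm => mN.
  have {}mN : (`|m| < N)%N by move: mN; rewrite -[N%:R]/(N%:Z%:~R) ltr_int; lia.
  case: (lerP 0 m) => m0; [left|right]; exists `|m|%N => //.
    by rewrite -[_%:R]/(`|m|%N%:Z%:~R) gez0_abs.
  by rewrite -[_%:R]/(`|m|%N%:Z%:~R) ltz0_abs // mulrNz opprK.
have sK := tower_subfield tK; have sA := adj_subfield sK Ks2 nKs.
have As : adj K s s by apply: adj_gen.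
have s0 : s != 0 by apply/eqP => s0; apply: nKs; rewrite s0; exact: sf0.
have [B bB] := tower_hom_bound tK Ks2.
have [c [hc cK cs cE]] := adj_conj sK Ks2 nKs.
pose B' := 2 * C * (B + 1) * `|d%:~R|.
apply: (@sub_finite_set _ _ [set (x + y / (s * d%:~R)) / 2 |
   x in [set w | [/\ K w, OO w & forall f, hom K f -> `|f w| <= 2 * C]]
 & y in [set w | [/\ K w, OO w & forall f, hom K f -> `|f w| <= B']]]); last first.
  by apply: finite_image2; exact: IH.
have d0' : d%:~R != 0 :> R by rewrite intr_eq0.
move=> w [[u [v [Ku Kv Ew]]] Ow small].
have Aw : adj K s w by exists u, v.
have Ocw : OO (c w) := OO_hom sA hc Aw Ow.
have Ecw : c w = u - v * s by rewrite Ew cE.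
have K2 (n : nat) : K n%:R by exact: sf_nat.
have Kd : K d%:~R by exact: sf_int.
exists (2 * u).
  split.
  - exact: (sfM sK).
  - have -> : 2 * u = w + c w by rewrite Ecw Ew; ring.
    exact: OOD.
  move=> f hf; have f0 := pos _ hf.
  have [g [hg gK _ gE]] := hom_ext_sqrt false sK Ks2 nKs hf f0.
  have [g' [hg' gK' _ gE']] := hom_ext_sqrt true sK Ks2 nKs hf f0.
  have -> : f (2 * u) = g w + g' w.
    by rewrite Ew gE // gE' // (homM hf) // (hom_nat sK hf) expr0 expr1; ring.
  by apply: (le_trans (ler_normD _ _)); move: (small _ hg) (small _ hg'); lra.
exists (2 * v * s ^+ 2 * d%:~R); last by rewrite Ew; field; rewrite s0 d0'.
split.
- by do 3 apply: (sfM sK) => //.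
- have -> : 2 * v * s ^+ 2 * d%:~R = (w - c w) * (d%:~R * s).
    by rewrite Ecw Ew; ring.
  by apply: OOM => //; exact: OOB.
move=> f hf; have f0 := pos _ hf.
have [g [hg gK gs gE]] := hom_ext_sqrt false sK Ks2 nKs hf f0.
have [g' [hg' gK' _ gE']] := hom_ext_sqrt true sK Ks2 nKs hf f0.
have -> : f (2 * v * s ^+ 2 * d%:~R) = (g w - g' w) * g s * d%:~R.
  rewrite Ew gE // gE' // gs (homM hf) ?(homM hf _ Ks2) ?(homM hf _ Kv) ?(hom_nat sK hf) //.
  - rewrite (hom_int sK hf) -{1}[f (s ^+ 2)]sqr_sqrtr ?ltW //.
    by rewrite expr0 expr1; ring.
  - exact: (sfM sK).
  - by do 2 apply: (sfM sK) => //.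
have gs2 : `|g s| ^+ 2 <= B.
  by rewrite -normrX -(homX sA hg) // gK //; exact: bB.
rewrite !normrM /B' ler_wpM2r // ler_pM //.
  apply: (le_trans (ler_normB _ _)).
  by move: (small _ hg) (small _ hg'); lra.
by move: (normr_ge0 (g s)) gs2; nra.
Qed.

Lemma ratr_poly_real_complex (p : {poly rat}) x :
  (map_poly ratr p : {poly R[i]}).[x%:C] = ((map_poly ratr p).[x])%:C.
Proof.
rewrite -horner_map /= -map_poly_comp; congr (_.[_]).
by apply: eq_map_poly => z /=; rewrite fmorph_rat.
Qed.

(** Each [psi s] is a square root of a positive real number, hence real. *)
Lemma hom_complex_real K (psi : R -> R[i]) : tower K -> hom K psi ->
  exists2 f, hom K f & forall x, K x -> psi x = (f x)%:C.
Proof.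
elim=> [hpsi|{}K s tK IH Ks2 nKs _ pos hpsi].
  by exists id => // _ [z ->]; rewrite hom_rats // fmorph_rat.
have sK := tower_subfield tK; have sA := adj_subfield sK Ks2 nKs.
have hK : hom K psi by apply: hom_sub hpsi; exact: adj_sub.
have [f hf fE] := IH hK; have As : adj K s s by apply: adj_gen.
have f0 := pos _ hf.
have [e es] : exists e : bool, psi s = ((-1) ^+ e * Num.sqrt (f (s ^+ 2)))%:C.
  have /eqP : psi s ^+ 2 = (Num.sqrt (f (s ^+ 2)))%:C ^+ 2.
    by rewrite -(homX sA hpsi) // fE // -rmorphXn /= sqr_sqrtr ?ltW.
  rewrite eqf_sqr => /orP[]/eqP ->; [exists false | exists true].
    by rewrite expr0 mul1r.
  by rewrite expr1 mulN1r rmorphN.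
have [g [hg gK gs gE]] := hom_ext_sqrt e sK Ks2 nKs hf f0.
exists g => // _ [u [v [Ku Kv ->]]].
have Au := adj_sub s sK Ku; have Av := adj_sub s sK Kv.
have Avs := sfM sA Av As.
rewrite gE // (homD sA hpsi) // (homM hpsi) // (fE _ Ku) (fE _ Kv) es.
by rewrite -!rmorphM -rmorphD.
Qed.

(** Extends an embedding to a field containing [M0] and [K], adjoining the generators of [K] one by
    one and sending each to a complex square root. *)
Lemma hom_lift K (M0 : set R) (phi : R -> R[i]) : tower K ->
  subfield M0 -> hom M0 phi -> exists M psi,
  [/\ subfield M, K `<=` M, M0 `<=` M, hom M psi & forall x, M0 x -> psi x = phi x].
Proof.
move=> tK sM0 hphi; elim: tK => [|{}K s tK [M [psi [sM KM M0M hpsi psiE]]] Ks2 nKs _ pos].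
  by exists M0, phi; split=> // _ [z ->]; exact: sf_rat.
have [Ms|nMs] := pselect (M s).
  exists M, psi; split=> // _ [u [v [/KM Ku /KM Kv ->]]].
  by apply: (sfD sM) => //; exact: (sfM sM).
have Ms2 := KM _ Ks2.
have [|g [hg gM gs gE]] := hom_ext sM Ms2 nMs (s' := sqrtC (psi (s ^+ 2))) hpsi.
  by rewrite sqrtCK.
exists (adj M s), g; split=> //.
- exact: adj_subfield.
- by move=> _ [u [v [/KM Ku /KM Kv ->]]]; exists u, v.
- by move=> x /M0M Mx; apply: adj_sub.
- by move=> x M0x; rewrite gM ?psiE //; exact: M0M.
Qed.

Lemma simple_hom (p : {poly rat}) x (b : R[i]) : irreducible_poly p ->
  root (map_poly ratr p) x -> root (map_poly ratr p) b ->
  exists M phi, [/\ subfield M, M x, hom M phi & phi x = b :> R[i]].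
Proof.
move=> irr px pb.
pose M : set R := [set y | exists h : {poly rat}, y = (map_poly ratr h).[x]].
pose phi y := if pselect (M y) is left P then (map_poly ratr (projT1 (cid P))).[b] else 0.
have dv (h : {poly rat}) : (map_poly ratr h).[x] = 0 -> p %| h.
  move=> hx; apply: contraT => ndv.
  have cop : coprimep p h.
    have [] := irredp_XsubCP irr (dvdp_gcdl p h).
      by rewrite /coprimep => /eqp_size; rewrite size_poly1 => ->.
    by move=> /eqp_dvdl E; move: (dvdp_gcdr p h); rewrite E (negbTE ndv).
  have /Bezout_eq1_coprimepP[[a c] /= E] := cop.
  move/eqP: px => px; move/(congr1 (fun q => (map_poly (ratr : rat -> R) q).[x])): E.
  rewrite rmorphD !rmorphM rmorph1 !hornerE /= px hx !mulr0 addr0 => /eqP.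
  by rewrite eq_sym oner_eq0.
have phiE (h : {poly rat}) : phi (map_poly ratr h).[x] = (map_poly ratr h).[b].
  rewrite /phi; case: pselect => [P|]; last by case; exists h.
  case: cid => h' /= E; have /dvdpP[k kE] : p %| h' - h.
    by apply: dv; rewrite rmorphB !hornerE E subrr.
  have -> : h' = k * p + h by rewrite -kE subrK.
  by rewrite rmorphD rmorphM !hornerE /= (eqP pb) mulr0 add0r.
have E0 (F : numFieldType) (y : F) : (map_poly ratr (1 : {poly rat})).[y] = 1.
  by rewrite rmorph1 hornerC.
exists M, phi; split.
- split.
  + by exists 1; rewrite E0.
  + by move=> _ _ [h ->] [k ->]; exists (h - k); rewrite rmorphB !hornerE.
  + by move=> _ _ [h ->] [k ->]; exists (h * k); rewrite rmorphM !hornerE.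
  + move=> _ [h ->]; have [dvd|ndv] := boolP (p %| h).
      exists 0; rewrite rmorph0 horner0; case/dvdpP: dvd => k ->.
      by rewrite rmorphM !hornerE /= (eqP px) mulr0 invr0.
    have cop : coprimep p h.
      have [] := irredp_XsubCP irr (dvdp_gcdl p h).
        by rewrite /coprimep => /eqp_size; rewrite size_poly1 => ->.
      by move=> /eqp_dvdl E; move: (dvdp_gcdr p h); rewrite E (negbTE ndv).
    have /Bezout_eq1_coprimepP[[a c] /= E] := cop.
    move/(congr1 (fun q => (map_poly (ratr : rat -> R) q).[x])): E.
    rewrite rmorphD !rmorphM rmorph1 !hornerE /= (eqP px) mulr0 add0r => E.
    exists c; have h0 : (map_poly ratr h).[x] != 0 :> R.
      by apply/eqP => /dv; apply/negP.
    by apply: (mulIf h0); rewrite E mulVf.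
- by exists 'X; rewrite map_polyX hornerX.
- split.
  + by rewrite -(E0 _ x) phiE E0.
  + move=> _ _ [h ->] [k ->]; rewrite !phiE.
    have -> : (map_poly ratr h).[x] - (map_poly ratr k).[x] = (map_poly ratr (h - k)).[x].
      by rewrite rmorphB !hornerE.
    by rewrite phiE rmorphB !hornerE.
  + move=> _ _ [h ->] [k ->]; rewrite !phiE.
    have -> : (map_poly ratr h).[x] * (map_poly ratr k).[x] = (map_poly ratr (h * k)).[x].
      by rewrite rmorphM !hornerE.
    by rewrite phiE rmorphM !hornerE.
- have xE : x = (map_poly ratr 'X).[x] by rewrite map_polyX hornerX.
  by rewrite {1}xE phiE map_polyX hornerX.
Qed.

Lemma conjugates_hom K x (b : R[i]) : tower K -> K x -> conjugates x%:C b ->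
  exists2 f, hom K f & b = (f x)%:C.
Proof.
move=> tK Kx [p [irr px pb]].
have px' : root (map_poly ratr p) x.
  by move: px; rewrite !rootE ratr_poly_real_complex fmorph_eq0.
have [M0 [phi [sM0 M0x hphi phix]]] := simple_hom irr px' pb.
have [M [psi [sM KM M0M hpsi psiE]]] := hom_lift tK sM0 hphi.
have [f hf fE] := hom_complex_real tK (hom_sub KM hpsi).
by exists f; rewrite // -phix -psiE // fE.
Qed.

Lemma tower_algebraic K x : tower K -> K x -> algebraicOver (ratr : rat -> R) x.
Proof.
move=> tK; elim: tK x => [_ [z ->]|{}K s tK IH Ks2 nKs [d d0 [p pm ps]] _ _ [u [v [Ku Kv ->]]]].
  exact: algebraic_id.
apply: algebraic_add; first exact: IH.
apply: algebraic_mul; first exact: IH.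
have -> : s = (d%:~R * s) / d%:~R by rewrite mulrC mulKf // intr_eq0.
apply: algebraic_div; last by rewrite -ratr_int; exact: algebraic_id.
exists (map_poly intr p); last by rewrite -map_poly_intrE.
by apply: monic_neq0; exact: monic_map.
Qed.

(** With [conjugates_hom], identifies the conjugates of [x] with its images under real embeddings.
    An annihilating polynomial is factored until an irreducible one is reached. *)
Lemma hom_conjugate K x f : tower K -> K x -> hom K f ->
  conjugates x%:C (f x)%:C.
Proof.
move=> tK Kx hf; have sK := tower_subfield tK.
have [p p0 px] := tower_algebraic tK Kx.
have [n] := ubnP (size p); elim: n p p0 px => // n IH p p0 px /ltnSE pn.
have [irr|nirr] := pselect (irreducible_poly p).
  exists p; split=> //; rewrite rootE ratr_poly_real_complex fmorph_eq0 //.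
  by move/eqP: px => px; rewrite -(hom_horner sK hf) // px (hom0 sK hf).
have p1 : (1 < size p)%N.
  rewrite ltnNge; apply/negP => /size1_polyC pE; move: px p0.
  by rewrite pE map_polyC rootC polyC_eq0 fmorph_eq0 => ->.
have [q [q1 qp nqp]] : exists q : {poly rat}, [/\ size q != 1%N, q %| p & ~~ (q %= p)].
  apply: contrapT => nex; apply: nirr; split=> // q q1 qp.
  by apply: contraT => nqp; case: nex; exists q.
have q0 : q != 0 by apply: contraTneq qp => ->; rewrite dvd0p.
have /dvdpP[k kE] := qp; have k0 : k != 0.
  by apply: contraNneq p0 => k0; rewrite kE k0 mul0r.
have sq : (size q < size p)%N.
  by rewrite ltn_neqAle dvdp_leq // andbT dvdp_size_eqp.
have sk : (size k < size p)%N.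
  have q2 : (1 < size q)%N by rewrite ltn_neqAle eq_sym q1 size_poly_gt0.
  rewrite kE size_mul //; case: (size q) q2 => [|[|m]] // _.
  by rewrite addnS /= addnS ltnS leq_addr.
move: px; rewrite kE rmorphM rootM => /orP[kx|qx].
  by apply: (IH k) => //; exact: leq_trans sk pn.
by apply: (IH q) => //; exact: leq_trans sq pn.
Qed.

End Towers.

(** * Integrality away from [w], and squarefree elements *)

Section Localization.
Context {R : realType} (w : R) (h : nat).
Hypotheses (w_gt0 : 0 < w) (w_sq : w ^+ 2 = h%:R) (h_even : (2 %| h)%N).
Implicit Types (K : set R) (x y z c : R).

(** The algebraic integers with [w] inverted; 2 is then a unit as well, [h] being even. *)
Definition BB : set R := [set x | exists k, OO (w ^+ k * x)].

Lemma OO_w : OO w.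
Proof. by apply: (@OO_rootX _ w 2%N) => //; rewrite w_sq; exact: OO_nat. Qed.

Lemma w_neq0 : w != 0. Proof. by rewrite gt_eqF. Qed.

Lemma BB_OO x : OO x -> BB x.
Proof. by move=> Ox; exists 0%N; rewrite mul1r. Qed.

Lemma BB_lift x k m : (k <= m)%N -> OO (w ^+ k * x) -> OO (w ^+ m * x).
Proof.
move=> km Ox; rewrite -(subnK km) exprD -mulrA.
by apply: OOM => //; apply: OOX; exact: OO_w.
Qed.

Lemma BBB x y : BB x -> BB y -> BB (x - y).
Proof.
move=> [k Ox] [m Oy]; exists (k + m)%N; rewrite mulrBr; apply: OOB.
  by apply: BB_lift Ox; exact: leq_addr.
by apply: BB_lift Oy; exact: leq_addl.
Qed.

Lemma BBN x : BB x -> BB (- x).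
Proof. by move=> [k Ox]; exists k; rewrite mulrN; exact: OON. Qed.

Lemma BBD x y : BB x -> BB y -> BB (x + y).
Proof. by move=> Bx By; rewrite -[y]opprK; apply: BBB => //; exact: BBN. Qed.

Lemma BBM x y : BB x -> BB y -> BB (x * y).
Proof.
move=> [k Ox] [m Oy]; exists (k + m)%N.
by rewrite exprD mulrACA; exact: OOM.
Qed.

Lemma BB_nat n : BB n%:R. Proof. by apply: BB_OO; exact: OO_nat. Qed.

Lemma BB_sqr x : BB (x ^+ 2) -> BB x.
Proof.
move=> [k Ox]; exists k; apply: (@OO_rootX _ _ 2%N) => //.
rewrite exprMn -exprM muln2 -addnn exprD -mulrA.
by apply: OOM => //; apply: OOX; exact: OO_w.
Qed.

Lemma BB_quadratic x a b : BB a -> BB b -> x ^+ 2 - a * x + b = 0 -> BB x.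
Proof.
move=> [k Oa] [m Ob] E; exists (k + m)%N.
apply: (@OO_quadratic _ _ (w ^+ (k + m) * a) (w ^+ (k + m).*2 * b)).
- by apply: BB_lift Oa; exact: leq_addr.
- by apply: BB_lift Ob; rewrite -addnn -addnA addnCA leq_addr.
- by rewrite -addnn (exprD w (k + m)) -[RHS](mulr0 (w ^+ (k + m) ^+ 2)) -E; ring.
Qed.

Lemma BB_Vw : BB w^-1.
Proof. by exists 1%N; rewrite mulfV ?w_neq0 //; exact: OO1. Qed.

Lemma BB_Vwn n : BB (w ^+ n)^-1.
Proof. by exists n; rewrite mulfV ?expf_neq0 ?w_neq0 //; exact: OO1. Qed.

Lemma BB_half : BB 2^-1.
Proof.
exists 2%N; rewrite w_sq; case/dvdnP: h_even => m ->.
by rewrite natrM mulfK //; exact: OO_nat.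
Qed.

Lemma BB_hom K f x : subfield K -> hom K f -> K w -> K x -> f w = w -> BB x -> BB (f x).
Proof.
move=> sK hf Kw Kx fw [k Ox]; exists k; have Kwk := sfX sK k Kw.
rewrite -{1}fw -(homX sK hf k Kw) -(homM hf Kwk Kx).
exact: (OO_hom sK hf (sfM sK Kwk Kx) Ox).
Qed.

(** If [c] divides a square it divides the root: squarefreeness of [c] in the ring of [BB]-elements
    of [K]. *)
Definition SF K c := forall z y, K z -> BB z -> BB y -> z ^+ 2 = c * y -> BB (z / c).

Section QuadraticStep.
Context (K : set R) (c : R) (sK : subfield K) (Kw : K w) (Kc2 : K (c ^+ 2))
  (nKc : ~ K c) (Bc : BB c).

Lemma adj_conj_spec : exists g, [/\ hom (adj K c) g, forall x, K x -> g x = x,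
  g c = - c, forall x, adj K c x -> BB x -> BB (g x)
  & forall x, adj K c x -> K (x + g x) /\ K (x * g x)].
Proof.
have [g [hg gK gc gE]] := adj_conj sK Kc2 nKc; exists g; split=> //.
  move=> x Ax Bx; apply: (BB_hom (adj_subfield sK Kc2 nKc) hg) => //.
    exact: (adj_sub c sK Kw).
  exact: gK.
move=> _ [u [v [Ku Kv ->]]]; rewrite gE //; split.
  have -> : u + v * c + (u - v * c) = u + u by ring.
  exact: sfD.
have -> : (u + v * c) * (u - v * c) = u ^+ 2 - v ^+ 2 * c ^+ 2 by ring.
by apply: (sfB sK); [exact: sfX | apply: (sfM sK) => //; exact: sfX].
Qed.

(* If [z ^+ 2 = (2 + d) * y] with [d = +-c], then [z / (2 + d)] has trace and norm over [K]
   in [BB], because [4 - c ^+ 2] is the norm of [2 + d]. *)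
Lemma SF_step d : d = c \/ d = - c -> SF K (4 - c ^+ 2) -> SF (adj K c) (2 + d).
Proof.
move=> dc sfK z y Az Bz By E.
have sA := adj_subfield sK Kc2 nKc.
have [g [hg gK gc gB gTN]] := adj_conj_spec.
have Ac : adj K c c by exact: adj_gen.
have Ad : adj K c d by case: dc => -> //; exact: sfN.
have Bd : BB d by case: dc => -> //; exact: BBN.
have gd : g d = - d by case: dc => ->; rewrite ?(homN sA hg) ?gc.
have d2 : c ^+ 2 = d ^+ 2 by case: dc => ->; ring.
have A2 : adj K c 2 by exact: sf_nat.
have rho0 : 4 - c ^+ 2 != 0.
  apply/eqP => E0; apply: nKc.
  have /eqP : c ^+ 2 = 2 ^+ 2 by rewrite -[LHS](subrK 4) -opprB E0; ring.
  rewrite eqf_sqr => /orP[]/eqP ->; first exact: sf_nat.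
  by apply: sfN => //; exact: sf_nat.
have E4 : 4 - c ^+ 2 = (2 + d) * (2 - d) by rewrite d2; ring.
have [g0 g'0] : 2 + d != 0 /\ 2 - d != 0.
  by apply/andP; rewrite -negb_or -mulf_eq0 -E4.
have Ay : adj K c y.
  have -> : y = z ^+ 2 / (2 + d) by rewrite E mulrC mulKf.
  by apply: sf_div => //; [exact: sfX | exact: sfD].
have Agd : adj K c (2 + d) by exact: sfD.
have E' : g z ^+ 2 = (2 - d) * g y.
  by rewrite -(homX sA hg) // E (homM hg) // (homD sA hg) // (hom_nat sA hg) gd.
set s := z * (2 - d) + g z * (2 + d).
have Ks : K s.
  have -> : s = z * (2 - d) + g (z * (2 - d)).
    rewrite (homM hg) //; last by apply: (sfB sA).
    by rewrite (homB hg) // (hom_nat sA hg) gd opprK.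
  by apply: (gTN _ _).1; apply: (sfM sA) => //; exact: (sfB sA).
have Kn : K (z * g z) by apply: (gTN _ _).2.
have [Bgz Bgy] : BB (g z) /\ BB (g y) by split; apply: gB.
have B2 : BB 2 by exact: BB_nat.
have Bs : BB s by apply: BBD; apply: BBM => //; [exact: BBB | exact: BBD].
have Bn : BB (z * g z) by exact: BBM.
have Bsr : BB (s / (4 - c ^+ 2)).
  apply: (sfK s (y * (2 - d) + g y * (2 + d) + 2 * (z * g z))) => //.
    apply: BBD; last exact: BBM.
    by apply: BBD; apply: BBM => //; [exact: BBB | exact: BBD].
  have -> : s ^+ 2 = z ^+ 2 * (2 - d) ^+ 2 + g z ^+ 2 * (2 + d) ^+ 2
     + 2 * (z * g z) * ((2 + d) * (2 - d)) by rewrite /s; ring.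
  by rewrite E E' E4; ring.
have Bnr : BB (z * g z / (4 - c ^+ 2)).
  apply: (sfK _ (y * g y)) => //; first exact: BBM.
  by rewrite exprMn E E' E4; ring.
apply: (BB_quadratic Bsr Bnr).
by rewrite E4 /s; field; rewrite g0 g'0.
Qed.

(** The trace gives [u], since 2 is a unit. Then [v * c] is in [BB], so [c ^+ 2] divides the square
    of [v * c ^+ 2], and squarefreeness gives [v]. *)
Lemma SF_split u v : SF K (c ^+ 2) -> K u -> K v -> BB (u + v * c) ->
  BB u /\ BB v.
Proof.
move=> sfK Ku Kv Bx; have [g [hg gK gc gB gTN]] := adj_conj_spec.
have sA := adj_subfield sK Kc2 nKc.
have Ac : adj K c c by exact: adj_gen.
have Au := adj_sub c sK Ku; have Av := adj_sub c sK Kv.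
have gx : g (u + v * c) = u - v * c.
  by rewrite (homD sA hg Au (sfM sA Av Ac)) (homM hg Av Ac) gc (gK _ Ku) (gK _ Kv) mulrN.
have Bgx : BB (u - v * c) by rewrite -gx; apply: gB => //; exists u, v.
have Bu : BB u.
  have -> : u = (u + v * c + (u - v * c)) * 2^-1 by field.
  by apply: BBM; [exact: BBD | exact: BB_half].
have Bvc : BB (v * c).
  have -> : v * c = (u + v * c) - u by ring.
  exact: BBB.
split=> //; have c0 : c ^+ 2 != 0.
  rewrite expf_eq0 /=; apply/eqP => c0; apply: nKc; rewrite c0; exact: sf0.
have -> : v = v * c ^+ 2 / c ^+ 2 by rewrite mulfK.
have Evc : v * c ^+ 2 = (v * c) * c by ring.
apply: (sfK _ (v ^+ 2 * c ^+ 2)).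
- exact: (sfM sK).
- by rewrite Evc; exact: BBM.
- by rewrite -exprMn expr2; exact: BBM.
- by ring.
Qed.

End QuadraticStep.

End Localization.

(** * Chebyshev polynomials *)

Section Chebyshev.
Context {R : realType}.
Implicit Types (y : R) (m k n : nat).

(* [T m (x + x^-1) = x ^+ m + x ^- m], twice the usual normalisation. *)
Fixpoint T m y : R :=
  match m with
  | 0 => 2
  | m'.+1 => match m' with 0 => y | m''.+1 => y * T m' y - T m'' y end
  end.

(** [T 0] is the constant 2; with 1 in its place the first [2 ^ n] polynomials, taken at [c n],
    serve as a basis. *)
Definition Tb m y : R := if m == 0%N then 1 else T m y.

Lemma TSS m y : T m.+2 y = y * T m.+1 y - T m y. Proof. by []. Qed.

Lemma nat_ind2 (P : nat -> Prop) :
  P 0%N -> P 1%N -> (forall m, P m -> P m.+1 -> P m.+2) -> forall m, P m.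
Proof.
move=> P0 P1 PS m; suff [] : P m /\ P m.+1 by [].
by elim: m => // m [Pm Pm1]; split=> //; exact: PS.
Qed.

Lemma T_mul m k y : (k <= m)%N -> T m y * T k y = T (m + k) y + T (m - k) y.
Proof.
elim/nat_ind2: k => [_|m1|k IH0 IH1 km].
- by rewrite addn0 subn0 /=; ring.
- case: m m1 => // m _; rewrite addn1 subn1 -[m.+1.-1]/m TSS (_ : T 1%N y = y) //. by rewrite subrK mulrC.
have {}IH0 := IH0 (ltnW (ltnW km)); have {}IH1 := IH1 (ltnW km).
have -> : (m + k.+2 = (m + k).+2)%N by lia.
have E : (m - k = (m - k.+2).+2)%N by lia.
have E1 : (m - k.+1 = (m - k.+2).+1)%N by lia.
rewrite TSS TSS; have -> : (m + k).+1 = (m + k.+1)%N by lia.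
rewrite E TSS -E1 in IH0.
by rewrite mulrBr mulrCA IH1 IH0; ring.
Qed.

Lemma T_double m y : T m.*2 y = T m (y ^+ 2 - 2).
Proof.
elim/nat_ind2: m => [||m IH0 IH1]; [by [] | by rewrite (_ : T _ y = y * y - 2) // |].
rewrite TSS -IH1 -IH0 !doubleS.
have := @T_mul m.*2.+2 2%N y isT; rewrite addn2 subn2 -[m.*2.+2.-2]/(m.*2).
rewrite (_ : T 2%N y = y ^+ 2 - 2) => [E|]; last by rewrite /=; ring.
by rewrite mulrC E addrK.
Qed.

Lemma T_opp m y : T m (- y) = (-1) ^+ m * T m y.
Proof.
elim/nat_ind2: m => [||m IH0 IH1]; [by rewrite /=; ring | by rewrite /=; ring |].
by rewrite !TSS IH0 IH1 !exprS; ring.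
Qed.

Lemma T_pell m y : T m y ^+ 2 - y * T m y * T m.+1 y + T m.+1 y ^+ 2 = 4 - y ^+ 2.
Proof.
elim: m => [|m IH]; first by rewrite /=; ring.
by rewrite TSS -IH; ring.
Qed.

(** By [T_pell], the product of [4 - y ^+ 2] and [4 - T m y ^+ 2] is the square of
    [2 * T m.+1 y - y * T m y]. *)
Lemma T_sqr_le4 m y : y ^+ 2 < 4 -> T m y ^+ 2 <= 4.
Proof.
move=> y4; have := T_pell m y; move: (T m y) (T m.+1 y) => a b E.
have p : 0 < 4 - y ^+ 2 by lra.
rewrite -(ler_pM2l p); have := sqr_ge0 (2 * b - y * a).
by move=> s0; nra.
Qed.

Lemma T_sqr m y : T m y ^+ 2 = T m.*2 y + 2.
Proof. by rewrite expr2 T_mul // subnn addnn. Qed.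

End Chebyshev.

(** The relative norm of [2 + d] is [4 - c ^+ 2], and the norm of a square is a square. *)
Lemma adj_nonsquare (R : realType) (K : set R) c d : subfield K -> K (c ^+ 2) ->
  ~ K c -> d = c \/ d = - c -> (forall y, K y -> y ^+ 2 <> 4 - c ^+ 2) ->
  forall y, adj K c y -> y ^+ 2 <> 2 + d.
Proof.
move=> sK Kc2 nKc dc nsq y [u [v [Ku Kv yE]]] E; have sA := adj_subfield sK Kc2 nKc.
have [g [hg gK gc gE]] := adj_conj sK Kc2 nKc.
have Ay : adj K c y by exists u, v.
have Ac : adj K c c by exact: adj_gen.
have E' : g y ^+ 2 = 2 - d.
  rewrite -(homX sA hg 2 Ay) E (homD sA hg) ?(hom_nat sA hg) //.
  - by case: dc => ->; rewrite ?(homN sA hg Ac) gc.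
  - exact: sf_nat.
  - by case: dc => -> //; exact: sfN.
apply: (nsq (u ^+ 2 - v ^+ 2 * c ^+ 2)).
  by apply: (sfB sK); [exact: sfX | apply: (sfM sK) => //; exact: sfX].
have -> : u ^+ 2 - v ^+ 2 * c ^+ 2 = y * g y by rewrite yE gE //; ring.
by rewrite exprMn E E'; case: dc => ->; ring.
Qed.

Lemma adj_sqr_base (R : realType) (K : set R) c u v : subfield K -> K (c ^+ 2) ->
  ~ K c -> K u -> K v -> K ((u + v * c) ^+ 2) -> u = 0 \/ v = 0.
Proof.
move=> sK Kc2 nKc Ku Kv Ky.
have Kuv : K (2 * u * v) by do 2 apply: (sfM sK) => //; exact: sf_nat.
have Kr : K (u ^+ 2 + v ^+ 2 * c ^+ 2 - (u + v * c) ^+ 2).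
  apply: (sfB sK) => //; apply: sfD => //; first exact: sfX.
  by apply: (sfM sK) => //; exact: sfX.
have [|_ /eqP] := adj_eq0 sK nKc Kr Kuv; first by ring.
by rewrite mulf_eq0 mulf_eq0 pnatr_eq0 /= => /orP[]/eqP; auto.
Qed.

(** The tower will start with [c 0 ^+ 2 = dd / dh ^ dj], so [d_sum] makes [4 - c 0 ^+ 2] equal to
    [dr / dh ^ dj]. [d_sf] serves integrality away from [dw]; [d_red], [d_coprime], [d_mod4] and the
    odd [dj] serve integrality at [dw]; the [d_nsq] conditions keep each step of the tower quadratic
    and separate the fields; [d_big] kills the upper half of the coordinates. *)
Record datum (R : realType) := Datum {
  dw : R; dh : nat; dr : nat; dd : nat; dj : nat; dE : set R;
  dw_gt0 : 0 < dw;
  dw_sq : dw ^+ 2 = dh%:R;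
  dh_even : (2 %| dh)%N;
  dE_tower : tower dE;
  dE_w : dE dw;
  dj_odd : odd dj;
  d_red : forall z y, dE z -> OO z -> OO y -> z ^+ 2 = dw * y -> OO (z / dw);
  d_sf : SF dw dE dr%:R;
  d_coprime : coprime dr dh;
  d_sum : (dd + dr = 4 * dh ^ dj)%N;
  d_mod4 : (dd %% 4 = 1)%N;
  d_nsq_r : forall y, dE y -> y ^+ 2 <> dr%:R;
  d_nsq_d : forall y, dE y -> y ^+ 2 <> dd%:R;
  d_nsq_rd : forall y, dE y -> y ^+ 2 <> (dr * dd)%:R;
  d_big : 24 * dw ^+ dj.+1 <= dr%:R }.

(** * The tower generated by the [c n], and its Chebyshev basis away from [w] *)

Section Levels.
Context {R : realType} (D : datum R).
Notation w := (dw D).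
Notation h := (dh D).
Notation r := (dr D).
Notation j := (dj D).
Notation delta := (dd D).
Notation E1 := (dE D).
Implicit Types (x y z u v : R) (f g : R -> R).

(** Up to the signs [eps], these are 2 cos of an angle halved at each step. [c n] enters the tower
    at level [n.+1]. *)
Fixpoint ch (eps : nat -> bool) n : R :=
  if n is m.+1 then (-1) ^+ eps m * Num.sqrt (2 + ch eps m)
  else Num.sqrt delta%:R / w ^+ j.

Fixpoint lev (eps : nat -> bool) n : set R :=
  if n is m.+1 then adj (lev eps m) (ch eps m) else E1.

Context (eps : nat -> bool).
Notation c := (ch eps).
Notation lv := (lev eps).

Lemma sE1 : subfield E1. Proof. exact: tower_subfield (dE_tower D). Qed.

Let w0 : w != 0. Proof. by rewrite gt_eqF ?dw_gt0. Qed.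

Lemma delta_gt0 : (0 < delta)%N.
Proof. by have := d_mod4 D; case: (delta). Qed.

Lemma r_gt0 : (0 < r)%N.
Proof.
rewrite -(@ltr_nat R); apply: lt_le_trans (d_big D).
by rewrite mulr_gt0 // exprn_gt0 ?dw_gt0.
Qed.

Lemma w2jE : w ^+ (2 * j) = (h ^ j)%:R.
Proof. by rewrite exprM dw_sq natrX. Qed.

Lemma c0_sq : c 0 ^+ 2 = delta%:R / (h ^ j)%:R.
Proof. by rewrite /= expr_div_n sqr_sqrtr ?ler0n // -exprM mulnC w2jE. Qed.

Let hj0 : (h ^ j)%:R != 0 :> R. Proof. by rewrite -w2jE expf_neq0. Qed.

Lemma c0_norm : 4 - c 0 ^+ 2 = r%:R / (h ^ j)%:R.
Proof.
have := congr1 (fun n : nat => n%:R : R) (d_sum D); rewrite natrD natrM => E.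
by rewrite c0_sq -(addrK r%:R delta%:R) E; field.
Qed.

Lemma c_sqr_lt4 n : c n ^+ 2 < 4.
Proof.
elim: n => [|n IH].
  rewrite -subr_gt0 c0_norm divr_gt0 ?ltr0n ?r_gt0 //.
  by rewrite lt0n -(@pnatr_eq0 R) hj0.
rewrite /= exprMn -exprM mulnC exprM sqrrN !expr1n mul1r.
by rewrite sqr_sqrtr; nra.
Qed.

Lemma cS_sqr n : c n.+1 ^+ 2 = 2 + c n.
Proof.
rewrite /= exprMn -exprM mulnC exprM sqrrN !expr1n mul1r.
by rewrite sqr_sqrtr //; have := c_sqr_lt4 n; nra.
Qed.

Lemma BB_c n : BB w (c n).
Proof.
have W := dw_gt0 D; have W2 := dw_sq D.
elim: n => [|n IH]; apply: (BB_sqr W2).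
  rewrite c0_sq -w2jE; apply: BBM; first exact: BB_nat.
  exact: BB_Vwn.
by rewrite cS_sqr; apply: (BBD W2) => //; exact: BB_nat.
Qed.

Lemma OO_hc n : OO ((h ^ j)%:R * c n).
Proof.
have W2 := dw_sq D.
elim: n => [|n IH]; apply: (@OO_rootX _ _ 2%N) => //; rewrite exprMn.
  by rewrite c0_sq expr2 -mulrA mulrCA mulfV // mulr1 -natrM; exact: OO_nat.
rewrite cS_sqr mulrDr expr2 -mulrA; apply: OOD.
  by rewrite -!natrM; exact: OO_nat.
by rewrite -mulrA; apply: OOM => //; exact: OO_nat.
Qed.

(** The induction carries that [4 - c n ^+ 2] is no square: it is the norm of [2 + c n], which is
    [c n.+1 ^+ 2], and of [2 - c n], which is [4 - c n.+1 ^+ 2]. *)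
Lemma lev_spec n : [/\ tower (lv n), lv n (c n ^+ 2), ~ lv n (c n),
  forall f, hom (lv n) f -> 0 < f (c n ^+ 2) < 4 &
  forall y, lv n y -> y ^+ 2 <> 4 - c n ^+ 2].
Proof.
elim: n => [|n [tn Kc2 nKc fc nsq]].
  have Kwj : E1 (w ^+ j) by apply: (sfX sE1); exact: dE_w.
  split.
  - exact: dE_tower.
  - by rewrite c0_sq; apply: (sf_div sE1); exact: (sf_nat sE1).
  - move=> Kc; apply: (@d_nsq_d _ D (c 0 * w ^+ j)); first exact: (sfM sE1).
    by rewrite exprMn c0_sq -exprM mulnC w2jE divfK.
  - move=> f hf; have -> : f (c 0 ^+ 2) = c 0 ^+ 2.
      by rewrite c0_sq (hom_div sE1 hf) ?(hom_nat sE1 hf) //; exact: (sf_nat sE1).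
    rewrite c_sqr_lt4 andbT c0_sq divr_gt0 ?ltr0n ?delta_gt0 //.
    by rewrite lt0n -(@pnatr_eq0 R) hj0.
  - move=> y Ky E; apply: (@d_nsq_r _ D (y * w ^+ j)); first exact: (sfM sE1).
    by rewrite exprMn E c0_norm -exprM mulnC w2jE divfK.
have sn := tower_subfield tn; have sA := adj_subfield sn Kc2 nKc.
have Ac : lv n.+1 (c n) by exact: adj_gen.
have A2 m : lv n.+1 m%:R by exact: sf_nat.
rewrite cS_sqr; split.
- apply: tower_adj => //; last by move=> f /fc/andP[].
  by exists (h ^ j)%N%:Z; [rewrite -(intr_eq0 R); exact: hj0 | exact: OO_hc].
- exact: (sfD sA (A2 2%N) Ac).
- move=> Ac'; apply: (adj_nonsquare sn Kc2 nKc _ nsq Ac' (d := c n)); first by left.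
  exact: cS_sqr.
- move=> f hf; rewrite (homD sA hf (A2 2%N) Ac) (hom_nat sA hf).
  have := fc _ (hom_sub (adj_sub _ sn) hf); rewrite (homX sA hf 2 Ac).
  by move=> /andP[_ ?]; apply/andP; split; nra.
- move=> y Ky E; apply: (adj_nonsquare sn Kc2 nKc _ nsq Ky (d := - c n)); first by right.
  by rewrite E; ring.
Qed.

Lemma lev_tower n : tower (lv n). Proof. by case: (lev_spec n). Qed.
Lemma lev_sf n : subfield (lv n). Proof. exact: tower_subfield (lev_tower n). Qed.
Lemma lev_c2 n : lv n (c n ^+ 2). Proof. by case: (lev_spec n). Qed.
Lemma lev_nc n : ~ lv n (c n). Proof. by case: (lev_spec n). Qed.
Lemma lev_c n : lv n.+1 (c n). Proof. exact/adj_gen/lev_sf. Qed.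

Lemma lev_sub m n : (m <= n)%N -> lv m `<=` lv n.
Proof.
move=> /subnK <-; elim: (n - m)%N => // k IH x /IH; exact: (adj_sub _ (lev_sf _)).
Qed.

Lemma lev_hom_c n f : hom (lv n.+1) f -> f (c n) ^+ 2 < 4.
Proof.
move=> hf; have [_ _ _ fc _] := lev_spec n.
have := fc _ (hom_sub (@lev_sub n n.+1 (leqnSn n)) hf).
by rewrite (homX (lev_sf _) hf 2 (lev_c n)) => /andP[].
Qed.

Lemma lev_w n : lv n w. Proof. exact/(lev_sub (leq0n n))/dE_w. Qed.

(* The sign may be chosen freely when a real embedding is extended one level up. *)
Lemma lev_ext n f (b : bool) : hom (lv n) f -> exists g,
  [/\ hom (lv n.+1) g, forall x, lv n x -> g x = f x
    & g (c n) = (-1) ^+ b * Num.sqrt (f (c n ^+ 2))].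
Proof.
move=> hf; have [tn Kc2 nKc fc _] := lev_spec n; have /andP[f0 _] := fc _ hf.
have [g [hg gK gc _]] := hom_ext_sqrt b (lev_sf n) Kc2 nKc hf f0.
by exists g.
Qed.

Lemma lev_ext_up m n f : (m <= n)%N -> hom (lv m) f -> exists2 g,
  hom (lv n) g & forall x, lv m x -> g x = f x.
Proof.
move=> mn hf; rewrite -(subnK mn); elim: (n - m)%N => [|k [g hg gE]]; first by exists f.
have [g' [hg' g'E _]] := lev_ext false hg; exists g' => // x mx.
by rewrite g'E ?gE //; apply: (lev_sub _ mx); exact: leq_addl.
Qed.

(** If a root of [2 - c n] first appeared on adjoining [c M], it would be [v * c M] with [v] at
    level [M]; each case then makes an excluded element a square. *)
Lemma lev_no_sqrt_step n : (forall z, lv n.+1 z -> z ^+ 2 <> 4 - c n ^+ 2) ->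
  forall M y, (n < M)%N -> lv M y -> y ^+ 2 <> 2 - c n.
Proof.
move=> base; elim=> // M IH y; rewrite ltnS leq_eqVlt => /orP[/eqP <-|nM] Ky E.
  have [_ _ _ _ nsq] := lev_spec n.+1; apply: (nsq _ Ky).
  by rewrite cS_sqr E; ring.
have sM := lev_sf M; have KcM : lv M (c n) := lev_sub nM (lev_c n).
have [u [v [Ku Kv yE]]] := Ky.
have K2 : lv M 2 by exact: sf_nat.
have Ky2 : lv M ((u + v * c M) ^+ 2) by rewrite -yE E; exact: (sfB sM).
have [u0|v0] := adj_sqr_base sM (lev_c2 M) (@lev_nc M) Ku Kv Ky2; last first.
  by apply: (IH u nM Ku); rewrite -E yE v0 mul0r addr0.
move: E; rewrite yE u0 add0r exprMn; case: M nM {IH Ky u Ku u0 yE Ky2} sM KcM Kv K2 => // M.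
rewrite ltnS leq_eqVlt cS_sqr => /orP[/eqP <-|nM] sM KcM Kv K2 E.
  (* Multiplying [v ^+ 2 * (2 + c n) = 2 - c n] by [2 + c n] makes [4 - c n ^+ 2] a square. *)
  apply: (base (v * (2 + c n))); first by apply: (sfM sM) => //; exact: sfD.
  have -> : (v * (2 + c n)) ^+ 2 = v ^+ 2 * (2 + c n) * (2 + c n) by ring.
  by rewrite E; ring.
have [_ _ _ _ nsq] := lev_spec M; have sm := lev_sf M.
have [g [hg gK gc gE]] := adj_conj sm (lev_c2 M) (@lev_nc M).
have Kn : lv M (c n) := lev_sub nM (lev_c n).
(* The conjugate of [E]. Their product shows [4 - c M ^+ 2] to be the square of
   [(2 - c n) / (v * g v)], against [lev_spec]. *)
have E' : g v ^+ 2 * (2 - c M) = 2 - c n.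
  have Kc := lev_c M; have Kv2 := sfX sM 2 Kv.
  have := congr1 g E; rewrite (homM hg Kv2) ?(homX sM hg 2 Kv) ?(homD sM hg K2 Kc) //.
    by rewrite (homB hg K2 KcM) (hom_nat sM hg) gc (gK _ Kn).
  exact: (sfD sM).
have [a [b [Ka Kb vE]]] := Kv.
have Kvv : lv M (v * g v).
  have -> : v * g v = a ^+ 2 - b ^+ 2 * c M ^+ 2 by rewrite vE gE //; ring.
  apply: (sfB sm); first exact: sfX.
  by apply: (sfM sm); [exact: sfX | exact: lev_c2].
have d0 : 2 - c n != 0.
  have := c_sqr_lt4 n; case: eqP => // /subr0_eq <-.
  by rewrite expr2 -natrM ltxx.
have vv0 : v * g v != 0.
  apply: contra d0; rewrite mulf_eq0 => /orP[]/eqP v0.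
    by rewrite -E v0 expr0n mul0r.
  by rewrite -E' v0 expr0n mul0r.
apply: (nsq ((2 - c n) / (v * g v))).
  by apply: (sf_div sm) => //; apply: (sfB sm) => //; exact: sf_nat.
rewrite expr_div_n expr2 -{1}E -E'; move: vv0; rewrite mulf_eq0 negb_or => /andP[v0 gv0].
by field; rewrite v0 gv0.
Qed.

(* [2 - c n = 4 - c n.+1 ^+ 2] has no square root in the whole tower. *)
Lemma lev_no_sqrt n M y : (n < M)%N -> lv M y -> y ^+ 2 <> 2 - c n.
Proof.
elim: n M y => [|n IH]; apply: lev_no_sqrt_step => z Kz; last first.
  by rewrite cS_sqr => E; apply: (IH n.+2 z) => //; rewrite E; ring.
have [_ Kc2 nKc _ nsq] := lev_spec 0; have s0 := lev_sf 0 => E.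
have [u [v [Ku Kv zE]]] := Kz.
have Kz2 : lv 0 ((u + v * c 0) ^+ 2).
  by rewrite -zE E; apply: (sfB s0) => //; exact: sf_nat.
have [u0|v0] := adj_sqr_base s0 Kc2 nKc Ku Kv Kz2; last first.
  by apply: (nsq u) => //; rewrite -E zE v0 mul0r addr0.
(* What remains is [v ^+ 2 * delta = r], which makes [r * delta] a square in [E1]. *)
apply: (@d_nsq_rd _ D (v * delta%:R)); first by apply: (sfM s0) => //; exact: sf_nat.
move: E; rewrite zE u0 add0r exprMn c0_norm c0_sq mulrA => /(divIf hj0) E.
by rewrite exprMn [_%:R ^+ 2]expr2 mulrA E natrM.
Qed.

(** [SF_step] climbs the tower because [4 - c n.+1 ^+ 2 = 2 - c n]. At the bottom, [4 - c 0 ^+ 2] is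
    [r] up to a power of the unit [w]. *)
Lemma SF_lev n : SF w (lv n.+1) (2 + c n) /\ SF w (lv n.+1) (2 - c n).
Proof.
have W := dw_gt0 D; have W2 := dw_sq D.
elim: n => [|n [_ IH]].
  have sf0 : SF w (lv 0) (4 - c 0 ^+ 2).
    move=> z y Kz Bz By; rewrite c0_norm -w2jE => E.
    have -> : z / (r%:R / w ^+ (2 * j)) = z / r%:R * w ^+ (2 * j).
      by rewrite invf_div mulrA mulrAC.
    apply: BBM; last by apply: BB_OO; apply: OOX; exact: OO_w W2.
    apply: (@d_sf _ D z (y * (w ^+ (2 * j))^-1)) => //; last by rewrite E; ring.
    by apply: BBM => //; exact: BB_Vwn.
  by split; apply: (SF_step W2 (lev_sf 0) (lev_w 0) (lev_c2 0) (@lev_nc 0) (BB_c 0) _ sf0);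
    auto.
have sfn : SF w (lv n.+1) (4 - c n.+1 ^+ 2).
  by rewrite cS_sqr (_ : 4 - (2 + c n) = 2 - c n) //; ring.
by split; apply: (SF_step W2 (lev_sf n.+1) (lev_w n.+1) (lev_c2 n.+1) (@lev_nc n.+1)
  (BB_c n.+1) _ sfn); auto.
Qed.

Lemma Tb_double m y : Tb m.*2 y = Tb m (y ^+ 2 - 2).
Proof. by rewrite /Tb double_eq0 T_double. Qed.

Lemma Tb_mulr m y : Tb m.*2 y * y = T m.*2.+1 y + (if m == 0%N then 0 else T m.*2.-1 y).
Proof.
case: m => [|m]; first by rewrite /Tb /=; ring.
rewrite /Tb double_eq0 -[m.+1 == 0%N]/false.
by have := @T_mul R m.+1.*2 1%N y isT; rewrite addn1 subn1 => <-.
Qed.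

Definition tsum n (a : nat -> R) y := \sum_(m < 2 ^ n) a m * Tb m y.

(** The change of basis for one level, [y] being the new generator and [y ^+ 2 - 2] the old one:
    [T m] becomes [T (2 m)], and multiplying that by [y] gives [T (2 m + 1) + T (2 m - 1)]. *)
Lemma tsum_double n (u v : nat -> R) y : v (2 ^ n)%N = 0 ->
  tsum n u (y ^+ 2 - 2) + tsum n v (y ^+ 2 - 2) * y =
  tsum n.+1 (fun m => if odd m then v m./2 + v m./2.+1 else u m./2) y.
Proof.
move=> v0; rewrite /tsum.
have sum2 (N : nat) (F : nat -> R) : \sum_(m < N.*2) F m = \sum_(m < N) (F m.*2 + F m.*2.+1).
  elim: N => [|N IH]; first by rewrite !big_ord0.
  by rewrite doubleS !big_ord_recr /= IH addrA.
rewrite expnS mul2n.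
rewrite (sum2 _ (fun m => (if odd m then v m./2 + v m./2.+1 else u m./2) * Tb m y)).
rewrite big_split /=; congr (_ + _).
  by apply: eq_bigr => m _; rewrite odd_double half_double Tb_double.
rewrite big_distrl /=.
under [LHS]eq_bigr => m _ do rewrite -mulrA -Tb_double Tb_mulr mulrDr.
under [RHS]eq_bigr => m _ do rewrite odd_double uphalf_double mulrDl.
rewrite !big_split /=; congr (_ + _).
(* The [T (2 m - 1)] terms are the [v m./2.+1] terms with the index shifted by one. Both boundary
   terms vanish, the upper one by [v0]. *)
pose G m := v m * (if m == 0%N then 0 else T m.*2.-1 y).
have G0 : G 0%N = 0 by rewrite /G mulr0.
have GN : G (2 ^ n)%N = 0 by rewrite /G v0 mul0r.
transitivity (\sum_(m < (2 ^ n).+1) G m).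
  by rewrite big_ord_recr /= GN addr0.
by rewrite big_ord_recl /= G0 add0r.
Qed.

(** Away from [w], the integers of each level are free over those of level 1 on the Chebyshev basis;
    [SF_split] supplies each step. *)
Lemma lev_coords n x : lv n.+1 x -> BB w x -> exists a : nat -> R,
  [/\ forall m, lv 1 (a m), forall m, BB w (a m), forall m, (2 ^ n <= m)%N -> a m = 0
    & x = tsum n a (c n)].
Proof.
have W := dw_gt0 D; have W2 := dw_sq D.
elim: n x => [|n IH] x Kx Bx.
  exists (fun m => if m is 0 then x else 0); split=> [[|m]|[|m]|[|m]|] //.
  - by apply: (sf0 (lev_sf 1)).
  - exact: BB_nat 0%N.
  - by rewrite /tsum expn0 big_ord_recl big_ord0 /Tb /= mulr1 addr0.
have [u [v [Ku Kv xE]]] := Kx.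
have sfn : SF w (lv n.+1) (c n.+1 ^+ 2) by rewrite cS_sqr; exact: (SF_lev n).1.
rewrite xE in Bx.
have [Bu Bv] := SF_split W2 (dh_even D) (lev_sf n.+1) (lev_w n.+1) (lev_c2 n.+1) (@lev_nc n.+1)
  (BB_c n.+1) sfn Ku Kv Bx.
have [a [Ka Ba a0 uE]] := IH u Ku Bu; have [b [Kb Bb b0 vE]] := IH v Kv Bv.
exists (fun m => if odd m then b m./2 + b m./2.+1 else a m./2); split.
- by move=> m; case: ifP => // _; exact: (sfD (lev_sf 1)).
- by move=> m; case: ifP => // _; exact: (BBD W2).
- move=> m; rewrite expnS mul2n => mN.
  have m2 : (2 ^ n <= m./2)%N by rewrite -(half_double (2 ^ n)%N); exact: half_leq.
  by case: ifP => _; rewrite ?a0 ?b0 ?addr0 // ltnW.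
have cE : c n = c n.+1 ^+ 2 - 2 by rewrite cS_sqr; ring.
by rewrite xE uE vE cE tsum_double // b0.
Qed.

End Levels.

(** * Divisibility by roots of [w], in place of valuations at [w] *)

Section Ramification.
Context {R : realType} (D : datum R) (eps : nat -> bool).
Notation w := (dw D).
Notation h := (dh D).
Notation r := (dr D).
Notation j := (dj D).
Notation delta := (dd D).
Notation E1 := (dE D).
Notation c := (ch D eps).
Notation lv := (lev D eps).
Implicit Types (x y z u v d : R) (f g : R -> R).

Let W := dw_gt0 D.
Let W2 := dw_sq D.
Let w0 : w != 0. Proof. by rewrite gt_eqF. Qed.

Lemma delta_bezout : exists a b : int, a * delta%:Z + b * h%:Z = 1.
Proof.
have /coprimezP[[a b] /= E] : coprimez r h by rewrite coprimezE; exact: d_coprime.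
have S := congr1 Posz (d_sum D); rewrite PoszD PoszM in S.
have jE : (h ^ j)%N = (h * h ^ j.-1)%N by rewrite -expnS prednK // odd_gt0 // dj_odd.
exists (- a), (b + 4 * a * (h ^ j.-1)%N%:Z).
have -> : delta%:Z = 4 * (h%:Z * (h ^ j.-1)%N%:Z) - r%:Z by rewrite -PoszM -jE -S addrK.
by rewrite -[RHS]E; ring.
Qed.

Lemma OO_cancel_delta (k y : R) : OO (h%:R / k) -> OO y -> OO (delta%:R * y / k) ->
  OO (y / k).
Proof.
move=> Ohk Oy Ody; have [a [b E]] := delta_bezout.
have {}E : a%:~R * delta%:R + b%:~R * h%:R = 1 :> R.
  by rewrite -[delta%:R]/(delta%:Z%:~R) -[h%:R]/(h%:Z%:~R) -!intrM -intrD E.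
have -> : y / k = a%:~R * (delta%:R * y / k) + b%:~R * y * (h%:R / k).
  transitivity ((a%:~R * delta%:R + b%:~R * h%:R) * y / k); last by ring.
  by rewrite E mul1r.
by apply: OOD; apply: OOM => //; [exact: OO_int | apply: OOM => //; exact: OO_int].
Qed.

Lemma OO_hw : OO (h%:R / w).
Proof. by rewrite -W2 expr2 mulfK //; exact: OO_w W2. Qed.

Let x0 : R := w ^+ j * c 0.

Let x0_sq : x0 ^+ 2 = delta%:R.
Proof.
by rewrite exprMn c0_sq -exprM mulnC w2jE mulrC divfK // -w2jE expf_neq0.
Qed.

Let OO_x0 : OO x0.
Proof. by apply: (@OO_rootX _ _ 2%N) => //; rewrite x0_sq; exact: OO_nat. Qed.

Let om : R := (1 + x0) / 2.
Let kp := (delta %/ 4)%N.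

Let deltaE : delta%:R = 4 * kp%:R + 1 :> R.
Proof. by rewrite {1}(divn_eq delta 4) d_mod4 natrD natrM mulrC. Qed.

Let om_sq : om ^+ 2 = om + kp%:R.
Proof.
have := x0_sq; rewrite deltaE => E.
have -> : om ^+ 2 = (1 + 2 * x0 + x0 ^+ 2) / 4 by rewrite /om; field.
by rewrite E /om; field.
Qed.

Let OO_om : OO om.
Proof.
apply: (@OO_quadratic _ _ 1 (- kp%:R)); first exact: OO1.
  by apply: OON; exact: OO_nat.
by rewrite om_sq; ring.
Qed.

Let om_eq0 u v : E1 u -> E1 v -> u + v * om = 0 -> u = 0 /\ v = 0.
Proof.
move=> Eu Ev E; have s1 := @sE1 _ D.
have E2 : E1 2^-1 by apply: (sfV s1); exact: sf_nat.
have [] := @adj_eq0 _ E1 (c 0) s1 (@lev_nc _ D eps 0) (u + v * 2^-1) (v * 2^-1 * w ^+ j).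
- by apply: (sfD s1) => //; exact: (sfM s1).
- by apply: (sfM s1); [exact: (sfM s1) | apply: sfX => //; exact: dE_w].
- by rewrite -[RHS]E /om /x0; ring.
move=> E3 /eqP; rewrite !mulf_eq0 expf_eq0 (negbTE w0) andbF orbF invr_eq0 pnatr_eq0 orbF.
by move/eqP => v0; move: E3; rewrite v0 mul0r addr0.
Qed.

(** [delta] is the discriminant of the basis 1, [om], so it clears the denominators. *)
Let om_coords z : lv 1 z -> OO z -> exists p p',
  [/\ E1 p, E1 p', OO p, OO p' & delta%:R * z = p + p' * om].
Proof.
move=> Kz Oz; have s1 := @sE1 _ D.
have [g [hg gK gc gE]] := adj_conj s1 (@lev_c2 _ D eps 0) (@lev_nc _ D eps 0).
have Ogz : OO (g z) := OO_hom (lev_sf D eps 1) hg Kz Oz.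
have Ow : E1 w by exact: dE_w.
have Op' : OO (x0 * (z - g z)) by apply: OOM => //; exact: OOB.
exists (delta%:R * z - x0 * (z - g z) * om), (x0 * (z - g z)); split=> //; last by ring.
- have [u [v [Ku Kv ->]]] := Kz; rewrite gE //.
  have -> : delta%:R * (u + v * c 0) - x0 * (u + v * c 0 - (u - v * c 0)) * om
    = delta%:R * u - v * w ^+ j * c 0 ^+ 2 + (delta%:R - x0 ^+ 2) * (v * c 0).
    by rewrite /om /x0; field.
  rewrite x0_sq subrr mul0r addr0; apply: (sfB s1).
    by apply: (sfM s1) => //; exact: sf_nat.
  apply: (sfM s1); last exact: (@lev_c2 _ D eps 0).
  by apply: (sfM s1) => //; exact: sfX.
- have [u [v [Ku Kv ->]]] := Kz; rewrite gE //.
  have -> : x0 * (u + v * c 0 - (u - v * c 0)) = 2 * v * w ^+ j * c 0 ^+ 2.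
    by rewrite /x0; ring.
  apply: (sfM s1); last exact: (@lev_c2 _ D eps 0).
  apply: (sfM s1); last exact: sfX.
  by apply: (sfM s1) => //; exact: sf_nat.
- by apply: OOB; [apply: OOM => //; exact: OO_nat | exact: OOM].
Qed.

(* Being reduced modulo [w] ascends from [E1] to [E1(x0)], as [x0 ^+ 2 = delta] is prime to [w]
   and [om = (1 + x0) / 2] is integral. *)
Lemma lev1_red z y : lv 1 z -> OO z -> OO y -> z ^+ 2 = w * y -> OO (z / w).
Proof.
move=> Kz Oz Oy E; have s1 := @sE1 _ D; have sK := lev_sf D eps 1.
have Ky : lv 1 y.
  have -> : y = z ^+ 2 / w by rewrite E mulrC mulKf.
  by apply: (sf_div sK); [exact: (sfX sK) | exact: lev_w].
have [p [p' [Ep Ep' Op Op' zE]]] := om_coords Kz Oz.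
have [q [q' [Eq Eq' Oq Oq' yE]]] := om_coords Ky Oy.
have En n : E1 n%:R by exact: sf_nat.
have On n : OO (n%:R : R) by exact: OO_nat.
have Ew : E1 w by exact: dE_w.
have Ow : OO w by exact: OO_w W2.
have [|||/subr0_eq F /subr0_eq G] := @om_eq0 (p ^+ 2 + kp%:R * p' ^+ 2 - delta%:R * w * q)
  (2 * p * p' + p' ^+ 2 - delta%:R * w * q').
- have E2 := sfX s1 2 Ep; have E3 := sfX s1 2 Ep'.
  apply: (sfB s1); last by apply: (sfM s1) => //; exact: (sfM s1).
  by apply: sfD => //; exact: (sfM s1).
- have E3 := sfX s1 2 Ep'.
  apply: (sfB s1); last by apply: (sfM s1) => //; exact: (sfM s1).
  by apply: sfD => //; apply: (sfM s1) => //; exact: (sfM s1).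
- transitivity ((p + p' * om) ^+ 2 - delta%:R * w * (q + q' * om) + p' ^+ 2 * (om + kp%:R - om ^+ 2)).
    by ring.
  by rewrite om_sq -zE -yE exprMn E; ring.
have F' : p ^+ 2 = delta%:R * w * q - kp%:R * p' ^+ 2 by rewrite -F; ring.
(* Modulo [w], [G] gives p'^2 = -2 p p' and [F] gives p^2 = -kp p'^2. Squaring the first, p'^4 = -4
   kp p'^4, that is, delta p'^4 = 0; [Y] is the cofactor of [w]. *)
pose Y := delta%:R ^+ 2 * w * q' ^+ 2 - 4 * delta%:R * q' * p * p' + 4 * delta%:R * q * p' ^+ 2.
have OY : OO Y.
  apply: OOD; first apply: OOB.
  - by apply: OOM; [apply: OOM => //; exact: OOX | exact: OOX].
  - by do 4 apply: OOM => //; exact: (On 4%N).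
  - by apply: OOM; [do 2 apply: OOM => //; exact: (On 4%N) | exact: OOX].
have E4 : delta%:R * (p' ^+ 2) ^+ 2 = w * Y.
  have G' : p' ^+ 2 = delta%:R * w * q' - 2 * p * p' by rewrite -G; ring.
  have : (p' ^+ 2) ^+ 2 = (delta%:R * w * q' - 2 * p * p') ^+ 2 by rewrite -G'.
  have -> : (delta%:R * w * q' - 2 * p * p') ^+ 2 = (delta%:R * w * q') ^+ 2
    - 4 * delta%:R * w * q' * p * p' + 4 * p ^+ 2 * p' ^+ 2 by ring.
  rewrite F' => E5; rewrite {1}deltaE mulrDl mul1r {2}E5 /Y; ring.
have Op4 : OO ((p' ^+ 2) ^+ 2 / w).
  apply: OO_cancel_delta; [exact: OO_hw | by do 2 apply: OOX |].
  by rewrite E4 mulrC mulKf.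
have Op2 : OO (p' ^+ 2 / w).
  apply: (@d_red _ D _ ((p' ^+ 2) ^+ 2 / w)) => //; first exact: (sfX s1).
    exact: OOX.
  by rewrite mulrC divfK.
have Op1 : OO (p' / w).
  by apply: (@d_red _ D _ (p' ^+ 2 / w)) => //; rewrite mulrC divfK.
have Opw : OO (p / w).
  apply: (@d_red _ D _ (delta%:R * q - kp%:R * (p' ^+ 2 / w))) => //.
    by apply: OOB; exact: OOM.
  by rewrite F'; field.
apply: OO_cancel_delta => //; first exact: OO_hw.
by rewrite zE mulrDl mulrAC; apply: OOD => //; exact: OOM.
Qed.

Lemma lev1_red_iter k z y : lv 1 z -> OO z -> OO y -> z ^+ (2 ^ k) = w * y -> OO (z / w).
Proof.
move=> Kz Oz; elim: k y => [|k IH] y Oy E.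
  by rewrite -[z]expr1 -[1%N](expn0 2) E mulrC mulKf.
apply: (IH (z ^+ (2 ^ k) / w)); last by rewrite mulrC divfK.
apply: (lev1_red _ _ Oy); [exact: (sfX (lev_sf D eps 1)) | exact: OOX |].
by rewrite -exprM -expnSr.
Qed.

(** The [2 ^ n]-th root of [w]. It need not lie in the tower: [OO] contains all real algebraic
    integers, and divisibility by [kap n] there stands for valuation at least [1 / 2 ^ n]. *)
Fixpoint kap n : R := if n is m.+1 then Num.sqrt (kap m) else w.

Lemma kap_gt0 n : 0 < kap n.
Proof. by elim: n => //= n IH; rewrite sqrtr_gt0. Qed.

Let k0 n : kap n != 0. Proof. by rewrite gt_eqF ?kap_gt0. Qed.

Lemma kap_sq n : kap n.+1 ^+ 2 = kap n.
Proof. by rewrite /= sqr_sqrtr // ltW ?kap_gt0. Qed.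

Lemma kap_exp n : kap n ^+ (2 ^ n) = w.
Proof. by elim: n => // n IH; rewrite expnS exprM kap_sq. Qed.

Lemma OO_kap n : OO (kap n).
Proof.
elim: n => [|n IH]; first exact: OO_w W2.
by apply: (@OO_rootX _ _ 2%N) => //; rewrite kap_sq.
Qed.

Let j_gt0 : (0 < j)%N. Proof. by rewrite odd_gt0 // dj_odd. Qed.

(** [c n] rescaled to valuation 0 at [w]; it is a unit modulo [kap n] by [xc_exp], since
    [x0 ^+ 2 = delta] is prime to [w]. *)
Definition xc n : R := kap n ^+ j * c n.

Lemma xcS_sq n : xc n.+1 ^+ 2 = xc n + kap n.+1 * (2 * kap n.+1 ^+ (2 * j).-1).
Proof.
rewrite /xc exprMn cS_sqr -exprM mulnC exprM kap_sq.
have -> : kap n.+1 * (2 * kap n.+1 ^+ (2 * j).-1) = 2 * kap n ^+ j.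
  rewrite mulrCA -exprS prednK ?muln_gt0 // exprM kap_sq //.
by ring.
Qed.

Lemma OO_xc n : OO (xc n).
Proof.
elim: n => [|n IH]; first exact: OO_x0.
apply: (@OO_rootX _ _ 2%N) => //; rewrite xcS_sq; apply: OOD => //.
apply: OOM; first exact: OO_kap.
by apply: OOM; [exact: (OO_nat 2) | apply: OOX; exact: OO_kap].
Qed.

Lemma pow_congr (a k e : R) m : OO a -> OO k -> OO e ->
  exists2 e', OO e' & (a + k * e) ^+ m = a ^+ m + k * e'.
Proof.
move=> Oa Ok Oe; elim: m => [|m [e' Oe' E]].
  by exists 0; [exact: OO0 | rewrite mulr0 addr0].
exists (e * a ^+ m + (a + k * e) * e').
  apply: OOD; apply: OOM => //; first exact: OOX.
  by apply: OOD => //; exact: OOM.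
by rewrite exprS E exprS; ring.
Qed.

Lemma xc_exp n : exists2 e, OO e & xc n ^+ (2 ^ n) = x0 + kap n * e.
Proof.
elim: n => [|n [e Oe E]]; first by exists 0; [exact: OO0 | rewrite mulr0 addr0].
have Ok := OO_kap n.+1.
have Oe1 : OO (2 * kap n.+1 ^+ (2 * j).-1).
  by apply: OOM; [exact: (OO_nat 2) | apply: OOX].
have [e' Oe' E'] := @pow_congr _ _ _ (2 ^ n)%N (OO_xc n) Ok Oe1.
exists (kap n.+1 * e + e'); first by apply: OOD => //; exact: OOM.
by rewrite expnS exprM xcS_sq E' E -kap_sq; ring.
Qed.

Definition tau n m : R := kap n ^+ (j * m) * T m (c n).

Lemma tauSS n m : tau n m.+2 = xc n * tau n m.+1 - kap n ^+ (2 * j) * tau n m.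
Proof.
rewrite /tau TSS /xc; have -> : (j * m.+2 = j + j * m.+1)%N by lia.
rewrite exprD mulrBr; congr (_ - _); first by ring.
by rewrite mulrA -!exprD; congr (_ ^+ _ * _); lia.
Qed.

Lemma OO_tau n m : OO (tau n m).
Proof.
elim/nat_ind2: m => [||m IH0 IH1].
- by rewrite /tau muln0 mul1r; exact: (OO_nat 2).
- by rewrite /tau muln1; exact: OO_xc.
rewrite tauSS; apply: OOB; apply: OOM => //; first exact: OO_xc.
by apply: OOX; exact: OO_kap.
Qed.

Lemma tau_congr n m : exists2 e, OO e & tau n m.+1 = xc n ^+ m.+1 + kap n * e.
Proof.
elim: m => [|m [e Oe E]].
  by exists 0; [exact: OO0 | rewrite /tau muln1 mulr0 addr0].
exists (xc n * e - kap n ^+ (2 * j).-1 * tau n m).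
  apply: OOB; apply: OOM => //; first exact: OO_xc.
    by apply: OOX; exact: OO_kap.
  exact: OO_tau.
have kE : kap n ^+ (2 * j) = kap n * kap n ^+ (2 * j).-1.
  by rewrite -exprS prednK ?muln_gt0.
by rewrite tauSS E kE (exprS _ m.+1); ring.
Qed.

Lemma OO_hkap n : OO (h%:R / kap n).
Proof.
rewrite -W2 -(kap_exp n) -exprM -[X in _ ^+ X]prednK ?muln_gt0 ?expn_gt0 //.
by rewrite exprS mulrC mulKf //; apply: OOX; exact: OO_kap.
Qed.

(** [tau n m.+1] is [xc n ^+ m.+1] modulo [kap n], a unit there. So [kap n] divides a power of [d],
    hence [w] divides a higher power, and level 1 is reduced modulo [w]. *)
Lemma tau_coprime n m d : lv 1 d -> OO d -> OO (d * tau n m.+1 / kap n) -> OO (d / w).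
Proof.
move=> Kd Od Ot; have Ok := OO_kap n.
have [e Oe E] := tau_congr n m; have [e' Oe' E'] := xc_exp n.
pose N := (2 ^ n)%N.
have O1 : OO (d * xc n ^+ m.+1 / kap n).
  have -> : d * xc n ^+ m.+1 / kap n = d * tau n m.+1 / kap n - d * e.
    by rewrite E; field.
  by apply: OOB => //; exact: OOM.
have [e2 Oe2 E2] := pow_congr m.+1 OO_x0 Ok Oe'.
have N0 : (0 < N)%N by rewrite expn_gt0.
have O2 : OO (d ^+ N * x0 ^+ m.+1 / kap n).
  (* The [N]-th power turns [xc n] into [x0] modulo [kap n]. *)
  have -> : d ^+ N * x0 ^+ m.+1 / kap n =
    (d * xc n ^+ m.+1 / kap n) ^+ N * kap n ^+ N.-1 - d ^+ N * e2.
    have -> : (d * xc n ^+ m.+1 / kap n) ^+ N * kap n ^+ N.-1 =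
      d ^+ N * (xc n ^+ N) ^+ m.+1 / kap n.
      have kN : kap n ^+ N = kap n * kap n ^+ N.-1 by rewrite -exprS prednK.
      have kN0 : kap n ^+ N.-1 != 0 by exact: expf_neq0.
      rewrite expr_div_n exprMn exprAC kN; move: (kap n ^+ N.-1) kN0 => k1 k10.
      by field; rewrite k0 k10.
    by rewrite E' E2; field.
  apply: OOB; apply: OOM => //; [exact: OOX | exact: OOX | exact: OOX].
have O3 : OO (d ^+ N / kap n).
  have O4 : OO (delta%:R ^+ m.+1 * d ^+ N / kap n).
    have -> : delta%:R ^+ m.+1 * d ^+ N / kap n = x0 ^+ m.+1 * (d ^+ N * x0 ^+ m.+1 / kap n).
      by rewrite -x0_sq -exprM mul2n -addnn exprD; ring.
    by apply: OOM => //; exact: OOX.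
  elim: (m.+1) O4 => [|i IH]; first by rewrite mul1r.
  move=> O4; apply: IH; apply: OO_cancel_delta.
  - exact: OO_hkap.
  - by apply: OOM; apply: OOX => //; exact: OO_nat.
  - by rewrite mulrA -exprS.
apply: (@lev1_red_iter (n + n) _ ((d ^+ N / kap n) ^+ N)) => //; first exact: OOX.
by rewrite expr_div_n kap_exp expnD exprM mulrC divfK.
Qed.

Lemma one_coprime n d : lv 1 d -> OO d -> OO (d / kap n) -> OO (d / w).
Proof.
move=> Kd Od Ot; apply: (@lev1_red_iter n _ ((d / kap n) ^+ (2 ^ n))) => //.
  exact: OOX.
by rewrite expr_div_n kap_exp mulrC divfK.
Qed.

End Ramification.

(** * Integrality of the coordinates at [w] *)

Section IntegralCoordinates.
Context {R : realType} (D : datum R) (eps : nat -> bool) (n : nat).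
Notation w := (dw D).
Notation j := (dj D).
Notation c := (ch D eps).
Notation lv := (lev D eps).
Notation kp := (kap D n).
Notation N := (2 ^ n)%N.
Implicit Types (x : R) (m i K : nat) (a : nat -> R).

Let W2 := dw_sq D.
Let w0 : w != 0. Proof. by rewrite gt_eqF ?dw_gt0. Qed.
Let N0 : (0 < N)%N. Proof. by rewrite expn_gt0. Qed.
Let k0 : kp != 0. Proof. by rewrite gt_eqF ?kap_gt0. Qed.
Let j0 : (0 < j)%N. Proof. by rewrite odd_gt0 // dj_odd. Qed.

(* [T m (c n)] has [w]-adic valuation [- j m / 2 ^ n], so [wexp m] is the least exponent of [w]
   that makes it integral, and [wfrac m / 2 ^ n] is the valuation of the resulting product. *)
Definition wexp m := ((j * m + N.-1) %/ N)%N.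
Definition wfrac m := (N * wexp m - j * m)%N.

Lemma wexpE m : (N * wexp m = j * m + wfrac m)%N /\ (wfrac m < N)%N.
Proof.
have L := ltn_pmod (j * m + N.-1) N0; have E := divn_eq (j * m + N.-1) N.
rewrite -/(wexp m) (mulnC (wexp m)) in E; rewrite /wfrac; move: E L N0.
move: ((j * m + N.-1) %% N)%N (N * wexp m)%N => u v.
by move: (j * m)%N N => k M; lia.
Qed.

(** [j] is odd, hence invertible modulo the power of two [N]. *)
Lemma wfrac_inj m m' : (m < N)%N -> (m' < N)%N -> wfrac m = wfrac m' -> m = m'.
Proof.
wlog le_mm : m m' / (m <= m')%N => [hw mN m'N E|mN m'N E].
  by case/orP: (leq_total m m') => le; [exact: hw | exact/esym/hw].
have [E1 _] := wexpE m; have [E2 _] := wexpE m'.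
have : (N %| j * (m' - m))%N.
  apply/dvdnP; exists (wexp m' - wexp m)%N; rewrite mulnBr mulnBl !(mulnC _ N) E1 E2 E.
  by rewrite subnDr.
rewrite Gauss_dvdr; last by rewrite coprimeXl // coprime2n dj_odd.
move=> dv; have : (m' - m)%N = 0%N.
  apply/eqP; apply: contraTT dv; rewrite -lt0n => p; rewrite gtnNdvd //.
  by rewrite (leq_ltn_trans (leq_subr _ _)).
by move/eqP; rewrite subn_eq0 => le; apply/eqP; rewrite eqn_leq le_mm.
Qed.

Lemma wexp0 : wexp 0 = 0%N.
Proof. by rewrite /wexp muln0 add0n divn_small // prednK. Qed.

Lemma wexp_ge1 m : (0 < m)%N -> (1 <= wexp m)%N.
Proof.
move=> m0; rewrite lt0n; apply/eqP => E; have [E2 _] := wexpE m.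
have : (0 < j * m)%N by rewrite muln_gt0 j0.
by move: E2; rewrite E muln0; move: (j * m)%N (wfrac m) => a b; lia.
Qed.

Lemma wexp_half m : (N <= m.*2)%N -> (j.+1./2 <= wexp m)%N.
Proof.
move=> Nm; have [E _] := wexpE m; have jodd := dj_odd D.
have : (N * j <= N * (wexp m).*2)%N.
  by rewrite -muln2 mulnA E mulnDl (mulnC N) -mulnA muln2 (leq_trans _ (leq_addr _ _)) //
    leq_mul.
by rewrite leq_pmul2l //; lia.
Qed.

Definition taub m : R := kp ^+ (j * m) * Tb m (c n).

Lemma OO_taub m : OO (taub m).
Proof.
case: m => [|m]; first by rewrite /taub muln0 /Tb mul1r; exact: OO1.
exact: (OO_tau D eps n m.+1).
Qed.

Lemma taub_coprime m d : lv 1 d -> OO d -> OO (d * taub m / kp) -> OO (d / w).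
Proof.
case: m => [|m] Kd Od; last exact: tau_coprime.
rewrite /taub muln0 /Tb mul1r mulr1; exact: one_coprime Kd Od.
Qed.

Lemma wexp_taub m : w ^+ wexp m * Tb m (c n) = kp ^+ wfrac m * taub m.
Proof.
by rewrite /taub mulrA -exprD addnC -(wexpE m).1 exprM kap_exp.
Qed.

(** The ultrametric argument, by induction on [i = wfrac m]. The whole sum is divisible by [w],
    terms with smaller [wfrac] are so by induction, and those with larger [wfrac] contain
    [kp ^+ i.+1]. So [kp] divides [d m * taub m], and [taub_coprime] applies. *)
Lemma coords_step K x a : OO x -> x = tsum n a (c n) -> (forall m, lv 1 (a m)) ->
  (forall m, (m < N)%N -> OO (w ^+ K.+1 * a m / w ^+ wexp m)) ->
  forall m, (m < N)%N -> OO (w ^+ K * a m / w ^+ wexp m).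
Proof.
move=> Ox xE Ka Oa.
pose d m : R := w ^+ K.+1 * a m / w ^+ wexp m.
have dw m : w ^+ K * a m / w ^+ wexp m = d m / w.
  by rewrite /d exprS; field; rewrite w0 expf_neq0.
have Kd m : lv 1 (d m).
  have s1 := lev_sf D eps 1; have Kw : lv 1 w := lev_w D eps 1.
  by apply: (sf_div s1); [apply: (sfM s1) => // |]; exact: (sfX s1).
have Ok := OO_kap D n.
have xd : w ^+ K.+1 * x = \sum_(m < N) d m * (kp ^+ wfrac m * taub m).
  rewrite xE /tsum big_distrr /=; apply: eq_bigr => m _.
  by rewrite -wexp_taub /d; field; rewrite expf_neq0.
suff H i m : (m < N)%N -> (wfrac m < i)%N -> OO (d m / w).
  by move=> m mN; rewrite dw; exact: (H (wfrac m).+1).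
elim: i m => // i IH m mN; rewrite ltnS leq_eqVlt => /orP[/eqP fi|]; last exact: IH.
have iN : (i < N)%N by rewrite -fi; case: (wexpE m).
apply: (@taub_coprime m) => //; first exact: Oa.
have kN : w = kp ^+ (N - i.+1) * kp ^+ i.+1 by rewrite -exprD subnK // kap_exp.
have ki0 : kp ^+ i.+1 != 0 by exact: expf_neq0.
have -> : d m * taub m / kp = (w ^+ K.+1 * x
    - \sum_(m' < N | m' != Ordinal mN) d m' * (kp ^+ wfrac m' * taub m')) / kp ^+ i.+1.
  rewrite xd (bigD1 (Ordinal mN)) //= addrK fi (exprS _ i).
  by field; rewrite k0 expf_neq0.
rewrite mulrBl big_distrl /=; apply: OOB.
  have -> : w ^+ K.+1 * x / kp ^+ i.+1 = w ^+ K * x * kp ^+ (N - i.+1).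
    by rewrite exprS {1}kN; field.
  apply: OOM; last exact: OOX.
  by apply: OOM => //; apply: OOX; exact: OO_w W2.
apply: OO_sum => m' nm; have := ltn_ord m' => m'N.
have [lt|gt|eq] := ltngtP (wfrac m') i.
- have -> : d m' * (kp ^+ wfrac m' * taub m') / kp ^+ i.+1 =
    (d m' / w) * kp ^+ wfrac m' * taub m' * kp ^+ (N - i.+1).
    by rewrite {1}kN; field; rewrite ki0 expf_neq0.
  apply: OOM; last exact: OOX.
  apply: OOM; last exact: OO_taub.
  by apply: OOM; [exact: IH | exact: OOX].
- have -> : d m' * (kp ^+ wfrac m' * taub m') / kp ^+ i.+1 =
    d m' * (kp ^+ (wfrac m' - i.+1) * taub m').
    by rewrite -{1}(subnK gt) exprD; field.
  apply: OOM; first exact: Oa.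
  by apply: OOM; [exact: OOX | exact: OO_taub].
- case/eqP: nm; apply/val_inj => /=; apply: wfrac_inj => //.
  by rewrite eq fi.
Qed.

(** A common power of [w] clears all denominators; [coords_step] lowers it to 0. *)
Lemma coords_int x a : OO x -> x = tsum n a (c n) -> (forall m, lv 1 (a m)) ->
  (forall m, BB w (a m)) -> forall m, (m < N)%N -> OO (a m / w ^+ wexp m).
Proof.
move=> Ox xE Ka Ba; suff [K HK] : exists K, forall m, (m < N)%N ->
    OO (w ^+ K * a m / w ^+ wexp m).
  elim: K HK => [HK m mN|K IH HK]; first by have := HK m mN; rewrite mul1r.
  by apply: IH; exact: (coords_step Ox xE Ka HK).
have [b Hb] := choice Ba.
pose M := (\max_(m < N) (b m + wexp m))%N; exists M => m mN.
have le : (b m + wexp m <= M)%N by exact: (leq_bigmax (Ordinal mN)).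
have -> : w ^+ M * a m / w ^+ wexp m = w ^+ (M - (b m + wexp m)) * (w ^+ b m * a m).
  by rewrite -{1}(subnK le) !exprD; field; exact: expf_neq0.
by apply: OOM => //; apply: OOX; exact: OO_w W2.
Qed.

Lemma coords_term x a : OO x -> x = tsum n a (c n) -> (forall m, lv 1 (a m)) ->
  (forall m, BB w (a m)) -> forall m, (m < N)%N -> OO (a m * Tb m (c n)).
Proof.
move=> Ox xE Ka Ba m mN; have Om := coords_int Ox xE Ka Ba mN.
have -> : a m * Tb m (c n) = (a m / w ^+ wexp m) * (w ^+ wexp m * Tb m (c n)).
  by field; exact: expf_neq0.
rewrite wexp_taub; apply: OOM => //.
by apply: OOM; [apply: OOX; exact: OO_kap | exact: OO_taub].
Qed.

Lemma coords_div x a m k : OO x -> x = tsum n a (c n) -> (forall m, lv 1 (a m)) ->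
  (forall m, BB w (a m)) -> (m < N)%N -> (k <= wexp m)%N -> OO (a m / w ^+ k).
Proof.
move=> Ox xE Ka Ba mN le; have Om := coords_int Ox xE Ka Ba mN.
have -> : a m / w ^+ k = (a m / w ^+ wexp m) * w ^+ (wexp m - k).
  by rewrite -{1}(subnK le) exprD; field; rewrite !expf_neq0.
by apply: OOM => //; apply: OOX; exact: OO_w W2.
Qed.

Lemma OO_wc : (j <= N)%N -> OO (w * c n).
Proof.
move=> jN; rewrite -{1}(kap_exp D n) -(subnK jN) exprD -mulrA.
by apply: OOM; [apply: OOX; exact: OO_kap | exact: OO_xc].
Qed.

End IntegralCoordinates.

(** * Averages over sign choices, and Chebyshev orthogonality *)

Section Averages.
Context {R : realType}.
Implicit Types (y : R) (F G : R -> R).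

(** The mean of [F] over the [2 ^ n] points reached from [y] by [n] choices of sign in +-sqrt(2 +
    y): the images of [c n] when [c 0] goes to [y]. *)
Fixpoint avg n F y : R :=
  if n is m.+1 then
    avg m (fun y' => (F (Num.sqrt (2 + y')) + F (- Num.sqrt (2 + y'))) / 2) y
  else F y.

Lemma sqrt2D_lt4 y : y ^+ 2 < 4 ->
  Num.sqrt (2 + y) ^+ 2 = 2 + y /\ Num.sqrt (2 + y) ^+ 2 < 4.
Proof. by move=> y4; have -> : Num.sqrt (2 + y) ^+ 2 = 2 + y; rewrite ?sqr_sqrtr; nra. Qed.

Lemma eq_avg n F G y : y ^+ 2 < 4 -> (forall y, y ^+ 2 < 4 -> F y = G y) ->
  avg n F y = avg n G y.
Proof.
elim: n F G => [|n IH] F G y4 FG /=; first exact: FG.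
apply: IH => // z /sqrt2D_lt4[_ z4]; rewrite !FG // sqrrN //.
Qed.

Lemma avg_sum n (I : Type) (s : seq I) (P : pred I) (b : I -> R) (F : I -> R -> R) y :
  avg n (fun y => \sum_(i <- s | P i) b i * F i y) y =
  \sum_(i <- s | P i) b i * avg n (F i) y.
Proof.
elim: n F => [|n IH] F //=; rewrite -IH; congr avg; apply/funext => z.
by rewrite -big_split big_distrl /=; apply: eq_bigr => i _; field.
Qed.

Lemma avgD n F G y : avg n (fun y => F y + G y) y = avg n F y + avg n G y.
Proof.
elim: n F G => [|n IH] F G //=; rewrite -IH; congr avg; apply/funext => z.
by field.
Qed.

Lemma avg_scale n b F y : avg n (fun y => b * F y) y = b * avg n F y.
Proof.
elim: n F => [|n IH] F //=; rewrite -IH; congr avg; apply/funext => z.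
by field.
Qed.

Lemma avg_cst n b y : avg n (fun=> b) y = b.
Proof.
elim: n => [|n IH] //=; rewrite -[RHS]IH; congr avg; apply/funext => z.
by field.
Qed.

(** For odd [m] the two signs cancel; for even [m] both give [T m./2], one level down. *)
Lemma avg_T n m y : y ^+ 2 < 4 ->
  avg n (T m) y = if (2 ^ n %| m)%N then T (m %/ 2 ^ n) y else 0.
Proof.
move=> y4; elim: n m => [|n IH] m; first by rewrite dvd1n divn1.
case: (boolP (odd m)) => om /=.
  rewrite (_ : (2 ^ n.+1 %| m)%N = false); last first.
    apply/negP => /(dvdn_trans (dvdn_exp2l 2 (ltn0Sn n))); rewrite expn1 dvdn2.
    by rewrite om.
  rewrite -[RHS](avg_cst n 0 y); congr avg; apply/funext => z.
  by rewrite T_opp -signr_odd om expr1; field.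
have -> : m = (m./2).*2 by rewrite -[LHS](odd_double_half m) (negbTE om).
rewrite expnS mul2n -!mul2n dvdn_pmul2l // divnMl // -IH.
apply: eq_avg => // z /sqrt2D_lt4[zE _].
by rewrite T_opp -signr_odd mul2n odd_double mul1r T_double zE (addrC 2 z) addrK; field.
Qed.

Section Orthogonality.
Context (n : nat).
Notation N := (2 ^ n)%N.

Let N0 : (0 < N)%N. Proof. by rewrite expn_gt0. Qed.

Definition tpart (al : nat -> R) y := \sum_(m < N | (0 < m)%N) al m * T m y.

Lemma avg_tpart al y : y ^+ 2 < 4 -> avg n (tpart al) y = 0.
Proof.
move=> y4; rewrite avg_sum big1 // => m m0.
by rewrite avg_T // gtnNdvd ?mulr0.
Qed.

(** Of [T (m + k)] and [T (m - k)] only indices divisible by [N] survive: [T 1 = y] and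
    [T 0 = 2]. *)
Lemma avg_TT y (m k : nat) : y ^+ 2 < 4 -> (0 < m < N)%N -> (0 < k < N)%N ->
  avg n (fun y => T m y * T k y) y =
  (if (m + k == N)%N then y else 0) + (if m == k then 2 else 0).
Proof.
wlog km : m k / (k <= m)%N => [hw|] y4 mN kN.
  case/orP: (leq_total k m) => le; first exact: hw.
  rewrite addnC [m == k]eq_sym -hw //; congr avg; apply/funext => z; exact: mulrC.
have -> : (fun y => T m y * T k y) = (fun y => T (m + k) y + T (m - k) y).
  by apply/funext => z; rewrite T_mul.
rewrite avgD !avg_T //; congr (_ + _).
  have [->|ne] := eqVneq (m + k)%N N; first by rewrite dvdnn divnn N0.
  case: (boolP (N %| m + k)%N) => // /dvdnP[q qE]; exfalso.
  have : (q * N < 2 * N)%N by rewrite -qE mul2n -addnn; lia.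
  rewrite ltn_pmul2r //; case: q qE => [|[|q]] // qE; first by lia.
  by move: ne; rewrite qE mul1n eqxx.
have [->|ne] := eqVneq m k; first by rewrite subnn dvdn0 div0n.
by rewrite gtnNdvd //; lia.
Qed.

Lemma avg_tpart_sqr al y : y ^+ 2 < 4 -> avg n (fun y => tpart al y ^+ 2) y =
  \sum_(m < N | (0 < m)%N) (2 * al m ^+ 2 + y * al m * al (N - m)%N).
Proof.
move=> y4.
have -> : (fun y => tpart al y ^+ 2) = (fun y => \sum_(m < N | (0 < m)%N) al m *
    (\sum_(k < N | (0 < k)%N) al k * (T m y * T k y))).
  apply/funext => z; rewrite expr2 big_distrl; apply: eq_bigr => m _ /=.
  by rewrite -mulrA big_distrr; congr (_ * _); apply: eq_bigr => k _; rewrite mulrCA.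
rewrite avg_sum; apply: eq_bigr => m m0; rewrite avg_sum.
have mN : (0 < m < N)%N by rewrite m0 ltn_ord.
transitivity (al m * (al m * 2 + al (N - m)%N * y)); last by ring.
congr (_ * _).
under eq_bigr => k k0 do rewrite avg_TT // ?k0 ?ltn_ord // mulrDr.
rewrite big_split addrC /=; congr (_ + _).
  have Nm : (N - m < N)%N by lia.
  rewrite (bigD1 (Ordinal Nm)) /=; last by lia.
  rewrite subnKC ?eqxx ?big1 ?addr0 //; last by lia.
  move=> k /andP[_ km]; rewrite ifF ?mulr0 //; apply: contraNF km => /eqP E.
  by apply/eqP/val_inj => /=; lia.
rewrite (bigD1 m) //= eqxx big1 ?addr0 // => k /andP[_ km].
by rewrite eq_sym (negbTE km : (k == m :> nat) = false) mulr0.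
Qed.

End Orthogonality.

End Averages.

Lemma hom_T (R : realType) (K : set R) (f : R -> R) m y : subfield K -> hom K f -> K y ->
  K (T m y) /\ f (T m y) = T m (f y).
Proof.
move=> sK hf Ky; elim/nat_ind2: m => [|//|m [K0 E0] [K1 E1]].
  by split; [exact: (sf_nat sK 2) | exact: (hom_nat sK hf 2)].
have K2 := sfM sK Ky K1; split; first by rewrite TSS; exact: (sfB sK).
by rewrite !TSS (homB hf K2 K0) (homM hf Ky K1) E0 E1.
Qed.

(** * The variance inequality for elements with conjugates in [(0, s)] *)

Section Embeddings.
Context {R : realType} (D : datum R) (eps : nat -> bool).
Notation w := (dw D).
Notation h := (dh D).
Notation r := (dr D).
Notation j := (dj D).
Notation c := (ch D eps).
Notation lv := (lev D eps).
Implicit Types (x y z u v : R) (f g : R -> R) (a : nat -> R).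

Lemma lev_ext_c n f (b : bool) : hom (lv n.+1) f -> exists g,
  [/\ hom (lv n.+2) g, forall x, lv n.+1 x -> g x = f x
    & g (c n.+1) = (-1) ^+ b * Num.sqrt (2 + f (c n))].
Proof.
move=> hf; have [g [hg gK gc]] := lev_ext b hf; exists g; split=> //.
rewrite gc cS_sqr (homD (lev_sf D eps n.+1) hf) ?(hom_nat (lev_sf D eps n.+1) hf) //.
  exact: (sf_nat (lev_sf D eps n.+1)).
exact: lev_c.
Qed.

Lemma avg_lt_hom n f0 (F : R -> R) M : hom (lv 1) f0 ->
  (forall f, hom (lv n.+1) f -> (forall x, lv 1 x -> f x = f0 x) -> F (f (c n)) < M) ->
  avg n F (f0 (c 0)) < M.
Proof.
move=> h0; elim: n F => [|n IH] F HF; first exact: HF.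
apply: IH => f hf fE; have L x : lv 1 x -> lv n.+1 x by apply: lev_sub.
have [g [hg gK gc]] := lev_ext_c false hf; have [g' [hg' gK' gc']] := lev_ext_c true hf.
have := HF _ hg (fun x Kx => etrans (gK x (L x Kx)) (fE x Kx)).
have := HF _ hg' (fun x Kx => etrans (gK' x (L x Kx)) (fE x Kx)).
by rewrite gc gc' expr0 expr1 mul1r mulN1r; lra.
Qed.

Lemma hom_w f : hom (lv 1) f -> f w ^+ 2 = w ^+ 2.
Proof.
move=> hf; have s1 := lev_sf D eps 1; have Kw : lv 1 w := lev_w D eps 1.
by rewrite -(homX s1 hf 2 Kw) dw_sq (hom_nat s1 hf).
Qed.

Lemma hom_wabs f : hom (lv 1) f -> `|f w| = w.
Proof.
move=> hf; have /eqP := hom_w hf; rewrite eqf_sqr => /orP[]/eqP ->.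
  by rewrite gtr0_norm ?dw_gt0.
by rewrite normrN gtr0_norm ?dw_gt0.
Qed.

Lemma hom_c0 f : hom (lv 1) f -> f (c 0) ^+ 2 = c 0 ^+ 2.
Proof.
move=> hf; have s1 := lev_sf D eps 1; have Kc : lv 1 (c 0) := lev_c D eps 0.
rewrite -(homX s1 hf 2 Kc) c0_sq (hom_div s1 hf) ?(hom_nat s1 hf) //; exact: (sf_nat s1).
Qed.

Lemma tsum_hom n f a : hom (lv n.+1) f -> (forall m, lv 1 (a m)) ->
  f (tsum n a (c n)) = tsum n (f \o a) (f (c n)).
Proof.
move=> hf Ka; have sK := lev_sf D eps n.+1; have Kc := lev_c D eps n.
have KT m : lv n.+1 (Tb m (c n)) /\ f (Tb m (c n)) = Tb m (f (c n)).
  by case: m => [|m]; [split; [exact: (sf1 sK) | exact: (hom1 hf)] | exact: hom_T].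
have Kan m : lv n.+1 (a m) by apply: (lev_sub (ltn0Sn n)).
rewrite /tsum (hom_sum sK hf); last by move=> i; exact: (sfM sK (Kan _) (KT _).1).
by apply: eq_bigr => m _; rewrite (homM hf (Kan _) (KT _).1) (KT _).2.
Qed.

Lemma w2_ge2 : 2 <= w ^+ 2.
Proof.
rewrite dw_sq ler_nat dvdn_leq ?dh_even // -(@ltr_nat R) -dw_sq exprn_gt0 //.
exact: dw_gt0.
Qed.

Section Spread.
Context (n : nat) (x s : R) (a : nat -> R).
Hypotheses (Ka : forall m, lv 1 (a m)) (xE : x = tsum n a (c n)).
Hypothesis spread : forall f, hom (lv n.+1) f -> 0 < f x < s.
Notation N := (2 ^ n)%N.

Let N0 : (0 < N)%N. Proof. by rewrite expn_gt0. Qed.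

(** [(x - s / 2) ^+ 2] is below [(s / 2) ^+ 2] in every embedding, hence on average over those
    extending [f0]. The average is the left side plus the square of [f0 (a 0) - s / 2]. *)
Lemma variance_lt f0 : hom (lv 1) f0 ->
  \sum_(m < N | (0 < m)%N) (2 * f0 (a m) ^+ 2 + f0 (c 0) * f0 (a m) * f0 (a (N - m)%N))
   < (s / 2) ^+ 2.
Proof.
move=> h0; have y4 : f0 (c 0) ^+ 2 < 4 by rewrite hom_c0 ?c_sqr_lt4.
have fG f : hom (lv n.+1) f -> (forall x, lv 1 x -> f x = f0 x) ->
    f x = f0 (a 0%N) + tpart n (f0 \o a) (f (c n)).
  move=> hf fE; rewrite xE tsum_hom // /tsum (bigD1 (Ordinal N0)) //=.
  rewrite {1}/Tb mulr1 fE //; congr (_ + _); apply: eq_big => m.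
    by rewrite lt0n.
  move=> m0; rewrite /Tb ifF /= ?(fE _ (Ka m)) //; by apply: contraNF m0 => /eqP E; rewrite -val_eqE /= E.
have H : avg n (fun y => (f0 (a 0%N) - s / 2 + tpart n (f0 \o a) y) ^+ 2) (f0 (c 0)) < (s / 2) ^+ 2.
  apply: (avg_lt_hom h0) => f hf fE; have := spread hf; rewrite (fG _ hf fE).
  by move: (f0 _) (tpart _ _ _) => u v; nra.
have E : (fun y => (f0 (a 0%N) - s / 2 + tpart n (f0 \o a) y) ^+ 2) =
  (fun y => (f0 (a 0%N) - s / 2) ^+ 2 +
    (2 * (f0 (a 0%N) - s / 2) * tpart n (f0 \o a) y + tpart n (f0 \o a) y ^+ 2)).
  by apply/funext => y; ring.
move: H; rewrite E !avgD avg_cst avg_scale avg_tpart // mulr0 add0r avg_tpart_sqr //.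
by have := sqr_ge0 (f0 (a 0%N) - s / 2); rewrite /comp; lra.
Qed.

End Spread.

End Embeddings.

(** * Embeddings that push a Chebyshev term towards 2 or -2 *)

Section Tower2Adic.
Context {R : realType} (D : datum R) (eps : nat -> bool).
Notation w := (dw D).
Notation c := (ch D eps).
Notation lv := (lev D eps).
Implicit Types (x y a b : R) (f g : R -> R).

(* For [m = 2 ^ e * m'] with [m'] odd, [T m (c n)] lies in the field of level [n - e]. *)
Lemma T_level n m : (0 < m < 2 ^ n)%N -> exists L m',
  [/\ odd m', (0 < L <= n)%N, T m (c n) = T m' (c L) & m = (2 ^ (n - L) * m')%N].
Proof.
elim: n m => [|n IH] m; first by case: m => [|[]].
move=> /andP[m0 mN]; case: (boolP (odd m)) => om.
  by exists n.+1, m; rewrite subnn mul1n leqnn.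
have mE : m = (m./2).*2 by rewrite -[LHS](odd_double_half m) (negbTE om).
have [|L [m' [om' /andP[L0 Ln] TE m'E]]] := IH m./2.
  move: mN; rewrite {1}mE expnS mul2n ltn_double => ->.
  by rewrite andbT -double_gt0 -mE.
exists L, m'; split=> //; first by rewrite L0 ltnW.
  rewrite mE T_double cS_sqr (_ : 2 + c n - 2 = c n) //; by ring.
by rewrite mE m'E subSn // expnS -mul2n mulnA.
Qed.

Lemma hom_T_lev n f m : hom (lv n.+1) f ->
  lv n.+1 (T m (c n)) /\ f (T m (c n)) = T m (f (c n)).
Proof. by move=> hf; exact: hom_T (lev_sf D eps n.+1) hf (lev_c D eps n). Qed.

Lemma T_in_lev m n : lv n.+1 (T m (c n)).
Proof. exact: (hom_T_lev m (hom_id (lv n.+1))).1. Qed.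

(** [T m] is an odd function for odd [m], so the free sign of [c k.+1] is a free sign of
    [T m (c k.+1)]. *)
Lemma sign_ext k f m (b : bool) : hom (lv k.+1) f -> odd m -> exists g,
  [/\ hom (lv k.+2) g, forall x, lv k.+1 x -> g x = f x,
    0 <= (-1) ^+ b * g (T m (c k.+1)) & g (T m (c k.+1)) ^+ 2 = 2 + f (T m (c k))].
Proof.
move=> hf om; have fc4 := lev_hom_c hf; have [sE s4] := sqrt2D_lt4 fc4.
pose e := (T m (Num.sqrt (2 + f (c k))) < 0) (+) b.
have [g [hg gK gc]] := lev_ext_c e hf; exists g; split=> //; rewrite (hom_T_lev m hg).2 gc.
  rewrite (_ : T m _ = (-1) ^+ e * T m (Num.sqrt (2 + f (c k)))); last first.
    by case: (e); rewrite ?expr0 ?mul1r // expr1 !mulN1r T_opp -signr_odd om expr1 mulN1r.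
  rewrite mulrA -signr_addb /e addbC addbK.
  by case: ltP => s; rewrite ?expr1 ?expr0; lra.
rewrite T_sqr T_double (hom_T_lev m hf).2 addrC; congr (_ + T m _).
by rewrite exprMn -exprM mulnC exprM sqrrN !expr1n mul1r sE; ring.
Qed.

Lemma flip_ext L f : hom (lv L.+1) f -> exists g,
  [/\ hom (lv L.+1) g, forall x, lv L x -> g x = f x
    & forall m, odd m -> g (T m (c L)) = - f (T m (c L))].
Proof.
move=> hf; have sL := lev_sf D eps L; have sL1 := lev_sf D eps L.+1.
have hf' := hom_sub (@lev_sub _ D eps L L.+1 (leqnSn L)) hf.
have [|g [hg gK gc gE]] := hom_ext sL (lev_c2 D eps L) (@lev_nc _ D eps L)
  (s' := - f (c L)) hf'.
  by rewrite sqrrN -(homX sL1 hf 2 (lev_c D eps L)).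
exists g; split=> // m om; rewrite (hom_T_lev m hg).2 (hom_T_lev m hf).2 gc.
by rewrite T_opp -signr_odd om expr1 mulN1r.
Qed.

(** Choosing nonnegative signs iterates u -> sqrt(2 + u), which at least halves the distance 2 - u,
    initially at most 4. The last sign is spent on the sign wanted for the product. *)
Lemma term_ext l t m g (b : bool) L am : hom (lv l.+1) g -> odd m -> lv l.+1 am ->
  (0 < t)%N -> (l + t <= L)%N -> exists f,
  [/\ hom (lv L.+1) f, forall x, lv l.+1 x -> f x = g x
    & `|g am| * (2 - 4 / 2 ^+ t) <= (-1) ^+ b * f (am * T m (c L))].
Proof.
move=> hg om Kam t0 ltL.
have step i : exists f, [/\ hom (lv (l + i).+1) f, forall x, lv l.+1 x -> f x = g x
    & 2 - f (T m (c (l + i))) <= 4 / 2 ^+ i].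
  elim: i => [|i [f [hf fE fT]]].
    exists g; rewrite addn0; split=> //; rewrite expr0 divr1 (hom_T_lev m hg).2.
    by have := T_sqr_le4 m (lev_hom_c hg); nra.
  have [f' [hf' f'E f'0 f'2]] := sign_ext false hf om.
  exists f'; rewrite addnS; split=> //.
    by move=> x Kx; rewrite f'E ?fE //; apply: (lev_sub _ Kx); rewrite ltnS leq_addr.
  have : 0 < 4 / 2 ^+ i :> R by rewrite divr_gt0 ?exprn_gt0.
  rewrite exprS invfM mulrCA; move: f'0 f'2 fT; rewrite expr0 mul1r.
  move: (f' _) (f _) (4 / 2 ^+ i) => u v z u0 u2 vz z0.
  by case: (lerP u 2) => ?; nra.
have [i LE] : exists i, L = (l + i).+1 by exists (L - l).-1; lia.
rewrite {}LE in ltL *.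
have [f [hf fE fT]] := step i.
pose e := b (+) (g am < 0).
have [f' [hf' f'E f'0 f'2]] := sign_ext e hf om.
have f'E' x : lv l.+1 x -> f' x = g x.
  by move=> Kx; rewrite f'E ?fE //; apply: (lev_sub _ Kx); rewrite ltnS leq_addr.
exists f'; split=> //.
have Kam' : lv (l + i).+2 am by apply: (lev_sub _ Kam); rewrite ltnS; lia.
rewrite (homM hf' Kam' (T_in_lev _ _)) f'E' //.
have tL : 4 / 2 ^+ i.+1 <= 4 / 2 ^+ t :> R.
  by rewrite ler_pM2l // lef_pV2 ?posrE ?exprn_gt0 // ler_weXn2l ?ler1n //; lia.
have u2 : 2 - 4 / 2 ^+ t <= (-1) ^+ e * f' (T m (c (l + i).+1)).
  have : ((-1) ^+ e * f' (T m (c (l + i).+1))) ^+ 2 = 2 + f (T m (c (l + i))).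
    by rewrite exprMn -exprM mulnC exprM sqrrN !expr1n mul1r.
  have : 0 < 4 / 2 ^+ t :> R by rewrite divr_gt0 ?exprn_gt0.
  move: f'0 fT tL; rewrite exprS invfM mulrCA.
  move: ((-1) ^+ e * f' _) (f _) (4 / 2 ^+ i) (4 / 2 ^+ t) => u v z y u0 vz zy y0 u2.
  by case: (lerP u 2) => ?; nra.
have -> : (-1) ^+ b * (g am * f' (T m (c (l + i).+1))) =
    `|g am| * ((-1) ^+ e * f' (T m (c (l + i).+1))).
  rewrite normrEsign /e signr_addb -!mulrA; case: (_ < 0); case: (b);
  by rewrite ?expr0 ?expr1; ring.
by rewrite ler_wpM2l.
Qed.

End Tower2Adic.

(** * Elementary inequalities *)

Section NumericBounds.
Context {R : realType}.
Implicit Types w u z B x y : R.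

Lemma bound_coef w u : 0 < w -> 2 <= w ^+ 2 -> 0 <= u ->
  2 * (w * u * (15 / 8)) < 4 * w + 1 -> u ^+ 2 < 2.
Proof.
move=> w0 w2 u0 us; rewrite ltNge; apply/negP => u2.
have wu : 0 <= w * u by rewrite mulr_ge0 // ltW.
have : (15 / 4 * (w * u)) ^+ 2 < (4 * w + 1) ^+ 2 by clear u0 u2 w2; nra.
have : 2 * w ^+ 2 <= (w * u) ^+ 2 by rewrite exprMn mulrC ler_wpM2l // sqr_ge0.
by have := sqr_ge0 (w - 1); clear - w2; lra.
Qed.

Lemma sqr_bound w z : 0 <= z -> 0 < w -> 2 * z < 4 * w + 1 ->
  4 * z ^+ 2 < (4 * w + 1) ^+ 2.
Proof. by move=> ? ? ?; nra. Qed.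

(** [113 / 40] is just below 2 sqrt 2, so that [prod_lt2] still yields a product below 2. *)
Lemma bound_sum w z B : 0 < w -> 2 <= w ^+ 2 -> 4 * z ^+ 2 < (4 * w + 1) ^+ 2 ->
  2 * w ^+ 2 * B <= z ^+ 2 -> B < 113 / 40.
Proof.
move=> w0 w2 zw Bz; rewrite ltNge; apply/negP => HB.
have := sqr_ge0 (w - 7 / 5).
have : 8 * (w ^+ 2 * (113 / 40)) <= 8 * (w ^+ 2 * B) by rewrite ler_pM2l // ler_wpM2l // sqr_ge0.
by lra.
Qed.

Lemma prod_lt2 x y : 0 <= x -> 0 <= y -> x + y < 113 / 40 -> x * y < 2.
Proof. by move=> x0 y0 xy; have := sqr_ge0 (x - y); nra. Qed.

Lemma prod3_lt1 x y z : 0 <= x -> 0 <= y -> 0 <= z -> x + (y + z) < 3 -> x * y * z < 1.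
Proof.
move=> x0 y0 z0 S; rewrite ltNge; apply/negP => P.
have amgm : 27 * (x * y * z) <= (x + y + z) ^+ 3.
  have := mulr_ge0 x0 (sqr_ge0 (y - z)); have := mulr_ge0 y0 (sqr_ge0 (x - z)).
  have := mulr_ge0 z0 (sqr_ge0 (x - y)).
  have : 0 <= (x + y + z) * ((x - y) ^+ 2 + (y - z) ^+ 2 + (x - z) ^+ 2).
    by rewrite mulr_ge0 ?addr_ge0 ?sqr_ge0.
  lra.
have : (x + y + z) ^+ 3 < 3 ^+ 3 by rewrite ltr_pXn2r ?nnegrE ?addr_ge0 // -addrA.
by lra.
Qed.

Lemma sum_ge2 x y : 0 <= x -> 0 <= y -> x * y = 1 -> 2 <= x + y.
Proof. by move=> x0 y0 xy; have := sqr_ge0 (x - y); nra. Qed.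

Lemma sqr_le_bound w T z B : 0 < w -> 0 <= T <= 2 -> 0 <= z -> 2 <= B ->
  2 * w ^+ 2 * B <= z ^+ 2 -> w * T <= z.
Proof.
move=> w0 /andP[T0 T2] z0 B2 Bz; have wT : 0 <= w * T by rewrite mulr_ge0 // ltW.
suff E : (w * T) ^+ 2 <= z ^+ 2 by rewrite -(@ler_pXn2r _ 2).
apply: (le_trans _ Bz); rewrite exprMn (_ : 2 * w ^+ 2 * B = w ^+ 2 * (2 * B)); last by ring.
by rewrite ler_wpM2l ?sqr_ge0 //; nra.
Qed.

End NumericBounds.

Lemma big_ord_pos (R : realType) N (F : nat -> R) :
  \sum_(i < N | (0 < i)%N) F i = \sum_(1 <= i < N) F i.
Proof.
case: N => [|N]; first by rewrite big_ord0 big_geq.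
by rewrite big_mkcond big_ord_recl /= add0r big_add1 big_mkord.
Qed.

(** * Integers with conjugates in [(0, s)] lie at a bounded level *)

Section LowerBound.
Context {R : realType} (D : datum R) (eps : nat -> bool).
Context (s : R) (M : int) (t : nat).
Notation w := (dw D).
Notation h := (dh D).
Notation r := (dr D).
Notation j := (dj D).
Notation c := (ch D eps).
Notation lv := (lev D eps).
Implicit Types (x y a b : R) (f g : R -> R).

(** The size that [term_ext] guarantees after [t] free levels. The hypotheses on [M] place the
    interval from [w * tau2] to [s - w * tau2] strictly between consecutive integers. *)
Let tau2 : R := 2 - 4 / 2 ^+ t.
Hypotheses (s_lt : s < 4 * w + 1) (M_lo : (M - 1)%:~R < w * tau2)
  (M_hi : s - w * tau2 < M%:~R) (tau_ge : 15 / 8 <= tau2).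

Let w0 : 0 < w. Proof. exact: dw_gt0. Qed.
Let w2 := w2_ge2 D.
Let wn0 : w != 0. Proof. by rewrite gt_eqF. Qed.

Let sqr_normr (u : R) : `|u| ^+ 2 = u ^+ 2.
Proof. exact: real_normK (num_real u). Qed.

Let t_gt0 : (0 < t)%N.
Proof. by move: tau_ge; rewrite /tau2; case: (t) => //; rewrite expr0; lra. Qed.

(** [(a - (M - 1)) * (M - a)] would be a nonzero algebraic integer with all conjugates in (0,
    1/4]. *)
Lemma no_window n a : lv n a -> OO a ->
  (forall g, hom (lv n) g -> w * tau2 < g a < s - w * tau2) -> False.
Proof.
move=> Ka Oa win; have sK := lev_sf D eps n.
have {}win g : hom (lv n) g -> (M - 1)%:~R < g a < M%:~R.
  by move=> /win/andP[g1 g2]; rewrite (lt_trans M_lo g1) (lt_trans g2 M_hi).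
pose v := (a - (M - 1)%:~R) * (M%:~R - a).
have Km (m : int) : lv n m%:~R by exact: sf_int.
have K1 : lv n (a - (M - 1)%:~R) by exact: (sfB sK).
have K2 : lv n (M%:~R - a) by exact: (sfB sK).
suff v0 : v = 0.
  have /andP[a1 a2] := win _ (hom_id _); move/eqP: v0; rewrite mulf_eq0 !subr_eq0.
  by rewrite (gt_eqF a1) (gt_eqF a2).
apply: (tower_norm_lt1 (lev_tower D eps n)); first exact: (sfM sK).
  by apply: OOM; apply: OOB => //; exact: OO_int.
move=> g hg; have /andP[g1 g2] := win _ hg.
rewrite (homM hg K1 K2) (homB hg Ka (Km _)) (homB hg (Km _) Ka) !(hom_int sK hg).
have M1 : (M - 1)%:~R = M%:~R - 1 :> R by rewrite intrB.
move: g1 g2; rewrite M1; move: (g a) (M%:~R) => u m u1 u2.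
by rewrite ltr_norml; apply/andP; split; nra.
Qed.

Lemma sqr_eq1 b : lv 1 b -> OO b -> b != 0 ->
  (forall f, hom (lv 1) f -> f b ^+ 2 < 2) -> b ^+ 2 = 1.
Proof.
move=> Kb Ob bn0 small; have sK := lev_sf D eps 1.
have Kb2 := sfX sK 2 Kb; have K1 := sf1 sK.
apply/subr0_eq/(tower_norm_lt1 (lev_tower D eps 1)); first exact: (sfB sK).
  by apply: OOB; [exact: OOX | exact: OO1].
move=> f hf; rewrite (homB hf Kb2 K1) (hom1 hf) (homX sK hf 2 Kb).
have f0 : f b != 0 by apply: contra_neq bn0; exact: (hom_eq0 sK hf).
have := small _ hf; have : 0 < f b ^+ 2 by rewrite exprn_even_gt0.
by rewrite ltr_norml => ? ?; apply/andP; split; lra.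
Qed.

Let lv1_sub n x : lv 1 x -> lv n.+1 x. Proof. exact: lev_sub. Qed.

(** Room for both signs inside [(0, s)] bounds the conjugates of [b] enough to force [b ^+ 2 = 1];
    the room left for [a] is then the window of [no_window]. *)
Lemma no_spread l n x a b : (l <= n)%N -> lv l.+1 a -> OO a -> lv 1 b -> OO b -> b != 0 ->
  (forall f, hom (lv n.+1) f -> 0 < f x < s) ->
  (forall g, hom (lv l.+1) g -> forall e : bool, exists f,
    [/\ hom (lv n.+1) f, f a = g a & `|g (w * b)| * tau2 <= (-1) ^+ e * (f x - f a)]) ->
  False.
Proof.
move=> ln Ka Oa Kb Ob bn0 spread ext; have s1 := lev_sf D eps 1.
have Kw : lv 1 w := lev_w D eps 1.
have rng g : hom (lv l.+1) g -> w * `|g b| * tau2 < g a < s - w * `|g b| * tau2.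
  move=> hg; have hg1 := hom_sub (@lv1_sub l) hg.
  have gwb : `|g (w * b)| = w * `|g b| by rewrite (homM hg1 Kw Kb) normrM (hom_wabs hg1).
  have [f [hf fa ft]] := ext g hg false; have [f' [hf' fa' ft']] := ext g hg true.
  move: ft ft'; rewrite gwb expr0 expr1 fa fa'.
  have /andP[f0 fs] := spread _ hf; have /andP[f0' fs'] := spread _ hf'.
  by move: (w * _ * _) => z; move=> ? ?; apply/andP; split; lra.
have small g : hom (lv l.+1) g -> g b ^+ 2 < 2.
  move=> /rng/andP[g1 g2]; have {g1 g2} : 2 * (w * `|g b| * tau2) < s by lra.
  rewrite -[g b ^+ 2]sqr_normr; move: (`|g b|) (normr_ge0 (g b)) => u u0 us.
  have us' : 2 * (w * u * (15 / 8)) < 4 * w + 1.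
    by apply: le_lt_trans (lt_trans us s_lt); rewrite !ler_wpM2l // mulr_ge0 // ltW.
  exact: bound_coef us'.
have b2 : b ^+ 2 = 1.
  apply: sqr_eq1 => // f hf; have [g hg gE] := lev_ext_up (ltn0Sn l) hf.
  by rewrite -gE //; exact: small.
apply: (no_window Ka Oa) => g hg; have := rng _ hg.
suff -> : `|g b| = 1 by rewrite mulr1.
have hg1 := hom_sub (@lv1_sub l) hg; have := homX s1 hg1 2 Kb.
rewrite b2 (hom1 hg1) => /esym/eqP; rewrite sqrf_eq1 => /orP[]/eqP ->.
  exact: normr1.
by rewrite normrN normr1.
Qed.

(* One term far above the level of the rest. *)
Lemma no_one_term l n x a b L m : (l + t <= L <= n)%N -> odd m -> lv l.+1 a -> OO a ->
  lv 1 b -> OO b -> b != 0 -> x = a + w * b * T m (c L) ->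
  (forall f, hom (lv n.+1) f -> 0 < f x < s) -> False.
Proof.
move=> /andP[lL Ln] om Ka Oa Kb Ob bn0 xE spread.
have s1 := lev_sf D eps 1; have Kwb : lv 1 (w * b) := sfM s1 (lev_w D eps 1) Kb.
apply: (@no_spread l n x a b) => //; first by move: lL Ln; clear; lia.
move=> g hg e; have [f [hf fE ft]] := term_ext e hg om (lv1_sub _ Kwb) t_gt0 lL.
have Ln1 : (L.+1 <= n.+1)%N by [].
have [f' hf' fE'] := lev_ext_up Ln1 hf; have sL := lev_sf D eps n.+1.
have KT := T_in_lev D eps m L.
have KaL : lv L.+1 a by apply: (lev_sub _ Ka); move: lL; clear; lia.
have KL : lv L.+1 (w * b * T m (c L)).
  by apply: (sfM (lev_sf D eps L.+1)) => //; exact: lv1_sub.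
exists f'; split=> //; first by rewrite fE' // fE.
rewrite xE (homD sL hf') ?(fE' _ KaL) ?(fE' _ KL); first by rewrite addrC addKr.
  exact: (lev_sub Ln1).
exact: (lev_sub Ln1).
Qed.

(** The sign of the higher term is chosen last, to agree with the lower one, so it can only increase
    the spread. *)
Lemma no_two_terms n x a b b' L L' m m' : (t <= L)%N -> (L < L' <= n)%N -> odd m -> odd m' ->
  lv 1 a -> OO a -> lv 1 b -> OO b -> b != 0 -> lv 1 b' ->
  x = a + w * b * T m (c L) + w * b' * T m' (c L') ->
  (forall f, hom (lv n.+1) f -> 0 < f x < s) -> False.
Proof.
move=> tL /andP[LL Ln] om om' Ka Oa Kb Ob bn0 Kb' xE spread.
have s1 := lev_sf D eps 1; have Kw := lev_w D eps 1.
have Kwb : lv 1 (w * b) := sfM s1 Kw Kb.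
have Kwb' : lv 1 (w * b') := sfM s1 Kw Kb'.
apply: (@no_spread 0 n x a b) => // g hg e.
have [f [hf fE ft]] := term_ext e hg om Kwb t_gt0 tL.
have [k kE] : exists k, L' = k.+1 by exists L'.-1; move: LL; clear; lia.
rewrite {}kE in LL Ln xE *.
have Lk : (L.+1 <= k.+1)%N by [].
have [f1 hf1 f1E] := lev_ext_up Lk hf.
pose e' := e (+) (g (w * b') < 0).
have [f2 [hf2 f2E f20 _]] := sign_ext e' hf1 om'.
have kn : (k.+2 <= n.+1)%N by [].
have [f3 hf3 f3E] := lev_ext_up kn hf2; have sL := lev_sf D eps n.+1.
have f3g y : lv 1 y -> f3 y = g y.
  move=> Ky; rewrite f3E ?f2E ?f1E ?fE //; exact: lv1_sub.
have K1 : lv L.+1 (w * b * T m (c L)).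
  by apply: (sfM (lev_sf D eps L.+1)); [exact: lv1_sub | exact: T_in_lev].
have K1' : lv k.+1 (w * b * T m (c L)) := lev_sub Lk K1.
have K2 : lv k.+2 (T m' (c k.+1)) := T_in_lev D eps m' k.+1.
have Ka' : lv n.+1 a := lv1_sub _ Ka.
have Kn1 : lv n.+1 (w * b * T m (c L)) by apply: (lev_sub _ K1); move: LL Ln; clear; lia.
have Kn2 : lv n.+1 (T m' (c k.+1)) := lev_sub kn K2.
exists f3; split=> //; first exact: f3g.
rewrite xE (homD sL hf3) ?(homD sL hf3) //; last 2 first.
- exact: sfD.
- by apply: (sfM sL) => //; exact: lv1_sub.
rewrite (homM hf3 (lv1_sub _ Kwb') Kn2) (f3g _ Kwb') (f3E _ K2).
rewrite (f3E _ (lev_sub (leqnSn _) K1')) (f2E _ K1') (f1E _ K1).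
have : 0 <= (-1) ^+ e * (g (w * b') * f2 (T m' (c k.+1))).
  rewrite [X in 0 <= X](_ : _ = `|g (w * b')| * ((-1) ^+ e' * f2 (T m' (c k.+1)))).
    by rewrite mulr_ge0.
  rewrite normrEsign /e' signr_addb -!mulrA; case: (_ < 0); case: (e);
  by rewrite ?expr0 ?expr1; ring.
move: ft; rewrite -/tau2; move: (f _) (g _ * f2 _) (f3 a) (`|_| * tau2) => u v z y.
by case: (e); rewrite ?expr0 ?expr1; lra.
Qed.

(* Two terms on the same level change sign together when the last square root does. *)
Lemma no_two_terms_same n x a b b' L m m' k k' : (0 < L <= n)%N -> odd m -> odd m' ->
  k != k' -> (0 < k)%N -> (0 < k')%N -> (k.*2 < 2 ^ n)%N -> (k'.*2 < 2 ^ n)%N ->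
  T k (c n) = T m (c L) -> T k' (c n) = T m' (c L) ->
  lv 1 a -> OO a -> lv 1 b -> OO b -> b != 0 -> lv 1 b' -> OO b' -> b' != 0 ->
  x = a + w * b * T k (c n) + w * b' * T k' (c n) ->
  (forall f, hom (lv n.+1) f -> 0 < f x < s) -> False.
Proof.
move=> /andP[L0 Ln] om om' kk' k0 k'0 kN k'N Tk Tk' Ka Oa Kb Ob bn0 Kb' Ob' bn0' xE spread.
have s1 := lev_sf D eps 1; have Kw := lev_w D eps 1; have sn := lev_sf D eps n.+1.
have Kwb : lv 1 (w * b) := sfM s1 Kw Kb; have Kwb' : lv 1 (w * b') := sfM s1 Kw Kb'.
have KT := T_in_lev D eps k n; have KT' := T_in_lev D eps k' n.
pose y := w * b * T k (c n) + w * b' * T k' (c n).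
have Ky1 : lv n.+1 (w * b * T k (c n)) by apply: (sfM sn) => //; exact: lv1_sub.
have Ky2 : lv n.+1 (w * b' * T k' (c n)) by apply: (sfM sn) => //; exact: lv1_sub.
have Ky : lv n.+1 y by apply: sfD.
have fy f : hom (lv n.+1) f ->
    f y = f (w * b) * T k (f (c n)) + f (w * b') * T k' (f (c n)).
  move=> hf; rewrite (homD sn hf) // (homM hf (lv1_sub _ Kwb) KT).
  by rewrite (homM hf (lv1_sub _ Kwb') KT') !(hom_T_lev _ hf).2.
have fx f : hom (lv n.+1) f -> f x = f a + f y.
  move=> hf; have -> : x = a + y by rewrite xE /y addrA.
  by rewrite (homD sn hf) //; exact: lv1_sub.
have g2 g : hom (lv 1) g ->
    g (w * b) ^+ 2 + g (w * b') ^+ 2 = w ^+ 2 * (g b ^+ 2 + g b' ^+ 2).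
  move=> hg; rewrite (homM hg Kw Kb) (homM hg Kw Kb') !exprMn (hom_w hg); ring.
(* The bound is the mean of [f y ^+ 2] over the extensions of [g]; there is no cross term as [k] and
   [k'] are below half of [2 ^ n]. *)
have big g : hom (lv 1) g -> exists f, [/\ hom (lv n.+1) f, forall z, lv 1 z -> f z = g z
    & 2 * w ^+ 2 * (g b ^+ 2 + g b' ^+ 2) <= f y ^+ 2].
  move=> hg; apply: contrapT => nex.
  pose al i : R := if i == k then g (w * b) else if i == k' then g (w * b') else 0.
  have : avg n (fun z => tpart n al z ^+ 2) (g (c 0)) < 2 * w ^+ 2 * (g b ^+ 2 + g b' ^+ 2).
    apply: (avg_lt_hom hg) => f hf fE; rewrite ltNge; apply/negP => le.
    apply: nex; exists f; split=> //; rewrite fy // (fE _ Kwb) (fE _ Kwb').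
    move: le; rewrite /tpart.
    have kN' : (k < 2 ^ n)%N by apply: leq_ltn_trans kN; rewrite -addnn leq_addr.
    have k'N' : (k' < 2 ^ n)%N by apply: leq_ltn_trans k'N; rewrite -addnn leq_addr.
    rewrite (bigD1 (Ordinal kN')) //= (bigD1 (Ordinal k'N')) /=; last first.
      by rewrite k'0 -val_eqE /= eq_sym.
    rewrite big1 ?addr0 /al ?eqxx => [|i /andP[/andP[_]]]; last first.
      by rewrite -!val_eqE /= => /negbTE -> /negbTE ->; rewrite mul0r.
    by rewrite eq_sym (negbTE kk').
  have y4 : g (c 0) ^+ 2 < 4 by rewrite hom_c0 ?c_sqr_lt4.
  rewrite avg_tpart_sqr // -mulrA -g2 //.
  have kN' : (k < 2 ^ n)%N by apply: leq_ltn_trans kN; rewrite -addnn leq_addr.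
  have k'N' : (k' < 2 ^ n)%N by apply: leq_ltn_trans k'N; rewrite -addnn leq_addr.
  have al0 i : (2 ^ n <= i.*2)%N -> al i = 0.
    rewrite /al; have [->|_] := eqVneq i k; first by rewrite leqNgt kN.
    by have [->|//] := eqVneq i k'; rewrite leqNgt k'N.
  rewrite (bigD1 (Ordinal kN')) //= (bigD1 (Ordinal k'N')) /=; last first.
    by rewrite k'0 -val_eqE /= eq_sym.
  rewrite big1 ?addr0 => [|i /andP[/andP[_]]]; last first.
    rewrite -!val_eqE /= {1 2}/al => /negbTE -> /negbTE ->.
    by rewrite expr0n mulr0 mulr0 mul0r addr0.
  rewrite !(al0 (2 ^ n - _)%N) ?mulr0 ?addr0; [|by move: k'N; clear; lia|by move: kN; clear; lia].
  by rewrite /al eqxx eq_sym (negbTE kk') eqxx; lra.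
have rng g : hom (lv 1) g -> exists2 z, 0 <= z &
    2 * w ^+ 2 * (g b ^+ 2 + g b' ^+ 2) <= z ^+ 2 /\ z < g a < s - z.
  move=> hg; have [f [hf fE f2]] := big _ hg.
  have L1n : (L.+1 <= n.+1)%N by [].
  have [f1 [hf1 f1E f1T]] := flip_ext (hom_sub (lev_sub L1n) hf).
  have [f2' hf2 f2E] := lev_ext_up L1n hf1.
  have f2g z : lv 1 z -> f2' z = g z.
    move=> Kz; rewrite f2E ?f1E ?fE //; [exact: (lev_sub L0) | exact: lv1_sub].
  have f2y : f2' y = - f y.
    have yE g' : hom (lv n.+1) g' -> (forall z, lv 1 z -> g' z = g z) ->
        g' y = g (w * b) * g' (T m (c L)) + g (w * b') * g' (T m' (c L)).
      move=> hg' g'E; rewrite /y (homD sn hg' Ky1 Ky2) (homM hg' (lv1_sub _ Kwb) KT).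
      by rewrite (homM hg' (lv1_sub _ Kwb') KT') (g'E _ Kwb) (g'E _ Kwb') Tk Tk'.
    rewrite (yE _ hf2 f2g) (yE _ hf fE) (f2E _ (T_in_lev _ _ m L)) (f2E _ (T_in_lev _ _ m' L)).
    by rewrite !f1T //; ring.
  exists `|f y|; first exact: normr_ge0.
  rewrite sqr_normr; split=> //.
  have := spread _ hf; have := spread _ hf2; rewrite !fx // f2y (f2g _ Ka) (fE _ Ka).
  by case: (ger0P (f y)) => _ /andP[? ?] /andP[? ?]; apply/andP; split; lra.
have small g : hom (lv 1) g -> g b ^+ 2 + g b' ^+ 2 < 113 / 40.
  move=> /rng[z z0 [z2 /andP[z3 z4]]].
  have zs : 2 * z < 4 * w + 1.
    by apply: lt_trans s_lt; rewrite mulr_natl mulr2n -ltrBrDr; exact: lt_trans z3 z4.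
  exact: bound_sum w0 w2 (sqr_bound z0 w0 zs) z2.
have s2 g : hom (lv 1) g -> 2 <= g b ^+ 2 + g b' ^+ 2.
  have : (b * b') ^+ 2 = 1.
    apply: sqr_eq1; [exact: (sfM s1) | exact: OOM | by rewrite mulf_neq0 |].
    move=> f hf; rewrite (homM hf Kb Kb') exprMn.
    by apply: prod_lt2; [exact: sqr_ge0 | exact: sqr_ge0 | exact: small].
  move=> bb hg; have := congr1 g bb; rewrite (homX s1 hg 2 (sfM s1 Kb Kb')) (hom1 hg).
  by rewrite (homM hg Kb Kb') exprMn => E; apply: sum_ge2 => //; exact: sqr_ge0.
apply: (no_window Ka Oa) => g hg; have [z z0 [z2 /andP[z3 z4]]] := rng _ hg.
have wz : w * tau2 <= z.
  apply: (sqr_le_bound w0 _ z0 (s2 _ hg) z2); apply/andP; split; first by move: tau_ge; lra.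
  by rewrite /tau2 lerBlDr lerDl divr_ge0 // exprn_ge0.
by apply/andP; split; [exact: le_lt_trans z3 | apply: lt_le_trans z4 _; rewrite lerB].
Qed.

Section Coordinates.
Context (n : nat) (x : R) (a : nat -> R).
Notation N := (2 ^ n)%N.
Hypotheses (Ox : OO x) (xE : x = tsum n a (c n)) (Ka : forall m, lv 1 (a m))
  (Ba : forall m, BB w (a m)) (aN : forall m, (N <= m)%N -> a m = 0).
Hypothesis spread : forall f, hom (lv n.+1) f -> 0 < f x < s.

Let s1 := lev_sf D eps 1.
Let N0 : (0 < N)%N. Proof. by rewrite expn_gt0. Qed.

Let s_gt0 : 0 < s.
Proof. by have /andP[x0 xs] := spread (hom_id _); exact: lt_trans xs. Qed.

Let s2_lt : (s / 2) ^+ 2 < 6 * w ^+ 2.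
Proof.
have := @sqr_bound _ w (s / 2) _ w0 _ => /(_ _ _)/[dup].
move=> /(_ (ltW (divr_gt0 s_gt0 _))) H _; have {H} : 4 * (s / 2) ^+ 2 < (4 * w + 1) ^+ 2.
  by apply: H => //; move: s_lt; lra.
by have := sqr_ge0 (w - 1); move: w2; lra.
Qed.

(** Pairing [i] with [N - i] splits the variance into positive definite binary forms, so f(a_m)^2 (4
    - c_0^2) < 4 (s/2)^2 < 24 w^2. Here a_m = b w^k with 2k = j + 1, and 4 - c_0^2 = r / w^(2j), so
    [d_big] puts all conjugates of the integer b below 1. *)
Lemma high_coord_eq0 m : (m < N)%N -> (N <= m.*2)%N -> a m = 0.
Proof.
move=> mN Nm; have k_le := wexp_half D Nm.
have Ob := coords_div Ox xE Ka Ba mN k_le.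
set k := j.+1./2 in Ob; have kE : (2 * k = j.+1)%N.
  by rewrite mul2n -[RHS]odd_double_half /= dj_odd.
have Kw := lev_w D eps 1; have Kwk := sfX s1 k Kw.
have Kb : lv 1 (a m / w ^+ k) by exact: (sf_div s1).
suff : a m / w ^+ k = 0.
  by move/eqP; rewrite mulf_eq0 invr_eq0 expf_eq0 (negbTE wn0) andbF orbF => /eqP.
apply: (tower_norm_lt1 (lev_tower D eps 1)) => // f hf.
have m0 : (0 < m)%N by rewrite -double_gt0 (leq_trans N0).
have V := variance_lt Ka xE spread hf.
set b := f (a m / w ^+ k).
have amE : f (a m) ^+ 2 = b ^+ 2 * w ^+ j.+1.
  have -> : a m = (a m / w ^+ k) * w ^+ k by rewrite divfK // expf_neq0.
  rewrite (homM hf Kb Kwk) exprMn -/b (homX s1 hf k Kw) -exprM mulnC exprM (hom_w hf).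
  by rewrite -exprM kE.
have c0E : 4 - f (c 0) ^+ 2 = r%:R / w ^+ (2 * j) by rewrite (hom_c0 hf) c0_norm w2jE.
have W : f (a m) ^+ 2 * (4 - f (c 0) ^+ 2) < 4 * (s / 2) ^+ 2.
  apply: le_lt_trans (_ : _ <= 4 * _) _; last by rewrite ltr_pM2l //; exact: V.
  pose F (i : nat) := f (a i) ^+ 2.
  have S : \sum_(i < N | (0 < i)%N) F i = \sum_(i < N | (0 < i)%N) F (N - i)%N.
    rewrite (big_ord_pos N F) (big_ord_pos N (fun i => F (N - i)%N)) big_nat_rev /=.
    by apply: eq_bigr => i _; rewrite add1n subSS.
  have -> : \sum_(i < N | (0 < i)%N)
      (2 * f (a i) ^+ 2 + f (c 0) * f (a i) * f (a (N - i)%N)) =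
    \sum_(i < N | (0 < i)%N) (F i + F (N - i)%N + f (c 0) * f (a i) * f (a (N - i)%N)).
    by rewrite !big_split /= -S -mulr_sumr -/F; congr (_ + _); rewrite mulr_natl mulr2n.
  have y4 : f (c 0) ^+ 2 < 4 by rewrite hom_c0 ?c_sqr_lt4.
  rewrite (bigD1 (Ordinal mN)) //= [X in _ <= X]mulrDr; apply: ler_wpDr; last first.
    have := sqr_ge0 (2 * f (a (N - m)%N) + f (c 0) * f (a m)).
    by rewrite /F; lra.
  rewrite mulr_ge0 // sumr_ge0 // => i _.
  have := sqr_ge0 (2 * f (a (N - i)%N) + f (c 0) * f (a i)).
  have : 0 <= f (a i) ^+ 2 * (4 - f (c 0) ^+ 2) by rewrite mulr_ge0 ?sqr_ge0 //; lra.
  by rewrite /F; lra.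
have rw : 24 * w ^+ j.+1 <= r%:R by exact: d_big.
have wj : w ^+ (2 * j) * w ^+ 2 = w ^+ j.+1 * w ^+ j.+1 by rewrite -!exprD; congr (_ ^+ _); clear; lia.
have b2 : b ^+ 2 < 1.
  move: W; rewrite amE c0E mulrA ltr_pdivrMr ?exprn_gt0 // => W.
  have p1 : 0 < w ^+ j.+1 by rewrite exprn_gt0.
  have : b ^+ 2 * (w ^+ j.+1 * (24 * w ^+ j.+1)) < 24 * (w ^+ (2 * j) * w ^+ 2).
    apply: le_lt_trans (_ : _ <= b ^+ 2 * w ^+ j.+1 * r%:R) _.
      by rewrite mulrA ler_wpM2l // mulr_ge0 ?sqr_ge0 // ltW.
    apply: lt_trans W _; rewrite mulrCA [X in _ < X]mulrCA mulrA mulrC.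
    by rewrite ltr_pM2l ?exprn_gt0 //; move: s2_lt; lra.
  rewrite wj; have -> : b ^+ 2 * (w ^+ j.+1 * (24 * w ^+ j.+1)) =
    b ^+ 2 * (24 * (w ^+ j.+1 * w ^+ j.+1)) by ring.
  by rewrite -[X in _ < X]mul1r ltr_pM2r // mulr_gt0 // mulr_gt0.
by rewrite -(@ltr_pXn2r _ 2) ?nnegrE ?normr_ge0 // sqr_normr expr1n.
Qed.

(** One of [i], [N - i] is in the vanishing half, so the cross terms drop out and [6 * w ^+ 2]
    bounds [2 * w ^+ 2] times the full sum. *)
Lemma sum_coords_lt f (ms : seq nat) : hom (lv 1) f -> uniq ms ->
  (forall m, m \in ms -> (0 < m < N)%N) ->
  \sum_(m <- ms) f (a m / w) ^+ 2 < 3.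
Proof.
move=> hf ums msN; have V := variance_lt Ka xE spread hf.
have Kw := lev_w D eps 1.
have E : \sum_(i < N | (0 < i)%N)
      (2 * f (a i) ^+ 2 + f (c 0) * f (a i) * f (a (N - i)%N)) =
   \sum_(1 <= i < N) 2 * w ^+ 2 * f (a i / w) ^+ 2.
  rewrite (big_ord_pos N (fun i => 2 * f (a i) ^+ 2 + f (c 0) * f (a i) * f (a (N - i)%N))).
  apply: eq_big_nat => i /andP[i0 iN].
  have -> : f (c 0) * f (a i) * f (a (N - i)%N) = 0.
    have [/(high_coord_eq0 iN) ->|iN2] := leqP N i.*2.
      by rewrite (hom0 s1 hf) mulr0 mul0r.
    by rewrite (@high_coord_eq0 (N - i)%N) ?(hom0 s1 hf) ?mulr0 //; move: i0 iN iN2; clear; lia.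
  have aE : a i = w * (a i / w) by rewrite mulrC divfK.
  by rewrite addr0 {1}aE (homM hf Kw (sf_div s1 (Ka i) Kw)) exprMn (hom_w hf) mulrA.
move: V; rewrite {}E -mulr_sumr => V.
have le : \sum_(m <- ms) f (a m / w) ^+ 2 <= \sum_(1 <= i < N) f (a i / w) ^+ 2.
  rewrite [X in _ <= X](perm_big (ms ++ [seq i <- index_iota 1 N | i \notin ms])).
    by rewrite big_cat /= lerDl sumr_ge0 // => i _; exact: sqr_ge0.
  apply: uniq_perm; first exact: iota_uniq.
    rewrite cat_uniq ums filter_uniq ?iota_uniq // andbT /=.
    by apply/hasPn => i; rewrite mem_filter => /andP[].
  move=> i; rewrite mem_cat mem_filter mem_index_iota.
  by case: (boolP (i \in ms)) => //= /msN.
apply: le_lt_trans le _; rewrite -(@ltr_pM2l _ (2 * w ^+ 2)); last by rewrite mulr_gt0 // exprn_gt0.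
by apply: lt_trans V _; move: s2_lt; lra.
Qed.

(** By the inequality of means, the product of the three integers [a m / w] has all conjugates below
    1. *)
Lemma at_most_two m1 m2 m3 : uniq [:: m1; m2; m3] ->
  (forall m, m \in [:: m1; m2; m3] -> (0 < m < N)%N) ->
  a m1 = 0 \/ a m2 = 0 \/ a m3 = 0.
Proof.
move=> um mN; have Kw := lev_w D eps 1.
have Kb m : lv 1 (a m / w) by exact: (sf_div s1).
have Ob m : (0 < m < N)%N -> OO (a m / w).
  move=> /andP[m0 mN']; rewrite -[w]expr1.
  by apply: (coords_div Ox xE Ka Ba mN'); exact: wexp_ge1.
pose p := a m1 / w * (a m2 / w) * (a m3 / w).
suff : p = 0.
  move/eqP; rewrite /p !mulf_eq0 invr_eq0 (negbTE wn0) !orbF => /orP[/orP[]|] /eqP; auto.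
have mN1 := mN m1 (mem_head _ _).
have mN2 : (0 < m2 < N)%N by apply: mN; rewrite !inE eqxx orbT.
have mN3 : (0 < m3 < N)%N by apply: mN; rewrite !inE eqxx !orbT.
have K12 := sfM s1 (Kb m1) (Kb m2).
apply: (tower_norm_lt1 (lev_tower D eps 1)); first exact: (sfM s1).
  by apply: OOM; [apply: OOM; exact: Ob | exact: Ob].
move=> f hf; have := sum_coords_lt hf um mN.
rewrite !big_cons big_nil addr0 /p (homM hf K12 (Kb m3)) (homM hf (Kb m1) (Kb m2)).
move: (f _) (f _) (f _) => x1 x2 x3 S.
rewrite -(@ltr_pXn2r _ 2) ?nnegrE ?normr_ge0 // sqr_normr expr1n !exprMn.
exact: prod3_lt1 (sqr_ge0 _) (sqr_ge0 _) (sqr_ge0 _) S.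
Qed.

Let term m : (0 < m < N)%N -> a m != 0 -> exists b L m',
  [/\ odd m', (0 < L <= n)%N, T m (c n) = T m' (c L) & [/\ lv 1 b, OO b, b != 0,
      a m = w * b & (m.*2 < N)%N]].
Proof.
move=> m0N am0; have [L [m' [om' LN TE _]]] := T_level D eps m0N; have /andP[m0 mN] := m0N.
exists (a m / w), L, m'; split=> //; split.
- exact: (sf_div s1 (Ka m) (lev_w D eps 1)).
- by rewrite -[w]expr1; apply: (coords_div Ox xE Ka Ba mN); exact: wexp_ge1.
- by rewrite mulf_neq0 // invr_eq0.
- by rewrite mulrC divfK.
- by rewrite ltnNge; apply: contra am0 => /(high_coord_eq0 mN) ->.
Qed.

Let x_expand : exists ms : seq nat, [/\ uniq ms, forall m, m \in ms -> (0 < m < N)%N && (a m != 0)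
  & x = a 0%N + \sum_(m <- ms) a m * T m (c n)].
Proof.
exists [seq m <- index_iota 1 N | a m != 0]; split.
- by rewrite filter_uniq // iota_uniq.
- by move=> m; rewrite mem_filter mem_index_iota andbC.
rewrite xE /tsum big_filter [in RHS]big_mkcond /= -(big_mkord xpredT (fun m => a m * Tb m (c n))).
rewrite big_ltn // /Tb eqxx mulr1; congr (_ + _); apply: eq_big_nat => m /andP[m0 _].
by rewrite gtn_eqF //; case: eqP => //= ->; rewrite mul0r.
Qed.

(** A term above level 2t has [t] free levels over anything of level at most [t]. So of two terms on
    different levels, the lower one either has [t] free levels itself or joins the base of
    [no_one_term]. *)
Lemma small_coords_level : lv (t.*2).+1 x.
Proof.
have Oa0 : OO (a 0%N).
  by have := coords_int Ox xE Ka Ba N0; rewrite wexp0 expr0 divr1.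
have sT := lev_sf D eps (t.*2).+1.
have up y : lv 1 y -> lv (t.*2).+1 y by apply: lev_sub.
have [ms [ums msP xE']] := x_expand.
have lowT L m b : lv 1 b -> (L <= t.*2)%N -> lv (t.*2).+1 (w * b * T m (c L)).
  move=> Kb Lt; apply: (sfM sT); first by apply: up; exact: (sfM s1 (lev_w D eps 1)).
  by apply: (lev_sub _ (T_in_lev D eps m L)).
case: ms ums msP xE' => [|m [|k [|l ms]]] ums msP xE'.
- by rewrite xE' big_nil addr0; exact: up.
- have /andP[mN am] := msP m (mem_head _ _).
  have [b [L [m' [om' /andP[L0 Ln] TE [Kb Ob bn0 amE _]]]]] := term mN am.
  move: xE'; rewrite big_seq1 amE TE => xE'.
  have [Lt|tL] := leqP L t.*2; first by rewrite xE'; apply: (sfD sT (up _ (Ka _))); exact: lowT.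
  case: (@no_one_term 0 n x (a 0%N) b L m') => //.
  by rewrite Ln andbT add0n; move: tL; clear; lia.
- have /andP[mN am] := msP m (mem_head _ _).
  have /andP[kN ak] : (0 < k < N)%N && (a k != 0) by apply: msP; rewrite !inE eqxx orbT.
  have [b [L [m' [om' /andP[L0 Ln] TE [Kb Ob bn0 amE mN2]]]]] := term mN am.
  have [b' [L' [k' [ok' /andP[L0' Ln'] TE' [Kb' Ob' bn0' akE kN2]]]]] := term kN ak.
  have mk : m != k by move: ums; rewrite /= inE andbT.
  have {}xE' : x = a 0%N + w * b * T m (c n) + w * b' * T k (c n).
    by rewrite xE' big_cons big_seq1 amE akE addrA.
  have OaT m1 b1 L1 : (0 < m1 < N)%N -> a m1 = w * b1 -> OO (w * b1 * T m1 (c n)).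
    move=> /andP[m10 m1N] <-; have := coords_term Ox xE Ka Ba m1N.
    by rewrite /Tb gtn_eqF.
  have wb y : lv 1 y -> lv 1 (w * y) by exact: (sfM s1 (lev_w D eps 1)).
  have [LL|LL|LL] := ltngtP L L'.
  + have [Lt|tL] := leqP L' t.*2.
      rewrite xE' TE TE'; apply: (sfD sT); last exact: lowT.
      apply: (sfD sT (up _ (Ka _))); apply: lowT => //; exact: leq_trans (ltnW LL) Lt.
    have [Lt|tL'] := leqP t L.
      exfalso; apply: (@no_two_terms n x (a 0%N) b b' L L' m' k') => //; first by rewrite LL.
      by rewrite xE' TE TE'.
    exfalso; apply: (@no_one_term t n x (a 0%N + w * b * T m (c n)) b' L' k') => //.
    * by rewrite Ln' andbT addnn ltnW.
    * rewrite TE; apply: (sfD (lev_sf D eps t.+1)); first by apply: (lev_sub _ (Ka 0%N)).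
      apply: (sfM (lev_sf D eps t.+1)); first by apply: (lev_sub _ (wb _ Kb)).
      by apply: (lev_sub _ (T_in_lev D eps m' L)); rewrite ltnS ltnW.
    * by apply: OOD => //; exact: OaT.
    * by rewrite xE' TE'.
  + have {}xE' : x = a 0%N + w * b' * T k (c n) + w * b * T m (c n) by rewrite xE'; ring.
    have [Lt|tL] := leqP L t.*2.
      rewrite xE' TE TE'; apply: (sfD sT); last exact: lowT.
      apply: (sfD sT (up _ (Ka _))); apply: lowT => //; exact: leq_trans (ltnW LL) Lt.
    have [Lt|tL'] := leqP t L'.
      exfalso; apply: (@no_two_terms n x (a 0%N) b' b L' L k' m') => //; first by rewrite LL.
      by rewrite xE' TE TE'.
    exfalso; apply: (@no_one_term t n x (a 0%N + w * b' * T k (c n)) b L m') => //.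
    * by rewrite Ln andbT addnn ltnW.
    * rewrite TE'; apply: (sfD (lev_sf D eps t.+1)); first by apply: (lev_sub _ (Ka 0%N)).
      apply: (sfM (lev_sf D eps t.+1)); first by apply: (lev_sub _ (wb _ Kb')).
      by apply: (lev_sub _ (T_in_lev D eps k' L')); rewrite ltnS ltnW.
    * by apply: OOD => //; exact: OaT.
    * by rewrite xE' TE.
  + subst L'; exfalso.
    have /andP[m0 _] := mN; have /andP[k0 _] := kN.
    by apply: (@no_two_terms_same n x (a 0%N) b b' L m' k' m k) => //; rewrite L0.
- exfalso; have u3 : uniq [:: m; k; l].
    by move: ums; rewrite -[_ :: _]/([:: m; k; l] ++ ms) cat_uniq => /and3P[].
  have P3 i : i \in [:: m; k; l] -> (0 < i < N)%N && (a i != 0).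
    by move=> i3; apply: msP; move: i3; rewrite !inE => /or3P[]/eqP->; rewrite eqxx ?orbT.
  have := at_most_two u3 (fun i i3 => proj1 (andP (P3 i i3))).
  case=> [|[|]]; apply/eqP.
  + by case/andP: (P3 m (mem_head _ _)).
  + by have /P3/andP[] : k \in [:: m; k; l] by rewrite !inE eqxx orbT.
  + by have /P3/andP[] : l \in [:: m; k; l] by rewrite !inE eqxx !orbT.
Qed.

End Coordinates.

Lemma small_in_level n x : lv n.+1 x -> OO x ->
  (forall f, hom (lv n.+1) f -> 0 < f x < s) -> lv (t.*2).+1 x.
Proof.
move=> Kx Ox spread; have [a [Ka Ba _ xE]] := lev_coords Kx (BB_OO w Ox).
exact: (small_coords_level Ox xE Ka Ba spread).
Qed.

End LowerBound.

Lemma infinite_inj (T : Type) (A : set T) (f : nat -> T) :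
  (forall n, A (f n)) -> injective f -> infinite_set A.
Proof.
move=> Af fI Afin; apply: infinite_nat.
have fin : finite_set (f @` [set: nat]) by apply: sub_finite_set Afin => _ [n _ <-].
rewrite -(eq_finite_set (inj_card_eq _ : f @` [set: nat] #= [set: nat])%card) //.
by move=> x y _ _; exact: fI.
Qed.

(** * The fields [K] and their Julia Robinson numbers *)

Section Fields.
Context {R : realType} (D : datum R).
Notation w := (dw D).
Notation j := (dj D).
Notation c := (ch D).
Notation lv := (lev D).
Implicit Types (x y : R) (eps : nat -> bool).

Definition towerK eps : set R[i] := [set z | exists n x, lv eps n x /\ z = x%:C].

Let w0 : 0 < w. Proof. exact: dw_gt0. Qed.

Lemma towerK_real eps x : towerK eps x%:C -> exists n, lv eps n x.
Proof. by case=> n [y [Ky [->]]]; exists n. Qed.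

Lemma towerK_subfield eps : is_subfield (towerK eps).
Proof.
split=> [|x y|x y]; rewrite ?in_setE.
- by exists 0%N, 1; split=> //; exact: (sf1 (lev_sf D eps 0)).
- move=> [n [u [Ku ->]]] [m [v [Kv ->]]]; exists (n + m)%N, (u - v).
  split; last by rewrite rmorphB.
  by apply: (sfB (lev_sf D eps _)); [apply: (lev_sub _ Ku) | apply: (lev_sub _ Kv)];
    rewrite ?leq_addr ?leq_addl.
- move=> [n [u [Ku ->]]] [m [v [Kv ->]]]; exists (n + m)%N, (u / v).
  split; last by rewrite rmorphM fmorphV.
  by apply: (sf_div (lev_sf D eps _)); [apply: (lev_sub _ Ku) | apply: (lev_sub _ Kv)];
    rewrite ?leq_addr ?leq_addl.
Qed.

Lemma towerK_Qtr eps : towerK eps `<=` @Qtr R.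
Proof.
move=> _ [n [x [Kx ->]]]; have tK := lev_tower D eps n; split.
  have [p p0 px] := tower_algebraic tK Kx; exists p => //.
  by rewrite rootE ratr_poly_real_complex (eqP px) rmorph0.
by move=> b /(conjugates_hom tK Kx)[f _ ->]; exists (f x).
Qed.

Lemma OO_complex x : integralOver (intr : int -> R[i]) x%:C <-> OO x.
Proof.
have E (p : {poly int}) : root (map_poly intr p) x%:C = root (map_poly intr p) x.
  by rewrite (map_poly_intrE R) (map_poly_intrE R[i]) !rootE ratr_poly_real_complex fmorph_eq0.
by split=> -[p pm px]; exists p; rewrite // ?E // -E.
Qed.

Lemma conj_lt_towerP eps n x s : lv eps n x -> OO x ->
  conj_lt (ring_of_integers (towerK eps)) s%:E x%:C <->
  forall f : R -> R, hom (lv eps n) f -> 0 < f x < s.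
Proof.
move=> Kx Ox; have tK := lev_tower D eps n; split.
  move=> [_ H] f hf; have [r [->]] := H _ (hom_conjugate tK Kx hf).
  by rewrite !lte_fin.
move=> H; split; first by split; [exists n, x | apply/OO_complex].
move=> b /(conjugates_hom tK Kx)[f hf ->]; exists (f x) => //.
by rewrite !lte_fin; exact: H.
Qed.

Let M : int := Num.ceil (2 * w).

Let M_ge : 2 * w <= M%:~R. Proof. exact: ceil_ge. Qed.

Let M_lt : (M - 1)%:~R < 2 * w.
Proof. by rewrite intrB; have := ceilB1_lt (2 * w); rewrite intrB. Qed.

Let JRv : R := M%:~R + 2 * w.

Lemma JR_lower eps (s : R) : s < JRv ->
  finite_set (conj_lt (ring_of_integers (towerK eps)) s%:E).
Proof.
move=> sV; have M1 : (M - 1)%:~R = M%:~R - 1 :> R by rewrite intrB.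
(* The slack in [M - 1 < 2 * w] and in [s - 2 * w < M]; [t] is chosen so that replacing 2 by [2 - d]
   costs less. *)
pose e : R := Num.min (2 * w - (M - 1)%:~R) (JRv - s).
have e0 : 0 < e by rewrite lt_min !subr_gt0 M_lt sV.
have [t tE] : exists t : nat, 4 * w / e + 32 < 2 ^+ t.
  exists (Num.truncn (4 * w / e + 32)).+1.
  apply: (lt_trans (truncnS_gt _)); rewrite -natrX ltr_nat.
  exact: ltn_expl.
have t0 : 0 < 2 ^+ t :> R by rewrite exprn_gt0.
have we0 : 0 < 4 * w / e by rewrite divr_gt0 // mulr_gt0.
pose d : R := 4 / 2 ^+ t.
have d1 : d <= 1 / 8 by rewrite /d ler_pdivrMr //; move: tE we0; lra.
have d2 : w * d < e.
  rewrite /d mulrA ltr_pdivrMr // mulrC -ltr_pdivrMl // mulrC mulrC.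
  by rewrite mulrC; move: tE we0; rewrite (mulrC w) mulrC; lra.
have [e1 e2] : e <= 2 * w - (M - 1)%:~R /\ e <= JRv - s.
  by split; rewrite ge_min lexx ?orbT.
have lo : (M - 1)%:~R < w * (2 - d) by move: d2 e1; lra.
have hi : s - w * (2 - d) < M%:~R by move: d2 e2; rewrite /JRv; lra.
have tau : 15 / 8 <= 2 - d by move: d1; lra.
have s4 : s < 4 * w + 1 by move: sV M_lt; rewrite M1 /JRv; lra.
have fin := tower_finite s (lev_tower D eps (t.*2).+1).
apply: (sub_finite_set _ (finite_image (real_complex R) fin)).
move=> _ [[[n [x [Kx ->]]] /OO_complex Ox] H].
have Kn := lev_sub (leqnSn n) Kx.
have /(conj_lt_towerP _ Kn Ox) spread : conj_lt (ring_of_integers (towerK eps)) s%:E x%:C.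
  by split=> //; split; [exists n, x | apply/OO_complex].
exists x => //; have Kt := small_in_level s4 lo hi tau Kn Ox spread.
split=> // f hf; have := spread.
have sp := (conj_lt_towerP s Kt Ox).1 _ _ hf.
have /sp/andP[f0 fs] : conj_lt (ring_of_integers (towerK eps)) s%:E x%:C.
  by split=> //; split; [exists n, x | apply/OO_complex].
by move=> _; rewrite gtr0_norm // ltW.
Qed.

Lemma JR_upper eps :
  infinite_set (conj_lt (ring_of_integers (towerK eps)) JRv%:E).
Proof.
(* The shift by [j] ensures [j <= 2 ^ (n + j)], which makes [w * c] integral. *)
pose x n := M%:~R + w * c eps (n + j).
apply: (@infinite_inj _ _ (fun n => (x n)%:C)) => [n|].
  have Kc := lev_c D eps (n + j); have sK := lev_sf D eps (n + j).+1.
  have Kw := lev_w D eps (n + j).+1; have KM : lv eps (n + j).+1 M%:~R by exact: sf_int.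
  have Kwc := sfM sK Kw Kc.
  have Kx : lv eps (n + j).+1 (x n) by exact: (sfD sK).
  have Ox : OO (x n).
    apply: OOD; first exact: OO_int.
    apply: OO_wc; apply: (leq_trans (leq_addl n j)); exact: ltnW (ltn_expl _ _).
  apply/(conj_lt_towerP _ Kx Ox) => f hf.
  rewrite (homD sK hf KM Kwc) (hom_int sK hf) (homM hf Kw Kc).
  have hf1 := hom_sub (@lev_sub _ D eps 1 (n + j).+1 (ltn0Sn _)) hf.
  have fw := hom_wabs hf1; have fc := lev_hom_c hf.
  have : `|f w * f (c eps (n + j))| < 2 * w.
    rewrite normrM fw mulrC ltr_pM2r // -(@ltr_pXn2r _ 2) ?nnegrE ?normr_ge0 //.
    by rewrite real_normK ?num_real // -natrX.
  by rewrite ltr_norml => /andP[? ?]; apply/andP; split; move: M_ge; rewrite /JRv; lra.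
suff lt_inj n m : (n < m)%N -> x n <> x m.
  move=> n m [E]; case: (ltngtP n m) => // lt; first by case: (lt_inj _ _ lt).
  by case: (lt_inj _ _ lt).
move=> nm /addrI/(mulfI (lt0r_neq0 w0)) E.
apply: (@lev_nc _ D eps (m + j)); rewrite -E.
by apply: (lev_sub _ (lev_c D eps (n + j))); rewrite ltn_add2r.
Qed.

Lemma JR_towerK eps : JR (ring_of_integers (towerK eps)) = JRv%:E.
Proof.
apply/eqP; rewrite eq_le; apply/andP; split.
  by apply: ereal_inf_lbound; split=> //; exact: JR_upper.
apply: le_ereal_inf_tmp => t [tn inf]; rewrite leNgt; apply/negP => tV.
case: t tn inf tV => [s|//|] // _ inf; rewrite lte_fin => sV.
exact/inf/JR_lower.
Qed.

(* Flipping one sign changes the field: [2 + c] and [2 - c] are not both squares. *)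
Definition flip i (k : nat) := k == i.

Lemma ch_flip i i' : (i < i')%N -> c (flip i) i.+1 = - c (flip i') i.+1.
Proof.
move=> ii; have E n : (n <= i)%N -> c (flip i) n = c (flip i') n.
  elim: n => // n IH ni /=; rewrite IH ?(ltnW ni) // /flip.
  by rewrite !ltn_eqF //; exact: ltn_trans ii.
by rewrite /= E // /flip eqxx ltn_eqF // expr0 expr1 mul1r mulN1r.
Qed.

(** For [i < i'] the two sequences first differ at index [i.+1], by a sign. One field contains a
    root of [2 + c], which is [2 - c] for the other, excluded there by [lev_no_sqrt]. *)
Lemma towerK_flip_inj : injective (fun i => towerK (flip i)).
Proof.
suff lt_inj i i' : (i < i')%N -> towerK (flip i) <> towerK (flip i').
  move=> n m E; case: (ltngtP n m) => // lt; first by case: (lt_inj _ _ lt).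
  by case: (lt_inj _ _ lt).
move=> ii E; have : towerK (flip i) (c (flip i) i.+2)%:C.
  by exists i.+3, (c (flip i) i.+2); split=> //; exact: lev_c.
rewrite E => /towerK_real[n Kn].
apply: (@lev_no_sqrt _ D (flip i') i.+1 (maxn n i.+2) (c (flip i) i.+2)).
- by rewrite leq_max ltnSn orbT.
- by apply: (lev_sub _ Kn); exact: leq_maxl.
by rewrite cS_sqr (ch_flip ii).
Qed.

Lemma infinite_JR : infinite_set [set K : set R[i] |
  [/\ is_subfield K, K `<=` @Qtr R & JR (ring_of_integers K) = (M%:~R + 2 * w)%:E]].
Proof.
apply: (infinite_inj _ towerK_flip_inj) => i; split.
- exact: towerK_subfield.
- exact: towerK_Qtr.
- exact: JR_towerK.
Qed.

End Fields.

(** * Squarefree numbers and the arithmetic parameters *)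

Section Squarefree.
Implicit Types (n m d k p q r s t : nat).

Lemma squarefree_dvd_sqr q m : (0 < q)%N -> squarefree q -> (q %| m ^ 2)%N -> (q %| m)%N.
Proof.
move=> q0 sqf qm; pose g := gcdn q m.
have g0 : (0 < g)%N by rewrite gcdn_gt0 q0.
have [gq gm] : (g %| q)%N /\ (g %| m)%N by rewrite dvdn_gcdl dvdn_gcdr.
pose a := (q %/ g)%N; pose b := (m %/ g)%N.
have qE : q = (a * g)%N by rewrite divnK.
have mE : m = (b * g)%N by rewrite divnK.
have cop : coprime a b.
  by rewrite /coprime -(eqn_pmul2r g0) muln_gcdl mul1n -qE -mE.
have ag : (a %| g)%N.
  have : (a * g %| (b ^ 2 * g) * g)%N.
    by rewrite -qE -mulnA -(expnS g 1) -expnMn -mE.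
  by rewrite dvdn_pmul2r // Gauss_dvdr // coprimeXr.
have a1 : a = 1%N by apply: sqf; rewrite qE expnS expn1 dvdn_mul.
by rewrite qE a1 mul1n.
Qed.

Lemma squarefree_double t : odd t -> squarefree t -> squarefree (2 * t).
Proof.
move=> ot sqf d dv; have [od|ed] := boolP (odd d).
  by apply: sqf; move: dv; rewrite Gauss_dvdr // coprimeXl // coprimen2.
have : (2 ^ 2 %| 2 * t)%N by apply: dvdn_trans dv; rewrite dvdn_exp2r // dvdn2.
by rewrite -[(2 ^ 2)%N]/(2 * 2)%N dvdn_pmul2l // dvdn2 ot.
Qed.

Lemma squarefree_part n : (0 < n)%N -> exists s r, n = (s ^ 2 * r)%N /\ squarefree r.
Proof.
have [N] := ubnP n; elim: N n => // N IH n /ltnSE nN n0.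
have [sqf|nsqf] := pselect (squarefree n); first by exists 1%N, n; rewrite mul1n.
have [d [dn d1]] : exists d, (d ^ 2 %| n)%N /\ d <> 1%N.
  by apply: contrapT => H; apply: nsqf => d dn; apply: contrapT => d1; apply: H; exists d.
have d2 : (1 < d)%N by case: d dn d1 => [|[|d]] //; rewrite dvd0n gtn_eqF.
have nE := divnK dn; have n'0 : (0 < n %/ d ^ 2)%N.
  by rewrite divn_gt0 ?expn_gt0 ?(ltnW d2) // dvdn_leq.
have [|s [r [E sqf]]] := IH (n %/ d ^ 2)%N _ n'0.
  by apply: leq_trans nN; rewrite ltn_Pdiv // -(expn1 1) ltn_exp2r // -(exp1n 2) ltn_exp2r.
by exists (s * d)%N, r; rewrite expnMn mulnAC -E nE.
Qed.

Lemma odd_sqr_mod8 k : odd k -> (k ^ 2 %% 8 = 1)%N.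
Proof.
move=> ok; rewrite -modnXm; have : odd (k %% 8) by rewrite odd_mod.
by have := ltn_pmod k (isT : (0 < 8)%N); case: (k %% 8)%N => [|[|[|[|[|[|[|[|i]]]]]]]].
Qed.

Lemma sqr_mod8 k : (k ^ 2 %% 8)%N \in [:: 0; 1; 4]%N.
Proof.
rewrite -modnXm; have := ltn_pmod k (isT : (0 < 8)%N).
by case: (k %% 8)%N => [|[|[|[|[|[|[|[|i]]]]]]]].
Qed.

(* [r] is the squarefree part of [p * m], where [p] is a large prime and [m = 3 p] modulo [8]. *)
Lemma exists_squarefree_3mod8 t B : odd t -> exists r,
  [/\ (r %% 8 = 3)%N, squarefree r, coprime r (2 * t) & (B <= r)%N].
Proof.
move=> ot; have [p pB prp] := prime_above (B + (2 * t + (1 + 7 * t ^ 2)))%N.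
have t0 : (0 < t)%N by exact: odd_gt0.
(* [m] is 1 modulo [t] and 1 + 7 t^2 modulo [p], hence prime to both. So [p] divides [p * m] exactly
   once, survives in the squarefree part and makes it large. *)
pose m := (1 + (3 * p + 7) * t ^ 2)%N.
have op : odd p.
  case: (even_prime prp) => // p2; move: pB t0; rewrite p2; clear; lia.
have pt : (t < p)%N by move: pB t0; clear; nia.
have nmod : (p * m %% 8 = 3)%N.
  have := divn_eq (p ^ 2) 8; have := divn_eq (t ^ 2) 8.
  rewrite (odd_sqr_mod8 op) (odd_sqr_mod8 ot).
  move: (p ^ 2 %/ 8)%N (t ^ 2 %/ 8)%N => a b tE pE.
  have -> : (p * m = (p + 3 * a * (8 * b + 1) + 7 * p * b + 3 * b) * 8 + 3)%N.
    rewrite /m tE (_ : p * (1 + (3 * p + 7) * (b * 8 + 1)) =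
      p + (3 * p ^ 2 + 7 * p) * (b * 8 + 1))%N; last by ring.
    by rewrite pE; ring.
  by rewrite modnMDl.
have n0 : (0 < p * m)%N by rewrite muln_gt0 prime_gt0.
have [s [r [nE sqf]]] := squarefree_part n0.
have on : odd (p * m) by rewrite -(@odd_mod (p * m) 8) ?nmod.
have /andP[os or] : odd s && odd r by move: on; rewrite nE oddM oddX.
have rmod : (r %% 8 = 3)%N.
  by move: nmod; rewrite nE -modnMml (odd_sqr_mod8 os) mul1n.
have pr : (p %| r)%N.
  have : (p %| s ^ 2 * r)%N by rewrite -nE dvdn_mulr.
  rewrite Euclid_dvdM // Euclid_dvdX // andbT => /orP[ps|//]; exfalso.
  have : (p ^ 2 %| p * m)%N by rewrite nE dvdn_mulr // dvdn_exp2r.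
  rewrite expnS expn1 dvdn_pmul2l ?prime_gt0 // /m.
  have -> : (1 + (3 * p + 7) * t ^ 2 = 3 * t ^ 2 * p + (1 + 7 * t ^ 2))%N by lia.
  rewrite dvdn_addr ?dvdn_mull // => /dvdn_leq; move: pB; clear; lia.
exists r; split=> //; last first.
  have : (p <= r)%N by rewrite dvdn_leq // odd_gt0.
  by move: pB; clear; lia.
have cn : coprime (p * m) t.
  rewrite coprimeMl; apply/andP; split.
    rewrite prime_coprime //; apply/negP => /dvdn_leq; move: pt t0; clear; lia.
  by rewrite /m coprime_sym expnS expn1 mulnA addnC /coprime gcdnMDl gcdn1.
rewrite coprimeMr coprimen2 or /=; apply: coprime_dvdl cn.
by rewrite nE dvdn_mull.
Qed.

(** [i] is the integer part of log_h(r / 24). As it is at least 5, 4 h^(2i-1) is at least 4 * 2^3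
    times h^(i+1), which exceeds [r]. *)
Lemma exists_exponent h r : (2 <= h)%N -> (24 * h ^ 5 <= r)%N -> exists i,
  (0 < i)%N && (24 * h ^ i <= r < 4 * h ^ (2 * i).-1)%N.
Proof.
move=> h2 hr; pose i := trunc_log h (r %/ 24).
have r24 : (0 < r %/ 24)%N.
  by rewrite divn_gt0 // (leq_trans _ hr) // -{1}[24%N]muln1 leq_pmul2l // expn_gt0; case: (h) h2.
have /andP[lo hi] := trunc_log_bounds h2 r24; rewrite -/i in lo hi.
have i5 : (5 <= i)%N.
  apply: trunc_log_max => //; by rewrite leq_divRL // mulnC.
exists i; apply/andP; split; first exact: leq_trans i5.
apply/andP; split; first by move: lo; rewrite leq_divRL // mulnC.
move: hi; rewrite ltn_divLR // => hi; apply: leq_trans hi _.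
have -> : (2 * i).-1 = (i.+1 + (i - 2))%N by move: i5; clear; lia.
rewrite expnD mulnCA leq_mul2l; apply/orP; right.
have : (2 ^ 3 <= h ^ (i - 2))%N.
  apply: (@leq_trans (h ^ 3)%N); first by rewrite leq_exp2r.
  by rewrite leq_pexp2l //; move: i5 h2; clear; lia.
by clear; lia.
Qed.

End Squarefree.

(** * The base field Q *)

Section RationalBase.
Context {R : realType}.
Implicit Types (x y z : R) (n q r : nat).

Lemma rats_OO z : rats z -> OO z -> exists m : int, z = m%:~R.
Proof. by move=> [u ->] /OO_rat. Qed.

Lemma rats_sqr_nat y n : rats y -> y ^+ 2 = n%:R -> exists k, (k ^ 2)%N = n.
Proof.
move=> Ky E; have [|m mE] := rats_OO Ky.
  by apply: (@OO_rootX _ _ 2%N) => //; rewrite E; exact: OO_nat.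
exists `|m|%N; apply/eqP; rewrite -(eqr_nat R) natrX -E mE natr_absz intr_norm.
by rewrite real_normK ?num_real.
Qed.

Lemma rats_nsq_mod8 n y : (n %% 8)%N \notin [:: 0; 1; 4]%N -> rats y -> y ^+ 2 <> n%:R.
Proof.
by move=> nn Ky /(rats_sqr_nat Ky)[k kE]; move: nn; rewrite -kE sqr_mod8.
Qed.

Lemma rats_red n z y : (0 < n)%N -> squarefree n -> rats z -> OO z -> OO y ->
  z ^+ 2 = n%:R * y -> OO (z / n%:R).
Proof.
move=> n0 sqf Kz Oz Oy E; have n0' : n%:R != 0 :> R by rewrite pnatr_eq0 -lt0n.
have Ky : rats y.
  have -> : y = z ^+ 2 / n%:R by rewrite E mulrC mulKf.
  by apply: (sf_div rats_subfield); [exact: (sfX rats_subfield) | exact: (sf_nat rats_subfield)].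
have [m mE] := rats_OO Kz Oz; have [k kE] := rats_OO Ky Oy.
have {}E : m ^+ 2 = n%:Z * k.
  by apply: (@intr_inj R); rewrite rmorphXn rmorphM /= -mE -kE E.
have dv : (n %| `|m| ^ 2)%N by rewrite -abszX E abszM /= dvdn_mulr.
have /dvdnP[l lE] := squarefree_dvd_sqr n0 sqf dv.
have : OO (`|m|%N%:R / n%:R : R) by rewrite lE natrM mulfK //; exact: OO_nat.
rewrite mE; case: (intP m) => [|i|i]; rewrite ?abszN ?mulr0z ?mul0r //.
by move=> O; rewrite mulrNz mulNr; exact: OON.
Qed.

Lemma BB_even (w : R) h x : w ^+ 2 = h%:R -> BB w x -> exists k, OO (h%:R ^+ k * x).
Proof.
move=> w2 [k Ok]; exists k; rewrite -w2 -exprM.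
by apply: (BB_lift w2 _ Ok); rewrite mul2n -addnn leq_addr.
Qed.

Lemma even_BB (w : R) h x k : w ^+ 2 = h%:R -> OO (h%:R ^+ k * x) -> BB w x.
Proof. by move=> w2 Ok; exists (2 * k)%N; rewrite exprM w2. Qed.

Lemma SF_rats (w : R) h r : w ^+ 2 = h%:R -> (0 < r)%N -> squarefree r -> SF w rats r%:R.
Proof.
move=> w2 r0 sqf z y Kz Bz By E.
have [k Ok] := BB_even w2 Bz; have [m Om] := BB_even w2 By.
have Oh i : OO (h%:R ^+ i : R) by apply: OOX; exact: OO_nat.
apply: (@even_BB _ h _ (k + m)) => //; rewrite mulrA.
apply: (@rats_red r _ (h%:R ^+ (k + k + m) * (h%:R ^+ m * y))) => //.
- apply: (sfM rats_subfield) => //; apply: (sfX rats_subfield).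
  exact: (sf_nat rats_subfield).
- by rewrite exprD mulrAC mulrC; apply: OOM.
- by apply: OOM.
- by rewrite exprMn E !exprD; ring.
Qed.

End RationalBase.

(** * The base field Q(sqrt q) *)

Section QuadraticBase.
Context {R : realType} (q : nat) (w : R).
Hypotheses (w_sq : w ^+ 2 = q%:R) (q_gt0 : (0 < q)%N) (q_sqf : squarefree q)
  (w_irr : ~ rats w).
Notation E1 := (adj rats w).
Implicit Types (y z : R).

Let sQ : subfield rats := @rats_subfield R.
Let Kw2 : rats (w ^+ 2). Proof. by rewrite w_sq; exact: sf_nat. Qed.
Let q0 : q%:R != 0 :> R. Proof. by rewrite pnatr_eq0 -lt0n. Qed.
Let w0 : w != 0. Proof. by apply/eqP => E; move/eqP: w_sq; rewrite E expr0n eq_sym (negbTE q0). Qed.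
Let Ow : OO w. Proof. by apply: (@OO_rootX _ _ 2%N) => //; rewrite w_sq; exact: OO_nat. Qed.

Let conj_spec : exists g : R -> R, [/\ hom E1 g, g w = - w,
  forall z, E1 z -> OO z -> OO (g z), forall z, E1 z -> BB w z -> BB w (g z)
  & forall z, E1 z -> [/\ rats (z + g z), rats (z * g z) & rats ((z - g z) * w)]].
Proof.
have [g [hg gK gw gE]] := adj_conj sQ Kw2 w_irr.
have sA := adj_subfield sQ Kw2 w_irr; exists g; split=> //.
- by move=> z Kz Oz; exact: OO_hom sA hg Kz Oz.
- move=> z Kz Bz; have [k Ok] := BB_even w_sq Bz.
  apply: (@even_BB _ _ q _ k) => //.
  have Kk : E1 (q%:R ^+ k) by apply: (sfX sA); exact: (sf_nat sA).
  have -> : q%:R ^+ k * g z = g (q%:R ^+ k * z).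
    by rewrite (homM hg Kk Kz) (homX sA hg k (sf_nat sA q)) (hom_nat sA hg).
  by apply: (OO_hom sA hg _ Ok); exact: (sfM sA).
move=> z [u [v [Ku Kv ->]]]; rewrite gE //.
have K2 : rats (2 : R) by exact: (sf_nat sQ 2).
split.
- have -> : u + v * w + (u - v * w) = 2 * u by ring.
  exact: (sfM sQ).
- have -> : (u + v * w) * (u - v * w) = u ^+ 2 - v ^+ 2 * w ^+ 2 by ring.
  by apply: (sfB sQ); [exact: sfX | apply: (sfM sQ) => //; exact: sfX].
- have -> : (u + v * w - (u - v * w)) * w = 2 * v * w ^+ 2 by ring.
  by apply: (sfM sQ) => //; exact: (sfM sQ).
Qed.

(** The norm of [z], then the rationals [z + g z] and [(z - g z) * w], are divisible by [r] by the
    rational case; they recover [z] because 2 and [w] are units. *)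
Lemma SF_quadratic r : (2 %| q)%N -> (0 < r)%N -> squarefree r -> SF w E1 r%:R.
Proof.
move=> q2 r0 sqf z y Kz Bz By E.
have sA := adj_subfield sQ Kw2 w_irr; have r0' : r%:R != 0 :> R by rewrite pnatr_eq0 -lt0n.
have Kr := sf_nat sA r.
have Ky : E1 y.
  have -> : y = z ^+ 2 / r%:R by rewrite E mulrC mulKf.
  by apply: (sf_div sA) => //; exact: (sfX sA).
have [g [hg gw gO gB gK]] := conj_spec; have [KT KN KS] := gK _ Kz.
have Bgz := gB _ Kz Bz; have Bgy := gB _ Ky By.
have E' : g z ^+ 2 = r%:R * g y.
  by rewrite -(homX sA hg 2 Kz) E (homM hg Kr Ky) (hom_nat sA hg).
have BN : BB w (z * g z / r%:R).
  apply: (BB_sqr w_sq); rewrite expr_div_n exprMn E E'.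
  have -> : r%:R * y * (r%:R * g y) / r%:R ^+ 2 = y * g y by field.
  exact: BBM.
have B2 : BB w 2 by exact: BB_nat.
have Bq : BB w q%:R by exact: BB_nat.
have BT : BB w ((z + g z) / r%:R).
  apply: (@SF_rats _ w q r w_sq r0 sqf _ (y + g y + 2 * (z * g z / r%:R))) => //.
  - exact: (BBD w_sq).
  - by apply: (BBD w_sq); [exact: (BBD w_sq) | exact: BBM].
  - have -> : (z + g z) ^+ 2 = z ^+ 2 + g z ^+ 2 + 2 * (z * g z) by ring.
    by rewrite E E'; field.
have BS : BB w ((z - g z) * w / r%:R).
  apply: (@SF_rats _ w q r w_sq r0 sqf _ (q%:R * (y + g y - 2 * (z * g z / r%:R)))) => //.
  - by apply: BBM; [exact: (BBB w_sq) | exact: BB_OO].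
  - by apply: BBM => //; apply: (BBB w_sq); [exact: (BBD w_sq) | exact: BBM].
  - have -> : ((z - g z) * w) ^+ 2 = (z ^+ 2 + g z ^+ 2 - 2 * (z * g z)) * w ^+ 2 by ring.
    by rewrite E E' w_sq; field.
have Bh : BB w 2^-1 := BB_half w_sq q2.
have BV : BB w w^-1 by exists 1%N; rewrite expr1 mulfV //; exact: OO1.
have -> : z / r%:R = ((z + g z) / r%:R + (z - g z) * w / r%:R * w^-1) * 2^-1.
  by field; rewrite w0 r0'.
by apply: BBM => //; apply: (BBD w_sq) => //; exact: BBM.
Qed.

(** The trace [(z - g z) * w / q] and norm [- (z * g z / q)] of [z / w] are integral by the rational
    case. *)
Lemma quadratic_red z y : E1 z -> OO z -> OO y -> z ^+ 2 = w * y -> OO (z / w).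
Proof.
move=> Kz Oz Oy E; have sA := adj_subfield sQ Kw2 w_irr.
have Kw : E1 w by exact: adj_gen.
have Ky : E1 y.
  have -> : y = z ^+ 2 / w by rewrite E mulrC mulKf.
  by apply: (sf_div sA) => //; exact: (sfX sA).
have [g [hg gw gO _ gK]] := conj_spec.
have [KT KN KS] := gK _ Kz; have [_ KNy _] := gK _ Ky.
have Ogz := gO _ Kz Oz; have Ogy := gO _ Ky Oy.
have E' : g z ^+ 2 = - w * g y by rewrite -(homX sA hg 2 Kz) E (homM hg Kw Ky) gw.
have ON : OO (z * g z / q%:R).
  apply: (@rats_red _ q _ (- (y * g y))) => //; first exact: OOM.
    by apply: OON; exact: OOM.
  by rewrite exprMn E E' -w_sq; ring.
have OS : OO ((z - g z) * w / q%:R).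
  apply: (@rats_red _ q _ ((z - g z) ^+ 2)) => //.
  - by apply: OOM => //; exact: OOB.
  - by apply: OOX; exact: OOB.
  - by rewrite exprMn w_sq mulrC.
apply: (OO_quadratic OS (OON ON)).
by rewrite -w_sq; field.
Qed.

Lemma quadratic_tower : 0 < w -> tower E1.
Proof.
move=> wp; apply: tower_adj => //; first exact: tower_rats.
  by exists 1; rewrite // mul1r.
by move=> f hf; rewrite w_sq (hom_nat sQ hf) ltr0n.
Qed.

(** A root of [n] would make [n] or [n * q] a square; the first fails modulo 8, and the second is
    twice an odd number. *)
Lemma quadratic_nsq n y : q = (2 * q./2)%N -> odd q./2 -> odd n ->
  (n %% 8)%N \notin [:: 0; 1; 4]%N -> E1 y -> y ^+ 2 <> n%:R.
Proof.
move=> q2 oq on nn [u [v [Ku Kv ->]]] E.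
have [u0|v0] := adj_sqr_base sQ Kw2 w_irr Ku Kv (eq_ind_r rats (sf_nat sQ n) E).
  move: E; rewrite u0 add0r exprMn w_sq => E.
  have [k kE] : exists k, (k ^ 2 = n * q)%N.
    apply: (@rats_sqr_nat _ (v * q%:R)); first by apply: (sfM sQ) => //; exact: (sf_nat sQ).
    by rewrite exprMn [q%:R ^+ 2]expr2 mulrA E natrM.
  have k2 : (2 %| k)%N.
    have : (2 %| k ^ 2)%N by rewrite kE q2 dvdn_mull // dvdn_mulr.
    by rewrite Euclid_dvdX // andbT.
  have : (2 * 2 %| n * (2 * q./2))%N by rewrite -q2 -kE -[(2 * 2)%N]/(2 ^ 2)%N dvdn_exp2r.
  by rewrite mulnCA dvdn_pmul2l // dvdn2 oddM on oq.
by move: E; rewrite v0 mul0r addr0; exact: rats_nsq_mod8.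
Qed.

End QuadraticBase.

(** * Choosing the parameters and building the two data *)

Section Exponents.
Variables (t h : nat).
Hypotheses (t_odd : odd t) (h_even : (2 %| h)%N) (h_gt0 : (0 < h)%N)
  (h_cop : forall n, coprime n (2 * t) -> coprime n h).

(** As 8 divides [4 * h ^ j], [r = 3] modulo 8 forces [d = 5] and [r * d = 7], none of them squares.
    With [j = 2 * i - 1], [w ^+ j.+1] is [h ^ i], so the last clause is [d_big]. *)
Lemma exists_parameters : exists r d j,
  [/\ [/\ squarefree r, coprime r h, odd j & (d + r = 4 * h ^ j)%N],
      [/\ (r %% 8 = 3)%N, (d %% 8 = 5)%N & ((r * d) %% 8 = 7)%N] &
      exists2 i, j.+1 = (2 * i)%N & (24 * h ^ i <= r)%N].
Proof.
have h2 : (2 <= h)%N by exact: dvdn_leq.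
have [r [rmod sqf cop rB]] := exists_squarefree_3mod8 (24 * h ^ 5) t_odd.
have [i /and3P[i0 ri rj]] := exists_exponent h2 rB.
pose j := (2 * i).-1; have jE : j.+1 = (2 * i)%N by rewrite prednK // muln_gt0.
have h8 : (8 %| 4 * h ^ j)%N.
  rewrite (_ : 8 = 4 * 2)%N // dvdn_pmul2l //; apply: dvdn_trans h_even _.
  by apply: dvdn_exp => //; rewrite -ltnS jE; case: (i) i0 => // k _; rewrite mulnS.
have dmod : ((4 * h ^ j - r) %% 8 = 5)%N.
  have [k kE] := dvdnP h8; rewrite kE; move: (divn_eq r 8) rj; rewrite rmod -/j kE.
  move: (r %/ 8)%N => s -> sk.
  have -> : (k * 8 - (s * 8 + 3) = (k - s.+1) * 8 + 5)%N by move: sk; clear; lia.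
  by rewrite modnMDl.
exists r, (4 * h ^ j - r)%N, j; split.
- split=> //; first exact: h_cop.
    by have : odd j.+1 = false by [rewrite jE mul2n odd_double] => /= /negbFE.
  by rewrite subnK // ltnW.
- by split=> //; rewrite -modnMm rmod dmod.
- by exists i.
Qed.

End Exponents.

Section Instances.
Context {R : realType} (t : nat).
Hypotheses (t_odd : odd t) (t_sqf : squarefree t).
Let q := (2 * t)%N.
Let q_gt0 : (0 < q)%N. Proof. by rewrite muln_gt0 (odd_gt0 t_odd). Qed.
Let q_even : (2 %| q)%N. Proof. exact: dvdn_mulr. Qed.
Let q_sqf : squarefree q. Proof. exact: squarefree_double. Qed.

Lemma rational_datum : exists D : datum R, dw D = q%:R.
Proof.
have w2 : q%:R ^+ 2 = (q ^ 2)%:R :> R by rewrite natrX.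
have [||//|r [d [j [[r_sqf cop jo dE] [rm dm rdm] [i jE ri]]]]] :=
  @exists_parameters t (q ^ 2) t_odd.
- by rewrite dvdn_mulr.
- by rewrite expn_gt0 q_gt0.
- by move=> n cn; rewrite coprimeXr.
have r0 : (0 < r)%N by case: (r) rm.
unshelve eexists (@Datum R q%:R (q ^ 2) r d j rats _ w2 _ (@tower_rats R) _ jo _ _ cop dE _ _ _ _ _) => //.
- by rewrite ltr0n.
- by rewrite dvdn_mulr.
- exact: (sf_nat rats_subfield).
- by move=> z y; exact: rats_red.
- exact: SF_rats w2 r0 r_sqf.
- by rewrite -(@modn_dvdm 8) ?dm.
- by move=> y; apply: rats_nsq_mod8; rewrite rm.
- by move=> y; apply: rats_nsq_mod8; rewrite dm.
- by move=> y; apply: rats_nsq_mod8; rewrite rdm.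
- by rewrite jE exprM w2 -!natrX -natrM ler_nat.
Qed.

Lemma quadratic_datum : exists D : datum R, dw D = Num.sqrt q%:R.
Proof.
set w : R := Num.sqrt q%:R.
have w2 : w ^+ 2 = q%:R by rewrite sqr_sqrtr ?ler0n.
have w0 : 0 < w by rewrite sqrtr_gt0 ltr0n.
have qE : q = (2 * q./2)%N by rewrite /q mul2n doubleK mul2n.
have qo : odd q./2 by rewrite /q mul2n doubleK.
have nw : ~ rats w.
  move=> /rats_sqr_nat /(_ w2)[k kE].
  have k2 : (2 %| k)%N by move: q_even; rewrite -kE Euclid_dvdX // andbT.
  have : (2 * 2 %| 2 * t)%N by rewrite -[(2 * t)%N]kE -[(2 * 2)%N]/(2 ^ 2)%N dvdn_exp2r.
  by rewrite dvdn_pmul2l // dvdn2 t_odd.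
have [//|//|//|r [d [j [[r_sqf cop jo dE] [rm dm rdm] [i jE ri]]]]] :=
  @exists_parameters t q t_odd.
have r0 : (0 < r)%N by case: (r) rm.
have modo n k : (n %% 8 = k)%N -> odd k -> odd n by move=> <-; rewrite odd_mod.
unshelve eexists (@Datum R w q r d j (adj rats w) w0 w2 q_even (quadratic_tower w2 q_gt0 nw w0) _ jo _ _ cop dE _ _ _ _ _) => //.
- by apply: adj_gen; exact: rats_subfield.
- by move=> z y; exact: (quadratic_red w2 q_gt0 q_sqf nw).
- exact: (SF_quadratic w2 q_gt0 nw q_even r0 r_sqf).
- by rewrite -(@modn_dvdm 8) ?dm.
- by move=> y; apply: (quadratic_nsq w2 nw qE qo (modo _ _ rm isT)); rewrite rm.
- by move=> y; apply: (quadratic_nsq w2 nw qE qo (modo _ _ dm isT)); rewrite dm.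
- by move=> y; apply: (quadratic_nsq w2 nw qE qo (modo _ _ rdm isT)); rewrite rdm.
- by rewrite jE exprM w2 -!natrX -natrM ler_nat.
Qed.

End Instances.

Theorem theorem8p8 (R : realType) (t : nat)
    (t_ge1 : (1 <= t)%N) (t_odd : odd t) (t_sqf : squarefree t) :
  infinite_set [set K : set R[i] |
    [/\ is_subfield K, K `<=` @Qtr R
      & JR (ring_of_integers K) =
        ((Num.ceil (2 * Num.sqrt (2 * t%:R : R)))%:~R
           + 2 * Num.sqrt (2 * t%:R : R))%:E]]
  /\
  infinite_set [set K : set R[i] |
    [/\ is_subfield K, K `<=` @Qtr R
      & JR (ring_of_integers K) = (8 * t%:R : R)%:E]].
Proof.
split.
  have [D wE] := @quadratic_datum R _ t_odd t_sqf.
  by have := @infinite_JR R D; rewrite wE natrM.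
have [D wE] := @rational_datum R _ t_odd t_sqf.
have := @infinite_JR R D; rewrite wE.
(* For [w = 2 * t] the number [2 * w] is an integer, its own ceiling, so the value is 4t + 4t. *)
have -> : 2 * (2 * t)%:R = (4 * t)%N%:Z%:~R :> R by rewrite -pmulrn !natrM; ring.
by rewrite intrKceil -pmulrn natrM (_ : 4 * t%:R + 4 * t%:R = 8 * t%:R) //; ring.
Qed.
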